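(* Let $(P,\Pi)$ be an oriented Poisson manifold with a volume form $\mu$ and let $\Xi_\mu$ be the modular vector field with respect to $\mu$. Then for any $a$-vector field $A\in\mathfrak{X}^a(P)$, the modular operator with respect to $\mu$ satisfies \[ \Lambda_\mu^aA=\mathfrak{C}_\mu^{a+1}(\partial_\Pi^aA)-\partial_\Pi^{a-1}(\mathfrak{C}_\mu^aA)=(-1)^a[\Xi_\mu,A]_{\mathrm S}. \]
   Context: $n=\dim P$, $\mathfrak{X}^k(P)=\Gamma^\infty(\wedge^kTP)$, $\Omega^k(P)=\Gamma^\infty(\wedge^kT^*P)$; the pairing is $\langle\alpha_1\wedge\cdots\wedge\alpha_k,X_1\wedge\cdots\wedge X_k\rangle=\det(\alpha_i(X_j))$. Schouten bracket: for $A\in\mathfrak{X}^a$, $B\in\mathfrak{X}^b$, writing $A(F_1,\dots,F_a)=A(dF_1,\dots,dF_a)$, \[ \begin{aligned}[] [A,B]_{\mathrm S}(F_1,\dots,F_{a+b-1})&=\sum_{\sigma\in\mathfrak{S}_{b,a-1}}\mathrm{sgn}(\sigma)A\bigl(B(F_{\sigma(1)},\dots,F_{\sigma(b)}),F_{\sigma(b+1)},\dots,F_{\sigma(a+b-1)}\bigr)\\&\quad-(-1)^{(a-1)(b-1)}\sum_{\sigma\in\mathfrak{S}_{a,b-1}}\mathrm{sgn}(\sigma)B\bigl(A(F_{\sigma(1)},\dots,F_{\sigma(a)}),F_{\sigma(a+1)},\dots,F_{\sigma(a+b-1)}\bigr),\end{aligned} \] where $\mathfrak{S}_{p,q}$ is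 the set of $(p,q)$-shuffles (empty sum if $p$ or $q$ is negative). The Poisson coboundary operator is $\partial_\Pi^a:\mathfrak{X}^a(P)\to\mathfrak{X}^{a+1}(P)$, $\partial_\Pi^a(A)=-[A,\Pi]_{\mathrm S}$. For $A\in\mathfrak{X}^a(P)$ and $\eta\in\Omega^p(P)$ with $p\ge a$, $i(A)\eta\in\Omega^{p-a}(P)$ is given by $\langle i(A)\eta,B\rangle=\langle\eta,A\wedge B\rangle$ for all $(p-a)$-vector fields $B$ (and $i(A)\eta=0$ if $p<a$). $\mu^\flat(A)=i(A)\mu$ is an isomorphism $\mathfrak{X}^a(P)\to\Omega^{n-a}(P)$ with inverse $\mu^\sharp$, and the curl operator is $\mathfrak{C}_\mu^a=\mu^\sharp\circ d\circ\mu^\flat:\mathfrak{X}^a(P)\to\mathfrak{X}^{a-1}(P)$. The modular vector field $\Xi_\mu$ is the vector field with $\mathcal{L}_\Pi\mu=i(\Xi_\mu)\mu$, where $\mathcal{L}_\Pi=i(\Pi)\circ d-d\circ i(\Pi)$. The $a$-th modular operator is $\Lambda_\mu^a=\mathfrak{C}_\mu^{a+1}\circ\partial_\Pi^a-\partial_\Pi^{a-1}\circ\mathfrak{C}_\mu^a:\mathfrak{X}^a(P)\to\mathfrak{X}^a(P)$. *)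

(* Defs.v *)
From HB Require Import structures.
From mathcomp Require Import all_boot all_order all_algebra all_fingroup.
From mathcomp Require Import all_classical all_reals all_analysis.

Set Implicit Arguments.
Unset Strict Implicit.
Unset Printing Implicit Defensive.

Import Order.TTheory GRing.Theory Num.Theory.
Import numFieldNormedType.Exports.

Local Open Scope classical_set_scope.
Local Open Scope ring_scope.

Section Smooth.
Variables (R : realType) (n : nat).
Implicit Types (U : set 'rV[R]_n) (f g : 'rV[R]_n -> R).

Definition unit_vec (i : 'I_n) : 'rV[R]_n := delta_mx 0 i.

Fixpoint Ck U (k : nat) f : Prop :=
  (forall x, U x -> {for x, continuous f}) /\
  (if k is k'.+1 then
     forall i, (forall x, U x -> derivable f x (unit_vec i)) /\
               Ck U k' ('D_(unit_vec i) f)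
   else True).

Definition smooth_on U f : Prop := forall k, Ck U k f.

Lemma Ck_eq U k f g : open U -> (forall x, U x -> f x = g x) ->
  Ck U k f -> Ck U k g.
Proof.
move=> oU; elim: k f g => [|k IH] f g fg /= [fc fd].
all: have nfg x : U x -> \near x, f x = g x
  by move=> Ux; near=> y; apply: fg; near: y; exact: open_nbhs_nbhs.
all: have gc x : U x -> {for x, continuous g}
  by move=> Ux; rewrite /prop_for /continuous_at -(fg x Ux);
     apply: cvg_trans (fc x Ux); exact: near_eq_cvg (nfg x Ux).
- by split.
split=> // i; have [d c] := fd i; split=> [x Ux|].
  by apply: near_eq_derivable (d x Ux); exact: nfg.
by apply: IH c => x Ux; apply: near_eq_derive; exact: nfg.
Unshelve. all: by end_near. Qed.

Lemma CkS U k f : Ck U k.+1 f -> Ck U k f.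
Proof.
elim: k f => [|k IH] f [fc fd]; split=> // i.
by have [d c] := fd i; split=> //; exact: IH.
Qed.

Lemma Ck_cst U k (a : R) : open U -> Ck U k (cst a).
Proof.
have cc (b : R) x : U x -> {for x, continuous (cst b : 'rV[R]_n -> R)}.
  by move=> _; exact: cst_continuous.
move=> oU; elim: k a => [|k IH] a; first by split=> // x; exact: cc.
split=> [x|i]; first exact: cc.
split=> [x _|]; first exact: derivable_cst.
by apply: Ck_eq (IH 0) => // x _; rewrite derive_cst.
Qed.

Lemma CkB U k f g : open U -> Ck U k f -> Ck U k g -> Ck U k (f - g).
Proof.
move=> oU; elim: k f g => [|k IH] f g [fc fd] [gc gd].
  by split=> // x Ux; apply: continuousB; [exact: fc | exact: gc].
split=> [x Ux|i]; first by apply: continuousB; [exact: fc | exact: gc].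
have [df cf] := fd i; have [dg cg] := gd i; split=> [x Ux|].
  by apply: derivableB; [exact: df | exact: dg].
by apply: Ck_eq (IH _ _ cf cg) => // x Ux; rewrite deriveB; auto.
Qed.

Lemma CkD U k f g : open U -> Ck U k f -> Ck U k g -> Ck U k (f + g).
Proof.
move=> oU cf cg; have -> : f + g = f - (cst 0 - g).
  by apply/funext => x /=; rewrite !fctE sub0r opprK.
by do 2!apply: CkB => //; exact: Ck_cst.
Qed.

Lemma CkM U k f g : open U -> Ck U k f -> Ck U k g -> Ck U k (f * g).
Proof.
move=> oU; elim: k f g => [|k IH] f g cf' cg'.
  split=> // x Ux; apply: continuousM.
    by case: cf' => c _; exact: c.
  by case: cg' => c _; exact: c.
have [fc fd] := cf'; have [gc gd] := cg'; split=> [x Ux|i].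
  by apply: continuousM; [exact: fc | exact: gc].
have [df cf] := fd i; have [dg cg] := gd i; split=> [x Ux|].
  by apply: derivableM; [exact: df | exact: dg].
have c2 := CkD oU (IH _ _ (CkS cf') cg) (IH _ _ (CkS cg') cf).
by apply: Ck_eq c2 => // x Ux; rewrite deriveM; auto.
Qed.

End Smooth.

(* [cmap] and [cinv] are total; only their restrictions to [cdom] and to
   [cmap @` cdom] matter. *)
Record chart (R : realType) (n : nat) (T : topologicalType) := Chart {
  cdom : set T;
  cmap : T -> 'rV[R]_n;
  cinv : 'rV[R]_n -> T;
  cdom_open : open cdom;
  cimg_open : open (cmap @` cdom);
  cmapK : forall x, cdom x -> cinv (cmap x) = x;
  cmap_continuous : forall x, cdom x -> {for x, continuous cmap};
  cinv_continuous : forall y, (cmap @` cdom) y -> {for y, continuous cinv} }.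

Arguments cdom_open {R n T} c.
Arguments cimg_open {R n T} c.

(* The atlas need not be maximal. *)
Record manifold (R : realType) (n : nat) := Manifold {
  points :> topologicalType;
  atlas : set (chart R n points);
  points_hausdorff : hausdorff_space points;
  points_second_countable : @second_countable points;
  atlas_cover : forall x, exists2 c, atlas c & cdom c x;
  atlas_compatible : forall c c', atlas c -> atlas c' -> forall j,
    smooth_on (cmap c @` (cdom c `&` cdom c'))
              (fun y => cmap c' (cinv c y) 0 j) }.

Section Manifold.
Variables (R : realType) (n : nat) (M : manifold R n).

(* An orientation given by an oriented atlas. *)
Definition oriented : Prop :=
  forall c c' : chart R n M, atlas c -> atlas c' ->
  forall x, cdom c x -> cdom c' x ->
  0 < \det (\matrix_(i < n, j < n)
        'D_(unit_vec R i) (fun y => cmap c' (cinv c y) 0 j) (cmap c x)).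

Definition smooth (f : M -> R) : Prop :=
  forall c : chart R n M, atlas c ->
  smooth_on (cmap c @` cdom c) (f \o cinv c).

Definition smooth_pred : {pred M -> R} := fun f => `[< smooth f >].

Lemma smooth_subring : subring_closed smooth_pred.
Proof.
split=> [|f g /asboolP sf /asboolP sg|f g /asboolP sf /asboolP sg];
  apply/asboolP => c ac k.
- apply: (Ck_eq (cimg_open c) _ (Ck_cst k 1 (cimg_open c))) => //.
- apply: (Ck_eq (cimg_open c) _ (CkB (cimg_open c) (sf c ac k) (sg c ac k))) => //.
- apply: (Ck_eq (cimg_open c) _ (CkM (cimg_open c) (sf c ac k) (sg c ac k))) => //.
Qed.

Record Cinf := MkCinf { fun_of_Cinf :> M -> R; _ : fun_of_Cinf \in smooth_pred }.

HB.instance Definition _ := [isSub of Cinf for fun_of_Cinf].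
HB.instance Definition _ := [Choice of Cinf by <:].
HB.instance Definition _ :=
  GRing.SubChoice_isSubComPzRing.Build (M -> R) smooth_pred Cinf smooth_subring.

Definition to_Cinf (f : M -> R) : Cinf := insubd (0 : Cinf) f.

(* T_xM is spanned by the coordinate derivations at x of a chart around x. *)
Definition tangent (x : M) (v : Cinf -> R) : Prop :=
  exists c : chart R n M, [/\ atlas c, cdom c x &
    exists u : 'rV[R]_n,
      forall F : Cinf, v F = 'D_u (F \o cinv c) (cmap c x)].

Definition tangents (x : M) (k : nat) (vs : seq (Cinf -> R)) : Prop :=
  size vs = k /\ forall i, (i < k)%N -> tangent x vs`_i.

(** k-vectors at x are represented by their values on exact covectors,
    w [:: F_1; ..; F_k] = w(d_xF_1, .., d_xF_k); every covector at x is d_xF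
    for some smooth F. *)

(* (v_1 /\ .. /\ v_k)(dF_1, .., dF_k) = det (v_i(F_j)) *)
Definition wedge_vectors (vs : seq (Cinf -> R)) (F : seq Cinf) : R :=
  \det (\matrix_(i < size vs, j < size vs) (vs`_i) F`_j).

(* w is the sum over the (r, vs) in l of r v_1 /\ .. /\ v_k *)
Definition decomposition (x : M) (k : nat) (w : seq Cinf -> R)
    (l : seq (R * seq (Cinf -> R))) : Prop :=
  (forall t, t \in l -> tangents x k t.2) /\
  (forall F : seq Cinf, size F = k ->
     w F = \sum_(t <- l) t.1 * wedge_vectors t.2 F).

Definition kvector (x : M) (k : nat) (w : seq Cinf -> R) : Prop :=
  exists l, decomposition x k w l.

(** Multivector fields: A [:: F_1; ..; F_k] = A(dF_1, .., dF_k). *)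

Definition mvfield := seq Cinf -> Cinf.

Definition mv_at (A : mvfield) (x : M) : seq Cinf -> R := fun F => A F x.

(* Smoothness of the section is the smoothness of every A(dF_1, .., dF_k).
   The values of A on sequences of another length are irrelevant. *)
Definition multivector (k : nat) (A : mvfield) : Prop :=
  forall x, kvector x k (mv_at A x).

Definition vf_at (x : M) (X : Cinf -> Cinf) : Cinf -> R := fun F => X F x.

Definition vector_field (X : Cinf -> Cinf) : Prop :=
  forall x, tangent x (vf_at x X).

Definition vector_fields (k : nat) (Xs : seq (Cinf -> Cinf)) : Prop :=
  size Xs = k /\ forall i, (i < k)%N -> vector_field Xs`_i.

(** Differential forms: sections of /\^k T^*M, the fibre at x being the
    alternating k-linear forms on T_xM via
    (alpha_1 /\ .. /\ alpha_k)(v_1, .., v_k) = det (alpha_i(v_j)). *)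

Definition dform := M -> seq (Cinf -> R) -> R.

Definition alternating (x : M) (k : nat) (alpha : seq (Cinf -> R) -> R) : Prop :=
  (forall vs i v w (r : R), tangents x k vs -> (i < k)%N ->
     tangent x v -> tangent x w ->
     alpha (set_nth 0 vs i (fun F => r * v F + w F)) =
     r * alpha (set_nth 0 vs i v) + alpha (set_nth 0 vs i w)) /\
  (forall vs i j, tangents x k vs -> (i < j < k)%N -> vs`_i = vs`_j ->
     alpha vs = 0).

Definition form (k : nat) (eta : dform) : Prop :=
  (forall x, alternating x k (eta x)) /\
  (forall Xs, vector_fields k Xs ->
     smooth (fun x => eta x [seq vf_at x X | X <- Xs])).

Definition eq_form (k : nat) (eta omega : dform) : Prop :=
  forall x vs, tangents x k vs -> eta x vs = omega x vs.

(* <alpha, w> at x: bilinear, with <alpha, v_1 /\ .. /\ v_k> =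
   alpha(v_1, .., v_k); it does not depend on the decomposition of w. *)
Definition pairing (k : nat) (x : M) (alpha : seq (Cinf -> R) -> R)
    (w : seq Cinf -> R) : R :=
  get [set r | exists2 l, decomposition x k w l &
                          r = \sum_(t <- l) t.1 * alpha t.2].

Definition shuffle (p q m : nat) (s : 'S_m) : bool :=
  (p + q == m)%N &&
  [forall i : 'I_m, forall j : 'I_m,
     ((i < j)%N && ((j < p) || (p <= i))%N) ==> (s i < s j)%N].

(* [:: F_(s 1); ..; F_(s m)] *)
Definition permute (F : seq Cinf) (s : 'S_(size F)) : seq Cinf :=
  [seq F`_(s i) | i <- enum 'I_(size F)].

Definition wedge (a b : nat) (w w' : seq Cinf -> R) : seq Cinf -> R :=
  fun F => \sum_(s : 'S_(size F) | shuffle a b s)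
    (-1) ^+ s * w (take a (permute s)) * w' (drop a (permute s)).

(* (-1)^((a+1)(b+1)) = (-1)^((a-1)(b-1)) *)
Definition schouten (a b : nat) (A B : mvfield) : mvfield := fun F =>
  (if a is a'.+1 then
     \sum_(s : 'S_(size F) | shuffle b a' s)
       (-1) ^+ s * A (B (take b (permute s)) :: drop b (permute s))
   else 0)
  - (-1) ^+ (a.+1 * b.+1) *
  (if b is b'.+1 then
     \sum_(s : 'S_(size F) | shuffle a b' s)
       (-1) ^+ s * B (A (take a (permute s)) :: drop a (permute s))
   else 0).

Definition omit (T : Type) (i : nat) (s : seq T) : seq T :=
  take i s ++ drop i.+1 s.

Definition lie_bracket (X Y : Cinf -> Cinf) : Cinf -> Cinf :=
  fun F => X (Y F) - Y (X F).

(* Koszul formula for (d eta)(X_0, .., X_k) at x *)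
Definition koszul (eta : dform) (Xs : seq (Cinf -> Cinf)) (x : M) : R :=
  \sum_(i < size Xs) (-1) ^+ i *
    (Xs`_i) (to_Cinf (fun y => eta y [seq vf_at y X | X <- omit i Xs])) x
  + \sum_(j < size Xs) \sum_(i < j) (-1) ^+ (i + j) *
    eta x [seq vf_at x X | X <- lie_bracket Xs`_i Xs`_j :: omit i (omit j Xs)].

(* Evaluated on any vector fields extending the given tangent vectors. *)
Definition extd (eta : dform) : dform := fun x vs =>
  get [set r | exists Xs, [/\ vector_fields (size vs) Xs,
                 [seq vf_at x X | X <- Xs] = vs & r = koszul eta Xs x]].

(** Contraction, for A of degree a and eta of degree p:
    (i(A)eta)(v_1, .., v_(p-a)) = <i(A)eta, B> = <eta, A /\ B>
    with B = v_1 /\ .. /\ v_(p-a). *)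
Definition contract (p a : nat) (A : mvfield) (eta : dform) : dform :=
  fun x vs =>
    if (a <= p)%N then
      pairing p x (eta x) (wedge a (p - a) (mv_at A x) (wedge_vectors vs))
    else 0.

Definition poisson (Pi : mvfield) : Prop :=
  multivector 2 Pi /\ forall F, size F = 3 -> schouten 2 2 Pi Pi F = 0.

Definition volume_form (mu : dform) : Prop :=
  form n mu /\ forall x, exists2 vs, tangents x n vs & mu x vs != 0.

Definition partial (Pi : mvfield) (a : nat) (A : mvfield) : mvfield :=
  fun F => - schouten a 2 A Pi F.

Definition mu_flat (mu : dform) (a : nat) (A : mvfield) : dform :=
  contract n a A mu.

(* Inverse of mu_flat on fields of degree a. For a > n the truncated n - a is
   0, which is harmless: curl then only uses it where eta x [::] = 0. *)
Definition mu_sharp (mu : dform) (a : nat) (eta : dform) : mvfield :=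
  xget (fun=> 0)
    [set B : mvfield | multivector a B /\ eq_form (n - a) (mu_flat mu a B) eta].

(* Fields of degree -1 are zero. *)
Definition curl (mu : dform) (a : nat) (A : mvfield) : mvfield :=
  if a is a'.+1 then mu_sharp mu a' (extd (mu_flat mu a A)) else fun=> 0.

(* L_Pi = i(Pi) o d - d o i(Pi) on forms of degree p *)
Definition lie_Pi (Pi : mvfield) (p : nat) (eta : dform) : dform := fun x vs =>
  contract p.+1 2 Pi (extd eta) x vs - extd (contract p 2 Pi eta) x vs.

Definition modular_field (Pi : mvfield) (mu : dform) : mvfield :=
  xget (fun=> 0)
    [set Xi : mvfield | multivector 1 Xi /\
       eq_form (n - 1) (lie_Pi Pi n mu) (contract n 1 Xi mu)].

(* For a = 0 the second term vanishes since curl mu 0 A = 0. *)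
Definition modular_op (Pi : mvfield) (mu : dform) (a : nat) (A : mvfield)
    : mvfield :=
  fun F => curl mu a.+1 (partial Pi a A) F - partial Pi a.-1 (curl mu a A) F.

End Manifold.

(* Main.v *)
(** On a coordinate domain with volume form mu = g dx_1 .. dx_n, the curl of A is
    the divergence (1 / g) sum_i d_i (g A(F_1, .., F_(a-1), x_i)) in the last
    argument: Cartan's formula, used once for each vector field inserted in the
    form, gives d (i(A) mu) = i(C A) mu from the identities
    C (A /\ X) = L_X A + (div X) A - (C A) /\ X and
    X (mu (W)) = mu (L_X W) + (div X) mu (W).
    In particular Xi = - C Pi, and the Hamiltonian field X_f = Pi(df, .) has
    divergence - Xi f. Writing i_f for the insertion of df in the first argument,
    one has i_f C = C i_f, i_f [A, Pi] = - [i_f A, Pi] - L_(X_f) A and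
    C L_X A = L_X C A - A(.., d (div X)), from which the theorem follows by
    induction on the degree of A.

    The globally defined functions, vector fields and curls that the definitions
    ask for are obtained with bump functions, and the vector fields are compared
    with partial derivatives through the mean value theorem. *)
From HB Require Import structures.
From mathcomp Require Import all_boot all_order all_algebra all_fingroup.
From mathcomp Require Import all_classical all_reals all_analysis.
From mathcomp Require Import ring lra zify.
Require Import Defs.

Set Implicit Arguments.
Unset Strict Implicit.
Unset Printing Implicit Defensive.

Import Order.TTheory GRing.Theory Num.Theory.
Import numFieldNormedType.Exports.

Local Open Scope classical_set_scope.
Local Open Scope ring_scope.

(** * Shuffle sums and wedge products *)

(** The definitions evaluate multivectors on functions of the whole manifold, where in general no
    frame exists, while the identities need commuting derivations [E i], functions [x j] dual to
    them and an inverse of the density. The calculus is therefore done over an arbitrary commutative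
    ring with such data (free of 2-torsion, for alternation), and applied to the restrictions to a
    coordinate domain of global smooth functions. These, rather than all smooth functions on the
    domain, are taken because each lifts to an argument that the given operators accept; locality of
    tangent vectors makes the choice of lift irrelevant. Sums over shuffle permutations are unsuited
    to induction on the arguments and give way to the recursion [shs], with value 0 in a wrong
    degree. The pairing, d, the curl and the modular field are defined by choice: each has to be
    shown to exist, and its value not to depend on the choice. For the curl and the modular field
    the latter is the injectivity of A -> i(A) mu at every point. *)

Section Shuffles.
Variables (K : Type) (L : comPzRingType).
Implicit Types (F U V : seq K) (T : seq K -> seq K -> L) (w : seq K -> L).

(* The signed sum of T U V over all ways of splitting F into two complementary
   subsequences U and V. The degrees do not appear: T vanishes on the sizes
   that are not meant. *)
Fixpoint shs T F : L :=
  if F is f :: F' then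
    shs (fun U V => T (f :: U) V) F' +
    shs (fun U V => (-1) ^+ size U * T U (f :: V)) F'
  else T [::] [::].

Lemma shs_ext T T' F :
  (forall U V, (size U + size V)%N = size F -> T U V = T' U V) ->
  shs T F = shs T' F.
Proof.
elim: F T T' => [|f F IH] T T' TT' /=; first exact: TT'.
congr (_ + _); apply: IH => U V UV; first by rewrite TT' //= addSn UV.
by rewrite TT' //= addnS UV.
Qed.

Lemma shs_eq T T' F : (forall U V, T U V = T' U V) -> shs T F = shs T' F.
Proof. by move=> TT'; apply: shs_ext. Qed.

Lemma shsD T T' F : shs (fun U V => T U V + T' U V) F = shs T F + shs T' F.
Proof.
elim: F T T' => //= f F IH T T'; rewrite IH addrACA; congr (_ + _).
by rewrite -IH; apply: shs_eq => U V; rewrite mulrDr.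
Qed.

Lemma shsZ c T F : shs (fun U V => c * T U V) F = c * shs T F.
Proof.
elim: F T => //= f F IH T; rewrite IH mulrDr; congr (_ + _).
by rewrite -IH; apply: shs_eq => U V; rewrite mulrCA.
Qed.

Lemma shs0 F : shs (fun _ _ => 0) F = 0.
Proof. by rewrite -[RHS](mul0r (shs (fun _ _ => 0) F)) -shsZ; apply: shs_eq => U V; rewrite mul0r. Qed.

Lemma shsN T F : shs (fun U V => - T U V) F = - shs T F.
Proof. by rewrite -mulN1r -shsZ; apply: shs_eq => U V; rewrite mulN1r. Qed.

Lemma shs_sum (I : Type) (r : seq I) (T : I -> seq K -> seq K -> L) F :
  shs (fun U V => \sum_(i <- r) T i U V) F = \sum_(i <- r) shs (T i) F.
Proof.
elim: r => [|i r IH]; first by rewrite big_nil -[RHS](shs0 F); apply: shs_eq => U V; rewrite big_nil.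
by rewrite big_cons -IH -shsD; apply: shs_eq => U V; rewrite big_cons.
Qed.

Lemma shs_nil_l T F : (forall u U V, T (u :: U) V = 0) -> shs T F = T [::] F.
Proof.
elim: F T => //= f F IH T T0.
rewrite IH => [|u U V]; last by rewrite T0.
rewrite T0 add0r IH ?expr0 ?mul1r // => u U V; by rewrite T0 mulr0.
Qed.

Lemma shs_nil_r T F : (forall U v V, T U (v :: V) = 0) -> shs T F = T F [::].
Proof.
elim: F T => //= f F IH T T0.
rewrite IH; last by move=> U v V; rewrite T0.
rewrite [X in _ + X](_ : _ = 0) ?addr0 // -[RHS](shs0 F).
by apply: shs_eq => U V; rewrite T0 mulr0.
Qed.

(** Both sides run over the splittings of F into three subsequences; the signs count the same
    inversions, grouped differently. *)
Lemma shs_assoc (T : seq K -> seq K -> seq K -> L) F :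
  shs (fun U V => shs (T U) V) F =
  shs (fun W V => shs (fun U1 U2 => T U1 U2 V) W) F.
Proof.
elim: F T => //= f F IH T; rewrite (IH (fun U => T (f :: U))).
under [X in _ + X = _]shs_eq => U V do rewrite mulrDr -!shsZ.
have /= e1 := IH (fun U V1 V2 => (-1) ^+ size U * T U (f :: V1) V2).
have /= e2 := IH (fun U V1 V2 =>
  (-1) ^+ size U * ((-1) ^+ size V1 * T U V1 (f :: V2))).
rewrite [X in _ + X = _]shsD e1 e2 [X in _ = X + _]shsD addrA; congr (_ + _).
apply: shs_eq => W V; rewrite -shsZ; apply: shs_ext => U1 U2 s.
by rewrite mulrA -exprD s.
Qed.

(** The sign counts the transpositions that move one block across the other. *)
Lemma shs_comm T F :
  shs T F = shs (fun U V => (-1) ^+ (size U * size V) * T V U) F.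
Proof.
elim: F T => [|f F IH] T /=; first by rewrite mul1r.
rewrite addrC; congr (_ + _); rewrite IH; apply: shs_eq => U V.
  by rewrite mulrA -exprD mulSn addnC.
by rewrite mulrA mulnS exprD mulrA -expr2 sqrr_sign mul1r.
Qed.

(** When the last entry joins U it has to cross all of V; when it joins V it crosses nothing. *)
Lemma shs_rcons T F z :
  shs T (rcons F z) = shs (fun U V => T U (rcons V z)) F +
                      shs (fun U V => (-1) ^+ size V * T (rcons U z) V) F.
Proof.
elim: F T => [|f F IH] T /=; first by rewrite !mul1r addrC.
rewrite !IH -!addrA; congr (_ + _); rewrite [in LHS]addrCA; congr (_ + _).
congr (_ + _); apply: shs_eq => U V /=.
by rewrite size_rcons !mulrA -!exprD !addnS addnC.
Qed.

Definition alt w := forall s f g t,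
  w (s ++ f :: g :: t) = - w (s ++ g :: f :: t).

(** If two neighbours land in the same subsequence, alternation of [T] applies; the two cases where
    they are separated are exchanged, with opposite signs. *)
Lemma shs_alt T : (forall V, alt (T ^~ V)) -> (forall U, alt (T U)) ->
  alt (shs T).
Proof.
move=> al ar s; elim: s T al ar => [|h s IH] T al ar f g t /=.
  rewrite !opprD -!shsN -!addrA; congr (_ + _).
    by apply: shs_eq => U V; exact: (al V [::]).
  rewrite [LHS]addrCA; congr (_ + _).
    by apply: shs_eq => U V; rewrite exprS !mulN1r mulNr.
  congr (_ + _).
    by apply: shs_eq => U V; rewrite exprS !mulN1r mulNr opprK.
  by apply: shs_eq => U V; rewrite -!mulrN; congr (_ * (_ * _)); exact: (ar U [::]).
rewrite opprD; congr (_ + _); apply: IH => // U s' f' g' t'.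
- exact: (al U (h :: s')).
- by rewrite !size_cat /= (al _ s') mulrN.
- by rewrite (ar U (h :: s')) mulrN.
Qed.

(* Multivectors and forms are extended by 0 to the sequences of a wrong size. *)
Definition hom (k : nat) w := forall F, size F != k -> w F = 0.

Lemma shs_hom T k :
  (forall U V, (size U + size V)%N != k -> T U V = 0) -> hom k (shs T).
Proof.
move=> T0 F Fk; rewrite -[RHS](shs0 F); apply: shs_ext => U V UV.
by rewrite T0 // UV.
Qed.

Definition wdg w w' := shs (fun U V => w U * w' V).

Definition ins (f : K) w : seq K -> L := fun F => w (f :: F).

Lemma hom_sign k w U : hom k w -> (-1) ^+ size U * w U = (-1) ^+ k * w U.
Proof.
by move=> hw; have [->//|Uk] := eqVneq (size U) k; rewrite hw ?mulr0.
Qed.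

(** Insertion of a function is an antiderivation of the wedge product. *)
Lemma wdg_cons k w w' f F : hom k w ->
  wdg w w' (f :: F) = wdg (ins f w) w' F + (-1) ^+ k * wdg w (ins f w') F.
Proof.
move=> hw; rewrite /wdg /= -[in RHS]shsZ; congr (_ + _); apply: shs_eq => U V.
by rewrite !mulrA (hom_sign _ hw).
Qed.

Lemma wdg_assoc u v w : wdg u (wdg v w) = wdg (wdg u v) w.
Proof.
apply/funext => F; rewrite /wdg.
under shs_eq => U V do rewrite -shsZ.
rewrite shs_assoc; apply: shs_eq => U V; rewrite mulrC -shsZ.
by apply: shs_eq => U1 U2; rewrite mulrA mulrC.
Qed.

Lemma wdg_comm a b w w' F : hom a w -> hom b w' ->
  wdg w w' F = (-1) ^+ (a * b) * wdg w' w F.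
Proof.
move=> hw hw'; rewrite /wdg shs_comm -shsZ; apply: shs_eq => U V.
have [<-|Va] := eqVneq (size V) a; last by rewrite hw // !(mulr0, mul0r).
have [<-|Ub] := eqVneq (size U) b; last by rewrite hw' // !(mulr0, mul0r).
by rewrite mulnC [w' U * _]mulrC.
Qed.

Lemma ins_hom k f w : hom k.+1 w -> hom k (ins f w).
Proof. by move=> hw F Fk; apply: hw. Qed.

Lemma ins_hom0 f w : hom 0 w -> ins f w = fun=> 0.
Proof. by move=> hw; apply/funext => F; apply: hw. Qed.

Lemma ins_alt f w : alt w -> alt (ins f w).
Proof. by move=> aw s; exact: (aw (f :: s)). Qed.

Lemma hom0 k : hom k (fun=> 0). Proof. by []. Qed.
Lemma alt0 : alt (fun=> 0). Proof. by move=> s f g t; rewrite oppr0. Qed.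

Lemma wdg_hom a b w w' : hom a w -> hom b w' -> hom (a + b) (wdg w w').
Proof.
move=> hw hw'; apply: shs_hom => U V UV.
have [Ua|Ua] := eqVneq (size U) a; last by rewrite hw ?mul0r.
by rewrite hw' ?mulr0 // -(eqn_add2l a) -[X in (X + _)%N]Ua.
Qed.

Lemma wdg_alt w w' : alt w -> alt w' -> alt (wdg w w').
Proof.
move=> aw aw'; apply: shs_alt => U s f g t; first by rewrite aw mulNr.
by rewrite aw' mulrN.
Qed.

Definition lin1 (v : K -> L) : seq K -> L := fun V =>
  if V is [:: g] then v g else 0.

Lemma lin1_hom v : hom 1 (lin1 v).
Proof. by case=> [|f [|g F]]. Qed.

Lemma lin1_alt v : alt (lin1 v).
Proof. by case=> [|h [|k s]] f g t /=; rewrite oppr0. Qed.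

Lemma hom1_lin1 w : hom 1 w -> w = lin1 (fun f => w [:: f]).
Proof. by move=> hw; apply/funext => -[|f [|g F]] //=; rewrite hw. Qed.

Definition eps : seq K -> L := fun V => if V is [::] then 1 else 0.

Lemma eps_hom : hom 0 eps. Proof. by case. Qed.

Lemma eps_alt : alt eps.
Proof. by case=> [|h s] f g t /=; rewrite oppr0. Qed.

Lemma wdg_eps w : wdg w eps = w.
Proof. by apply/funext => F; rewrite /wdg shs_nil_r ?mulr1 // => U v V; rewrite mulr0. Qed.

Lemma eps_wdg w : wdg eps w = w.
Proof. by apply/funext => F; rewrite /wdg shs_nil_l ?mul1r // => U v V; rewrite mul0r. Qed.

(** w /\ X_1 /\ .. /\ X_k. By the definition of contraction, (i(w) mu)(X_1, .., X_k) is mu on this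
    product, so that computations with forms become computations with multivectors. *)
Definition wdgs (Xs : seq (K -> L)) w :=
  foldl (fun w X => wdg w (lin1 X)) w Xs.

(* X_1 /\ .. /\ X_k, a determinant by [det_dw] *)
Definition dw (Xs : seq (K -> L)) :=
  foldr (fun X w => wdg (lin1 X) w) eps Xs.

Lemma wdg_dw w Xs : wdg w (dw Xs) = wdgs Xs w.
Proof.
elim: Xs w => [|X Xs IH] w /=; first exact: wdg_eps.
by rewrite -IH wdg_assoc.
Qed.

Lemma dw_hom Xs : hom (size Xs) (dw Xs).
Proof.
elim: Xs => [|X Xs IH] /=; first exact: eps_hom.
by apply: (wdg_hom (a := 1)) => //; exact: lin1_hom.
Qed.

Lemma lin1_swap X Y : wdg (lin1 X) (lin1 Y) = fun F => - wdg (lin1 Y) (lin1 X) F.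
Proof.
apply/funext => F; rewrite (wdg_comm _ (@lin1_hom X) (@lin1_hom Y)).
by rewrite expr1 mulN1r.
Qed.

Lemma wdgDl u v w F : wdg (fun F => u F + v F) w F = wdg u w F + wdg v w F.
Proof. by rewrite -shsD; apply: shs_eq => U V; rewrite mulrDl. Qed.
Lemma wdgNl u w F : wdg (fun F => - u F) w F = - wdg u w F.
Proof. by rewrite -shsN; apply: shs_eq => U V; rewrite mulNr. Qed.
Lemma wdgZl c u w F : wdg (fun F => c * u F) w F = c * wdg u w F.
Proof. by rewrite -shsZ; apply: shs_eq => U V; rewrite mulrA. Qed.
Lemma wdgNr u w F : wdg w (fun F => - u F) F = - wdg w u F.
Proof. by rewrite -shsN; apply: shs_eq => U V; rewrite mulrN. Qed.

Lemma wdgs_D Xs u v :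
  wdgs Xs (fun F => u F + v F) = fun F => wdgs Xs u F + wdgs Xs v F.
Proof.
elim: Xs u v => //= X Xs IH u v; rewrite -IH; congr wdgs.
by apply/funext => F; exact: wdgDl.
Qed.
Lemma wdgs_Z Xs c u : wdgs Xs (fun F => c * u F) = fun F => c * wdgs Xs u F.
Proof.
elim: Xs u => //= X Xs IH u; rewrite -IH; congr wdgs.
by apply/funext => F; exact: wdgZl.
Qed.
Lemma wdgs_N Xs u : wdgs Xs (fun F => - u F) = fun F => - wdgs Xs u F.
Proof.
elim: Xs u => //= X Xs IH u; rewrite -IH; congr wdgs.
by apply/funext => F; exact: wdgNl.
Qed.

Lemma wdgs_swap X Y Xs w F :
  wdgs (X :: Y :: Xs) w F = - wdgs (Y :: X :: Xs) w F.
Proof.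
rewrite /= -!wdg_assoc lin1_swap.
have -> : wdg w (fun F => - wdg (lin1 Y) (lin1 X) F) =
          fun F => - wdg w (wdg (lin1 Y) (lin1 X)) F.
  by apply/funext => F'; exact: wdgNr.
by rewrite wdgs_N.
Qed.

End Shuffles.

Lemma shs_map (K K' : Type) (L : comPzRingType) (h : K' -> K)
    (T : seq K -> seq K -> L) (F : seq K') :
  shs T (map h F) = shs (fun U V => T (map h U) (map h V)) F.
Proof.
elim: F T => //= f F IH T; rewrite !IH; congr (_ + _).
by apply: shs_eq => U V; rewrite size_map.
Qed.

Lemma shs_morph (K : Type) (L L' : comPzRingType) (phi : L -> L')
    (T : seq K -> seq K -> L) (F : seq K) :
  (forall a b, phi (a + b) = phi a + phi b) -> (forall a, phi (- a) = - phi a) ->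
  phi (shs T F) = shs (fun U V => phi (T U V)) F.
Proof.
move=> phiD phiN; elim: F T => //= f F IH T; rewrite phiD !IH; congr (_ + _).
apply: shs_eq => U V; elim: (size U) => [|k IHk]; first by rewrite !mul1r.
by rewrite !exprS -!mulrA !mulN1r phiN IHk.
Qed.

(** * Alternating tensorial functions in coordinates *)
Fixpoint alls (T : Type) (P : T -> Prop) (s : seq T) : Prop :=
  if s is t :: s' then P t /\ alls P s' else True.

Lemma alls_nth (T : Type) (P : T -> Prop) (s : seq T) t0 i :
  alls P s -> (i < size s)%N -> P (nth t0 s i).
Proof. by elim: s i => // t s IH [|i] /= [Pt Ps] // si; exact: IH. Qed.

Lemma nth_alls (T : Type) (P : T -> Prop) (s : seq T) t0 :
  (forall i, (i < size s)%N -> P (nth t0 s i)) -> alls P s.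
Proof.
elim: s => //= t s IH Ps; split; first exact: (Ps 0%N).
by apply: IH => i si; exact: (Ps i.+1).
Qed.

Section Alternation.
Variables (K : Type) (L : comPzRingType).
Hypothesis tf : forall a : L, a = - a -> a = 0.
Implicit Types (w : seq K -> L).

Lemma alt_front w s f t : alt w ->
  w (s ++ f :: t) = (-1) ^+ size s * w (f :: s ++ t).
Proof.
elim: s w => [|h s IH] w aw /=; first by rewrite mul1r.
rewrite -[LHS]/(ins h w (s ++ f :: t)) IH; last exact: ins_alt.
by rewrite /ins (aw [::]) exprS mulrN mulN1r mulNr.
Qed.

Lemma alt_rcons w F z : alt w -> w (rcons F z) = (-1) ^+ size F * w (z :: F).
Proof. by move=> aw; rewrite -cats1 alt_front // cats0. Qed.

Lemma alt_eq w f F : alt w -> w (f :: f :: F) = 0.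
Proof. by move=> aw; apply: tf; exact: (aw [::]). Qed.

End Alternation.

Section AlternationEq.
Variables (K : eqType) (L : comPzRingType).
Hypothesis tf : forall a : L, a = - a -> a = 0.
Implicit Types (w : seq K -> L).

Lemma alt_dup w s : alt w -> ~~ uniq s -> w s = 0.
Proof.
elim: s w => //= x s IH w aw; rewrite negb_and negbK => /orP[xs|us].
  case/splitPr: xs => a b.
  rewrite -[LHS]/(ins x w (a ++ x :: b)) alt_front ?/ins; last exact: ins_alt.
  by rewrite (alt_eq tf) ?mulr0.
by rewrite -[LHS]/(ins x w s) IH //; exact: ins_alt.
Qed.

Lemma alt_perm w s t : alt w -> perm_eq s t ->
  exists b : bool, w s = (-1) ^+ b * w t.
Proof.
elim: s w t => [|x s IH] w t aw.
  by rewrite perm_sym => /perm_nilP->; exists false; rewrite mul1r.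
move=> st; have xt : x \in t by rewrite -(perm_mem st) mem_head.
case/splitPr: xt st => a b; rewrite perm_sym perm_catC /= perm_cons => st.
have st' : perm_eq s (a ++ b) by rewrite perm_sym perm_catC.
have [c wc] := IH (ins x w) _ (ins_alt x aw) st'.
exists (c (+) odd (size a)); rewrite alt_front // -(signr_odd _ (size a)) signr_addb.
by rewrite mulrA -[X in X * _]mulrA -signr_addb addbb mulr1; exact: wc.
Qed.

End AlternationEq.

(* [d m f] is the m-th partial derivative of [f], and [tens] says that [w]
   depends on the differentials only. This is used for fields over the functions
   on a coordinate domain ([K] = [L]), for a single tangent space ([L] the real
   numbers) and, dually, for forms at a point ([K] the tangent vectors, [x] a
   frame). *)
Section Coordinates.
Variables (K : Type) (L : comPzRingType) (n : nat).
Variables (d : 'I_n -> K -> L) (x : 'I_n -> K).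
Hypothesis tf : forall a : L, a = - a -> a = 0.
Hypothesis dx : forall i j, d i (x j) = (i == j)%:R.
Implicit Types (F U V : seq K) (w : seq K -> L).

Definition der (v : K -> L) := forall f, v f = \sum_m d m f * v (x m).

Definition tens w := forall f F, w (f :: F) = \sum_m d m f * w (x m :: F).

Definition kvec k w := [/\ alt w, hom k w & tens w].

Notation xs := (map x (enum 'I_n)).

Lemma sum_delta (g : 'I_n -> L) j : \sum_m g m * (m == j)%:R = g j.
Proof.
rewrite (bigD1 j) //= eqxx mulr1 big1 ?addr0 // => m /negPf->.
by rewrite mulr0.
Qed.

Lemma der_d m : der (d m).
Proof.
by move=> f; under eq_bigr do rewrite dx eq_sym; rewrite sum_delta.
Qed.

Lemma kvec_ins k f w : kvec k.+1 w -> kvec k (ins f w).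
Proof.
move=> [aw hw tw]; split; [exact: ins_alt | exact: ins_hom |].
move=> g F; rewrite /ins (aw [::]) tw -sumrN; apply: eq_bigr => m _.
by rewrite -mulrN; congr (_ * _); exact: esym (aw [::] _ _ _).
Qed.

Lemma kvec0 k : kvec k (fun=> 0).
Proof. by split=> [||f F]; [exact: alt0 | exact: hom0 | rewrite big1 // => m _; rewrite mulr0]. Qed.

Lemma kvecD k u w : kvec k u -> kvec k w -> kvec k (fun F => u F + w F).
Proof.
move=> [au hu tu] [aw hw tw]; split.
- by move=> s f g t; rewrite au aw opprD.
- by move=> F Fk; rewrite hu ?hw ?addr0.
- by move=> f F; rewrite tu tw -big_split; apply: eq_bigr => m _; rewrite mulrDr.
Qed.

Lemma kvecZ k c w : kvec k w -> kvec k (fun F => c * w F).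
Proof.
move=> [aw hw tw]; split.
- by move=> s f g t; rewrite aw mulrN.
- by move=> F Fk; rewrite hw ?mulr0.
- by move=> f F; rewrite tw mulr_sumr; apply: eq_bigr => m _; rewrite mulrCA.
Qed.

Lemma kvecN k w : kvec k w -> kvec k (fun F => - w F).
Proof.
by move=> /(kvecZ (-1)); congr kvec; apply/funext => F; rewrite mulN1r.
Qed.

Lemma shs_tens (T : seq K -> seq K -> L) :
  (forall V, tens (T ^~ V)) -> (forall U, tens (T U)) -> tens (shs T).
Proof.
move=> tl tr f F /=.
under [X in X + _ = _]shs_eq => U V do rewrite tl.
under [X in _ + X = _]shs_eq => U V do rewrite tr mulr_sumr.
rewrite !shs_sum -big_split; apply: eq_bigr => m _ /=.
rewrite mulrDr -!shsZ; congr (_ + _); apply: shs_eq => U V.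
by rewrite mulrCA.
Qed.

Lemma wdg_kvec a b u w : kvec a u -> kvec b w -> kvec (a + b) (wdg u w).
Proof.
move=> [au hu tu] [aw hw tw]; split; [exact: wdg_alt | exact: wdg_hom |].
apply: shs_tens => U f F.
  by rewrite tu mulr_suml; apply: eq_bigr => m _; rewrite mulrA.
by rewrite tw mulr_sumr; apply: eq_bigr => m _; rewrite mulrCA.
Qed.

Lemma lin1_kvec v : der v -> kvec 1 (lin1 v).
Proof.
move=> dv; split; [exact: lin1_alt | exact: lin1_hom |].
move=> f [|g F] /=; first exact: dv.
by rewrite big1 // => m _; rewrite mulr0.
Qed.

Lemma kvec1_der w : kvec 1 w -> der (fun f => w [:: f]).
Proof. by move=> [_ _ tw] f; exact: tw. Qed.

Lemma eps_kvec : kvec 0 (@eps K L).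
Proof.
split; [exact: eps_alt | exact: eps_hom |] => f F /=.
by rewrite big1 // => m _; rewrite mulr0.
Qed.

Lemma dw_kvec Xs : alls der Xs -> kvec (size Xs) (dw Xs).
Proof.
elim: Xs => [|X Xs IH] /=; first by move=> _; exact: eps_kvec.
by move=> [dX dXs]; apply: (wdg_kvec (a := 1)) (IH dXs); exact: lin1_kvec.
Qed.

Lemma wdgs_kvec k w Xs : kvec k w -> alls der Xs ->
  kvec (k + size Xs) (wdgs Xs w).
Proof. by move=> kw dXs; rewrite -wdg_dw; apply: wdg_kvec => //; exact: dw_kvec. Qed.

(** Applied with [h] replacing a function by another lift of its restriction, which has the same
    differential on the domain. *)
Lemma kvec_map k w (h : K -> K) F : kvec k w ->
  (forall f m, d m (h f) = d m f) -> w (map h F) = w F.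
Proof.
move=> kw dh; elim: F k w kw => // f F IH k w kw.
case: (kw) => _ hw tw; rewrite /= tw [RHS]tw; apply: eq_bigr => m _; rewrite dh.
congr (_ * _); case: k kw hw => [|k] kw hw; first by rewrite !hw.
exact: (IH k (ins (x m) w) (kvec_ins _ kw)).
Qed.

Lemma kvec_eq0 k w : kvec k w ->
  (forall I : seq 'I_n, size I = k -> w (map x I) = 0) -> forall F, w F = 0.
Proof.
move=> kw w0 F; have [Fk|Fk] := eqVneq (size F) k; last by case: kw => _ ->.
elim: k w kw w0 F Fk => [|k IH] w kw w0 F.
  by move/size0nil->; exact: (w0 [::]).
case: F => //= f F [Fk]; case: (kw) => _ _ ->; apply: big1 => m _.
rewrite -[w _]/(ins (x m) w F) IH ?mulr0 //; first exact: kvec_ins.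
by move=> I Ik; apply: (w0 (m :: I)); rewrite /= Ik.
Qed.

Lemma alt_mapx w : alt w -> alt (fun I : seq 'I_n => w (map x I)).
Proof. by move=> aw s f g t; rewrite !map_cat /= aw. Qed.

(** Only sequences of coordinates matter. In degree above n an index repeats; in degree n a sequence
    without repetition is a permutation of all coordinates. *)
Lemma kvec_top k w : kvec k w -> (n <= k)%N -> (n == k -> w xs = 0) ->
  forall F, w F = 0.
Proof.
move=> kw nk w0; apply: (kvec_eq0 kw) => I Ik; have [aw _ _] := kw.
have au := alt_mapx aw.
have [uI|uI] := boolP (uniq I); last exact: (alt_dup tf au uI).
have nk' : n = k.
  apply/eqP; rewrite eqn_leq nk -Ik /=.
  by have := max_card (mem I); rewrite card_ord (card_uniqP uI).
have pI : perm_eq I (enum 'I_n).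
  apply: uniq_perm => //; first exact: enum_uniq.
  have := @uniq_min_size _ I (enum 'I_n) uI; case.
  - by move=> i _; rewrite mem_enum.
  - by rewrite size_enum_ord Ik -nk'.
  - by [].
by have [b] := alt_perm au pI => ->; rewrite w0 ?mulr0 //; exact/eqP.
Qed.

Lemma shs_lin1_eq0 (T : seq K -> seq K -> L) v (I : seq 'I_n) :
  (forall i, i \in I -> v (x i) = 0) ->
  shs (fun U V => T U V * lin1 v V) (map x I) = 0.
Proof.
elim: I T => [|i I IH] T vI /=; first by rewrite mulr0.
rewrite (IH (fun U V => T (x i :: U) V)) => [|j jI]; last by apply: vI; rewrite inE jI orbT.
rewrite add0r -[RHS](shs0 _ (map x I)); apply: shs_eq => U [|g V] /=.
  by rewrite vI ?mem_head ?mulr0.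
by rewrite !mulr0.
Qed.

(** Injectivity of w -> i(w) mu at a point. For k < n some index m is missing from I, and w on the
    coordinates of I is recovered from w /\ [d m]; this raises the degree, up to n. *)
Lemma wdgs_inj j k w : (k + j)%N = n -> kvec k w ->
  (forall Xs, size Xs = j -> alls der Xs -> wdgs Xs w xs = 0) ->
  forall F, w F = 0.
Proof.
elim: j k w => [|j IH] k w kjn kw w0.
  by apply: (kvec_top kw) => [|_]; [rewrite -kjn addn0 | exact: (w0 [::])].
apply: (kvec_eq0 kw) => I Ik.
have [m mI] : exists m : 'I_n, m \notin I.
  apply/existsP; rewrite -negb_forall; apply/negP => /forallP allI.
  have : (n <= size I)%N.
    have := @uniq_leq_size _ (enum 'I_n) I (enum_uniq _).
    by rewrite size_enum_ord; apply => i _; exact: allI.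
  by rewrite Ik -kjn addnS ltnNge leq_addr.
have wm F : wdg w (lin1 (d m)) F = 0.
  apply: (IH (k + 1)%N).
  - by rewrite -kjn addn1 addSn addnS.
  - by apply: wdg_kvec => //; apply: lin1_kvec; exact: der_d.
  - move=> Xs Xsj dXs; apply: (w0 (d m :: Xs)); rewrite /= ?Xsj //.
    by split=> //; exact: der_d.
have [_ hw _] := kw.
(* Only the term in which [d m] takes x_m survives, since [d m] kills the coordinates of I. *)
have := wm (x m :: map x I); rewrite (wdg_cons _ _ _ hw) /wdg.
rewrite shs_lin1_eq0 => [|i iI]; last first.
  by rewrite dx; case: eqP => // mi; rewrite mi iI in mI.
rewrite add0r shs_nil_r => [|U v V]; last by rewrite /ins /= mulr0.
rewrite /ins /= dx eqxx mulr1 => /(congr1 ( *%R ((-1) ^+ k))).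
by rewrite mulrA -expr2 sqrr_sign mul1r mulr0.
Qed.

(** Euler's identity for the degree: every entry of F is moved once to the front, and alternation
    turns each such term into w F. *)
Lemma wdg_ins_count k w F : kvec k w ->
  \sum_m wdg (lin1 (d m)) (ins (x m) w) F = k%:R * w F.
Proof.
move=> [aw hw tw].
have -> : \sum_m wdg (lin1 (d m)) (ins (x m) w) F =
    shs (fun U V => if U is [:: u] then w (u :: V) else 0) F.
  rewrite -shs_sum; apply: shs_eq => -[|u [|u' U]] V /=.
  - by rewrite big1 // => m _; rewrite mul0r.
  - by rewrite tw.
  - by rewrite big1 // => m _; rewrite mul0r.
have [Fk|Fk] := eqVneq (size F) k; last first.
  rewrite hw // mulr0 -[RHS](shs0 _ F); apply: shs_ext => -[|u [|u' U]] V //= UV.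
  by rewrite hw //= -[_.+1]add1n UV.
rewrite -Fk; elim: F w {k hw tw Fk} aw => [|f F IH] w aw /=; first by rewrite mul0r.
rewrite shs_nil_l //.
have -> : shs (fun U V => (-1) ^+ size U *
    (if U is [:: u] then w [:: u, f & V] else 0)) F =
    shs (fun U V => if U is [:: u] then ins f w (u :: V) else 0) F.
  apply: shs_eq => -[|u [|u' U]] V /=; rewrite ?mulr0 //.
  by rewrite expr1 mulN1r (aw [::]) opprK.
by rewrite IH; [rewrite /ins mulrS mulrDl mul1r | exact: ins_alt].
Qed.

End Coordinates.

(** * Curl, Schouten bracket and Koszul formula over a ring with a frame *)
Section Derivations.
Variable K : comPzRingType.
Implicit Types (X Y : K -> K) (w : seq K -> K).

Definition derivation X :=
  (forall f h, X (f + h) = X f + X h) /\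
  (forall f h, X (f * h) = X f * h + f * X h).

Lemma derivation0 X : derivation X -> X 0 = 0.
Proof. by move=> [XD _]; apply: (addrI (X 0)); rewrite -XD !addr0. Qed.

Lemma derivationN X f : derivation X -> X (- f) = - X f.
Proof.
move=> dX; apply: (addrI (X f)); case: (dX) => <- _.
by rewrite !subrr derivation0.
Qed.

Lemma derivation1 X : derivation X -> X 1 = 0.
Proof.
move=> [_ XM]; apply: (addrI (X 1)).
by rewrite addr0 -{3}(mulr1 1) XM mulr1 mul1r.
Qed.

Lemma derivation_sum X (I : Type) (r : seq I) (P : pred I) (f : I -> K) :
  derivation X -> X (\sum_(i <- r | P i) f i) = \sum_(i <- r | P i) X (f i).
Proof.
move=> dX; rewrite (big_morph X (id1 := 0) (op1 := +%R)) //; last exact: derivation0.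
by case: dX.
Qed.

Lemma derivation_sign X b f : derivation X ->
  X ((-1) ^+ b * f) = (-1) ^+ b * X f.
Proof.
move=> dX; elim: b f => [|b IH] f; first by rewrite !mul1r.
by rewrite exprS -mulrA !mulN1r derivationN // IH mulNr.
Qed.

Lemma derivation_shs X (T : seq K -> seq K -> K) F : derivation X ->
  X (shs T F) = shs (fun U V => X (T U V)) F.
Proof.
move=> dX; elim: F T => //= f F IH T; case: (dX) => -> _; rewrite !IH.
by congr (_ + _); apply: shs_eq => U V; rewrite derivation_sign.
Qed.

Definition comm X Y : K -> K := fun f => X (Y f) - Y (X f).

(* the sum of the [w F'], [F'] being [F] with one entry [f] changed to [X f] *)
Fixpoint sub X w F : K :=
  if F is f :: F' then w (X f :: F') + sub X (ins f w) F' else 0.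

(** The Lie derivative of a multivector, evaluated on exact covectors by means of L_X dF = d (X
    F). *)
Definition Lie X w F := X (w F) - sub X w F.

Lemma sub_eq X w w' F : w =1 w' -> sub X w F = sub X w' F.
Proof. by move=> /funext->. Qed.

Lemma subD X w w' F : sub X (fun F => w F + w' F) F = sub X w F + sub X w' F.
Proof.
elim: F w w' => [|f F IH] w w' /=; first by rewrite addr0.
by rewrite addrACA -IH.
Qed.

Lemma subZ X c w F : sub X (fun F => c * w F) F = c * sub X w F.
Proof.
elim: F w => [|f F IH] w /=; first by rewrite mulr0.
by rewrite mulrDr -IH.
Qed.

Lemma sub0 X F : sub X (fun=> 0) F = 0.
Proof. by elim: F => //= f F IH; rewrite add0r. Qed.

Lemma sub_sign X w F :
  sub X (fun F => (-1) ^+ size F * w F) F = (-1) ^+ size F * sub X w F.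
Proof.
elim: F w => [|f F IH] w /=; first by rewrite mulr0.
rewrite mulrDr; congr (_ + _).
transitivity (sub X (fun F => -1 * ((-1) ^+ size F * ins f w F)) F).
  by apply: sub_eq => F'; rewrite /ins /= exprS mulrA.
by rewrite subZ IH exprS mulrA.
Qed.

Lemma sub_shs X (T : seq K -> seq K -> K) F : sub X (shs T) F =
  shs (fun U V => sub X (T ^~ V) U + sub X (T U) V) F.
Proof.
elim: F T => [|f F IH] T /=; first by rewrite addr0.
rewrite -[ins f (shs T)]/(fun F => shs (fun U V => T (f :: U) V) F +
   shs (fun U V => (-1) ^+ size U * T U (f :: V)) F).
rewrite subD !IH [LHS]addrACA; congr (_ + _); rewrite -shsD; apply: shs_eq => U V.
  by rewrite addrA.
by rewrite sub_sign subZ !mulrDr [RHS]addrCA.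
Qed.

Lemma Lie_wdg X w w' F : derivation X ->
  Lie X (wdg w w') F = wdg (Lie X w) w' F + wdg w (Lie X w') F.
Proof.
move=> dX; rewrite /Lie derivation_shs // sub_shs -shsN -!shsD.
apply: shs_eq => U V; case: (dX) => _ ->.
have -> : sub X (fun U => w U * w' V) U = sub X w U * w' V.
  by rewrite mulrC -subZ; apply: sub_eq => U'; rewrite mulrC.
by rewrite subZ; ring.
Qed.

Lemma Lie_lin1 X Y : derivation X -> Lie X (lin1 Y) = lin1 (comm X Y).
Proof.
move=> dX; apply/funext => -[|f [|h F]]; rewrite /Lie /=.
- by rewrite derivation0 // subr0.
- by rewrite addr0.
- rewrite derivation0 // add0r; case: F => [|k F] /=; rewrite /ins /= ?add0r.
  + by rewrite oppr0.
  by rewrite sub0 oppr0.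
Qed.

Lemma Lie_ins X w f F : ins f (Lie X w) F = Lie X (ins f w) F - w (X f :: F).
Proof. by rewrite /Lie /ins /=; ring. Qed.

(** The terms of L_X (w /\ Y_1 /\ .. /\ Y_k) in which X acts on a factor: the sum over j of the
    products with [X, Y_j] in place of Y_j. *)
Fixpoint lieW X w (Ys : seq (K -> K)) F : K :=
  if Ys is Y :: Ys' then
    wdgs (comm X Y :: Ys') w F + lieW X (wdg w (lin1 Y)) Ys' F
  else 0.

Lemma Lie_wdgs X w Ys F : derivation X ->
  Lie X (wdgs Ys w) F = wdgs Ys (Lie X w) F + lieW X w Ys F.
Proof.
move=> dX; elim: Ys w => [|Y Ys IH] w /=; first by rewrite addr0.
rewrite IH addrA; congr (_ + _).
have -> : Lie X (wdg w (lin1 Y)) = fun F =>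
    wdg (Lie X w) (lin1 Y) F + wdg w (lin1 (comm X Y)) F.
  by apply/funext => F'; rewrite Lie_wdg // Lie_lin1.
by rewrite wdgs_D.
Qed.

(** (-1)^j is the sign for moving [X, Y_j] from the front, where the Koszul formula has it, back to
    place j. *)
Lemma lieW_omit X w Ys F : \sum_(j < size Ys)
   (-1) ^+ j * wdgs (comm X (nth (fun=> 0) Ys j) :: omit j Ys) w F =
  lieW X w Ys F.
Proof.
elim: Ys w => [|Y Ys IH] w; first by rewrite big_ord0.
rewrite big_ord_recl mul1r [omit _ _]/= /omit /= drop0; congr (_ + _).
rewrite -IH; apply: eq_bigr => j _; rewrite /= exprS mulN1r.
rewrite -[wdgs _ _ F]/(wdgs (comm X (nth (fun=> 0) Ys j) :: Y :: omit j Ys) w F).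
by rewrite wdgs_swap mulrNN.
Qed.

Definition kosz (eta : seq (K -> K) -> K) (Xs : seq (K -> K)) : K :=
  \sum_(i < size Xs) (-1) ^+ i * nth (fun=> 0) Xs i (eta (omit i Xs))
  + \sum_(j < size Xs) \sum_(i < j) (-1) ^+ (i + j) *
    eta (comm (nth (fun=> 0) Xs i) (nth (fun=> 0) Xs j) :: omit i (omit j Xs)).

(* Cartan's formula: the middle sum is the part of the Lie derivative along
   [X] that acts on the arguments. *)
Lemma kosz_cons (eta : seq (K -> K) -> K) X Xs :
  (forall Y Z Ys, eta (Y :: Z :: Ys) = - eta (Z :: Y :: Ys)) ->
  kosz eta (X :: Xs) = X (eta Xs)
    - \sum_(j < size Xs) (-1) ^+ j * eta (comm X (nth (fun=> 0) Xs j) :: omit j Xs)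
    - kosz (fun Ys => eta (X :: Ys)) Xs.
Proof.
move=> eta_swap; rewrite /kosz /= !big_ord_recl big_ord0 add0r mul1r /=.
rewrite {1}/omit /= drop0 opprD -!addrA; congr (_ + _).
rewrite [RHS]addrCA; congr (_ + _).
  by rewrite -sumrN; apply: eq_bigr => i _; rewrite exprS mulN1r mulNr.
rewrite -!sumrN -big_split; apply: eq_bigr => j _ /=.
rewrite big_ord_recl /= add0n exprS mulN1r mulNr.
rewrite {1}[omit 0 _]/omit /= drop0; congr (_ + _).
rewrite -sumrN; apply: eq_bigr => i _.
have bump0 k : bump 0 k = k.+1 by [].
by rewrite !bump0 addSn addnS 2!exprS !mulN1r opprK -mulrN -eta_swap.
Qed.

End Derivations.

(** * Divergence, curl and Poisson coboundary in a commuting frame with density g *)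

Section Calculus.
Variables (K : comPzRingType) (n : nat).
Variables (E : 'I_n -> K -> K) (x : 'I_n -> K) (g gi : K).
Hypothesis tf : forall a : K, a = - a -> a = 0.
Hypothesis dE : forall i, derivation (E i).
Hypothesis EC : forall i j f, E i (E j f) = E j (E i f).
Hypothesis ggi : g * gi = 1.

Notation der := (der E x).
Notation kvec := (kvec E x).
Notation xs := (map x (enum 'I_n)).
Implicit Types (X Y : K -> K) (A B : seq K -> K) (F : seq K).

Let ED i f h : E i (f + h) = E i f + E i h. Proof. by case: (dE i). Qed.
Let EM i f h : E i (f * h) = E i f * h + f * E i h. Proof. by case: (dE i). Qed.
Let E_sum i := fun I r P f => @derivation_sum K (E i) I r P f (dE i).

Lemma sum_antisym (h : 'I_n -> 'I_n -> K) :
  (forall i j, h i j = - h j i) -> \sum_i \sum_j h i j = 0.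
Proof.
move=> hN; apply: tf; rewrite -sumrN [LHS]exchange_big; apply: eq_bigr => j _.
by rewrite -sumrN; apply: eq_bigr => i _.
Qed.

(* d (log g), for the volume form g dx_1 .. dx_n *)
Definition theta i := gi * E i g.

(** The derivative of [gi] comes from differentiating g gi = 1; no logarithm is involved, so g may
    have any sign. *)
Lemma theta_closed i j : E i (theta j) = E j (theta i).
Proof.
have Egi k : E k gi = - (gi * (gi * E k g)).
  have := congr1 ( *%R gi) (congr1 (E k) ggi).
  rewrite EM derivation1 // mulr0 mulrDr [gi * (g * _)]mulrA [gi * g]mulrC ggi mul1r.
  by move/eqP; rewrite addrC addr_eq0 => /eqP->; ring.
by rewrite /theta !EM !Egi EC; ring.
Qed.

Lemma der_derivation X : der X -> derivation X.
Proof.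
move=> dX; split=> f h; rewrite !dX.
  by rewrite -big_split; apply: eq_bigr => i _; rewrite ED mulrDl.
rewrite mulr_suml mulr_sumr -big_split; apply: eq_bigr => i _ /=.
by rewrite EM; ring.
Qed.

Lemma kvec_0 k A F : kvec k A -> A (0 :: F) = 0.
Proof.
by move=> [_ _ tA]; rewrite tA big1 // => m _; rewrite derivation0 // mul0r.
Qed.

Lemma kvec_add k A f h F : kvec k A -> A (f + h :: F) = A (f :: F) + A (h :: F).
Proof.
move=> [_ _ tA]; rewrite !(tA _ F) -big_split; apply: eq_bigr => m _.
by rewrite ED mulrDl.
Qed.

Lemma kvec_opp k A f F : kvec k A -> A (- f :: F) = - A (f :: F).
Proof.
move=> kA; apply/eqP; rewrite -addr_eq0 -(kvec_add _ _ _ kA) addNr.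
by rewrite (kvec_0 _ kA).
Qed.

Lemma kvec_mul k A f h F : kvec k A ->
  A (f * h :: F) = f * A (h :: F) + h * A (f :: F).
Proof.
move=> [_ _ tA]; rewrite !(tA _ F) !mulr_sumr -big_split; apply: eq_bigr => m _ /=.
by rewrite EM; ring.
Qed.

Lemma kvec_sum_l k A (I : Type) (r : seq I) (f : I -> K) F : kvec k A ->
  A ((\sum_(i <- r) f i) :: F) = \sum_(i <- r) A (f i :: F).
Proof.
move=> kA; elim: r => [|i r IH]; first by rewrite !big_nil (kvec_0 _ kA).
by rewrite !big_cons (kvec_add _ _ _ kA) IH.
Qed.

Lemma kvec_insP k A f : kvec k A -> kvec k.-1 (ins f A).
Proof.
case: k => [[_ hA _]|k]; last exact: kvec_ins.
by rewrite ins_hom0 //; exact: kvec0.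
Qed.

Lemma kvec_mid k A s f t : kvec k A ->
  A (s ++ f :: t) = \sum_m E m f * A (s ++ x m :: t).
Proof.
move=> [aA _ tA]; rewrite alt_front // tA mulr_sumr; apply: eq_bigr => m _.
by rewrite [in RHS]alt_front // mulrCA.
Qed.

(** The second derivatives of f enter X (Y f) and Y (X f) in the same way, by the commutation of the
    [E i], and cancel. *)
Lemma der_comm X Y : der X -> der Y -> der (comm X Y).
Proof.
move=> dX dY f; have DX := der_derivation dX; have DY := der_derivation dY.
have second Z W : der Z -> der W -> Z (W f) =
    \sum_m E m f * Z (W (x m)) + \sum_i \sum_m E i (E m f) * W (x m) * Z (x i).
  move=> dZ dW; have DZ := der_derivation dZ; rewrite dW (derivation_sum _ _ _ DZ).
  rewrite [X in _ + X]exchange_big -big_split; apply: eq_bigr => m _ /=.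
  case: DZ => _ ->; rewrite addrC; congr (_ + _); rewrite dZ mulr_suml.
  by apply: eq_bigr => i _; ring.
rewrite /comm (second X Y) // (second Y X) // [X in _ + X - _]exchange_big.
rewrite opprD addrACA [X in _ + X](_ : _ = 0) ?addr0.
  by rewrite -sumrB; apply: eq_bigr => m _; rewrite mulrBr.
rewrite -sumrB big1 // => i _; rewrite -sumrB big1 // => m _.
by rewrite EC; ring.
Qed.

Definition dvg X := \sum_i (E i (X (x i)) + theta i * X (x i)).

(* The curl: (1 / g) d_i (g A (F, x_i)), summed over i. No term differentiates
   the arguments F: it would be d_i d_j F times A (.., x_j, .., x_i), that is
   symmetric times antisymmetric. *)
Definition D A F :=
  \sum_i (E i (A (rcons F (x i))) + theta i * A (rcons F (x i))).

Lemma D_add A B F : D (fun F => A F + B F) F = D A F + D B F.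
Proof. by rewrite -big_split; apply: eq_bigr => i _ /=; rewrite ED; ring. Qed.

Lemma D_opp A F : D (fun F => - A F) F = - D A F.
Proof. by rewrite -sumrN; apply: eq_bigr => i _ /=; rewrite derivationN //; ring. Qed.

Lemma D_0 F : D (fun=> 0) F = 0.
Proof. by apply: big1 => i _; rewrite derivation0 // mulr0 addr0. Qed.

Lemma D_hom k A : hom k.+1 A -> hom k (D A).
Proof.
move=> hA F Fk; apply: big1 => i _.
by rewrite hA ?size_rcons // derivation0 // mulr0 addr0.
Qed.

Lemma D_kvec k A : kvec k A -> kvec k.-1 (D A).
Proof.
case: k => [[_ hA _]|k [aA hA tA]].
  have -> : D A = fun=> 0.
    apply/funext => F; rewrite -[RHS](D_0 F); apply: eq_bigr => i _.
    by rewrite hA // size_rcons.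
  exact: kvec0.
split; [|exact: D_hom|].
  move=> s f h t; rewrite -sumrN; apply: eq_bigr => i _.
  rewrite !rcons_cat /= aA derivationN //; ring.
move=> f F; transitivity (\sum_m E m f * D A (x m :: F) +
    \sum_i \sum_m E i (E m f) * A (x m :: rcons F (x i))).
  under eq_bigr do rewrite mulr_sumr.
  rewrite exchange_big -big_split; apply: eq_bigr => i _ /=.
  rewrite tA E_sum mulr_sumr -!big_split; apply: eq_bigr => m _ /=.
  by rewrite EM; ring.
rewrite [X in _ + X]sum_antisym ?addr0 // => i j.
rewrite -[A (x j :: _)]/(ins (x j) A (rcons F (x i))) (alt_rcons _ _ (ins_alt _ aA)).
rewrite -[A (x i :: _)]/(ins (x i) A (rcons F (x j))) (alt_rcons _ _ (ins_alt _ aA)).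
by rewrite /ins (aA [::]) EC; ring.
Qed.

(** Inserting the entries of F one by one, with a correction that is linear in [A] and also
    inserted, leaves the case of a vector field: div [X, A] = X (div A) - A (div X). *)
Lemma D_Lie k X A F : der X -> kvec k A ->
  D (Lie X A) F = Lie X (D A) F - A (rcons F (dvg X)).
Proof.
move=> dX; have DX := der_derivation dX.
elim: F k A => [|f F IH] k A kA; last first.
  rewrite -[LHS]/(D (ins f (Lie X A)) F).
  have -> : ins f (Lie X A) = fun F => Lie X (ins f A) F + - ins (X f) A F.
    by apply/funext => F'; rewrite Lie_ins.
  rewrite D_add D_opp (IH k.-1); last exact: kvec_insP.
  rewrite -[Lie X (D A) (f :: F)]/(ins f (Lie X (D A)) F) Lie_ins.
  rewrite -[D A (X f :: F)]/(D (ins (X f) A) F) -[ins f (D A)]/(D (ins f A)).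
  by rewrite -[A (rcons _ _)]/(ins f A (rcons F (dvg X))); ring.
have tA f : A [:: f] = \sum_m E m f * A [:: x m] by case: kA.
set a := fun i => A [:: x i]; set c := fun i => X (x i).
have -> : D (Lie X A) [::] = \sum_i \sum_m
   (E i (E m (a i)) * c m + E m (a i) * E i (c m)
    - E i (E m (c i)) * a m - E m (c i) * E i (a m)
    + theta i * E m (a i) * c m - theta i * E m (c i) * a m).
  apply: eq_bigr => i _; rewrite /Lie /= addr0 (tA (X (x i))) (dX (A [:: x i])).
  rewrite ED derivationN // !E_sum mulrBr !mulr_sumr -!sumrB -big_split.
  apply: eq_bigr => m _ /=.
  by rewrite !EM -/(a m) -/(a i) -/(c i) -/(c m); ring.
have -> : Lie X (D A) [::] = \sum_i \sum_m
   (E i (E m (a i)) * c m + E m (theta i) * c m * a i + theta i * E m (a i) * c m).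
  rewrite /Lie /= subr0 /D (derivation_sum _ _ _ DX); apply: eq_bigr => i _ /=.
  case: (DX) => -> ->; rewrite 3!dX !mulr_suml mulr_sumr -!big_split.
  by apply: eq_bigr => m _ /=; rewrite (EC i) -/(a i) -/(c m); ring.
have -> : A [:: dvg X] = \sum_i \sum_m
   (E i (E m (c i)) * a m + E m (theta i) * c i * a m + theta i * E m (c i) * a m).
  rewrite tA exchange_big; apply: eq_bigr => m _; rewrite E_sum mulr_suml.
  apply: eq_bigr => i _; rewrite ED EM (EC i) -/(c i) -/(a m); ring.
(* After cancellation the double sum is antisymmetric in i and m; for the terms in theta this is its
   closedness. *)
apply/eqP; rewrite -subr_eq0 -sumrB -sumrB; apply/eqP.
under eq_bigr do rewrite -sumrB -sumrB.
apply: sum_antisym => i m; rewrite (theta_closed m i); ring.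
Qed.

(* [A, B] = br A B - (-1)^((a-1)(b-1)) br B A *)
Definition br A B : seq K -> K := shs (fun U V => A (B U :: V)).

Lemma br_cons k b A B f F : kvec k A -> hom b B ->
  br A B (f :: F) = br A (ins f B) F - (-1) ^+ b * br (ins f A) B F.
Proof.
move=> kA hB; rewrite /br /= -[in RHS]shsZ -shsN; congr (_ + _).
apply: shs_eq => U V; have [aA _ _] := kA.
rewrite /ins (aA [::]) mulrN; congr (- _).
have [->//|Ub] := eqVneq (size U) b.
(* If U has the wrong size then B U = 0, and both sides vanish because A kills the function 0. *)
have A0 : A [:: f, 0 & V] = 0 by rewrite (aA [::]) /= (kvec_0 _ kA) oppr0.
by rewrite hB //= A0 !mulr0.
Qed.

(** One half of the bracket of [A] with a vector field; with the other half, [br_lin1_l], it makes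
    up the Lie derivative. *)
Lemma br_lin1 k A X F : kvec k A -> br A (lin1 X) F = sub X A F.
Proof.
elim: F k A => [|f F IH] k A kA; first by rewrite /br /= (kvec_0 _ kA).
rewrite (br_cons _ _ kA (@lin1_hom _ _ X)) expr1 mulN1r opprK /=.
rewrite (IH k.-1); last exact: kvec_insP.
congr (_ + _).
rewrite /br shs_nil_l /= // => u U V; exact: (kvec_0 _ kA).
Qed.

Lemma br_lin1_l X A F : br (lin1 X) A F = X (A F).
Proof. by rewrite /br shs_nil_r. Qed.

Lemma br_0 k A F : kvec k A -> br A (fun=> 0) F = 0.
Proof.
by move=> kA; rewrite -[RHS](shs0 _ F); apply: shs_eq => U V; exact: (kvec_0 _ kA).
Qed.

Lemma br_0l A F : br (fun=> 0) A F = 0.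
Proof. by rewrite -[RHS](shs0 _ F). Qed.

Lemma br_alt k b A B : kvec k A -> kvec b B -> alt (br A B).
Proof.
move=> kA [aB _ _]; apply: shs_alt => U s f h t.
  by rewrite aB (kvec_opp _ _ kA).
by case: kA => aA _ _; exact: (ins_alt _ aA).
Qed.

Lemma br_hom k b A B : kvec k A -> hom b B -> hom (k + b).-1 (br A B).
Proof.
move=> kA hB; apply: shs_hom => U V UV.
have [Ub|Ub] := eqVneq (size U) b; last by rewrite hB // (kvec_0 _ kA).
case: kA => _ hA _; rewrite hA //=; apply: contra UV => /eqP<-.
by rewrite Ub addSn addnC.
Qed.

(** The second sum, in the second derivatives of f, is the failure of the left side to depend on df
    alone. It has to cancel in [dPi_kvec]. *)
Lemma br_ins_der k A B f F : kvec k A -> tens E x B ->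
  br A (ins f B) F = \sum_m E m f * br A (ins (x m) B) F +
    \sum_m wdg (ins (x m) B) (ins (E m f) A) F.
Proof.
move=> kA tB; rewrite -big_split /= /br /wdg.
under [RHS]eq_bigr do rewrite -shsZ -shsD.
rewrite -shs_sum; apply: shs_eq => U V.
rewrite {1}/ins tB (kvec_sum_l _ _ _ kA); apply: eq_bigr => m _.
by rewrite (kvec_mul _ _ _ kA).
Qed.

Lemma br_sum_der k A (h : 'I_n -> K) (B : 'I_n -> seq K -> K) F : kvec k A ->
  br A (fun U => \sum_m h m * B m U) F =
  \sum_m h m * br A (B m) F + \sum_m wdg (B m) (ins (h m) A) F.
Proof.
move=> kA; rewrite -big_split /= /br /wdg.
under [RHS]eq_bigr do rewrite -shsZ -shsD.
rewrite -shs_sum; apply: shs_eq => U V.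
rewrite (kvec_sum_l _ _ _ kA); apply: eq_bigr => m _.
by rewrite (kvec_mul _ _ _ kA).
Qed.

Section Bivector.
Variable Pi : seq K -> K.
Hypothesis kPi : kvec 2 Pi.

Definition ham f : K -> K := fun h => Pi [:: f; h].

Lemma ins_Pi f : ins f Pi = lin1 (ham f).
Proof. by have [_ h1 _] := kvec_ins f kPi; rewrite (hom1_lin1 h1). Qed.

Lemma der_ham f : der (ham f).
Proof. exact: (kvec1_der (kvec_ins f kPi)). Qed.

(* - [A, Pi], where (-1)^(3 (k + 1)) = - (-1)^k *)
Definition dPi k A F := - (br A Pi F + (-1) ^+ k * br Pi A F).

Lemma dPi_cons k A f F : kvec k A ->
  dPi k A (f :: F) = - dPi k.-1 (ins f A) F + Lie (ham f) A F.
Proof.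
move=> kA; have [_ hA _] := kA; have [_ hPi _] := kPi.
rewrite /dPi (br_cons _ _ kA hPi) (br_cons _ _ kPi hA) ins_Pi br_lin1_l.
rewrite (br_lin1 _ _ kA) /Lie expr2 mulrNN !mul1r.
have -> : (-1) ^+ k * (br Pi (ins f A) F - (-1) ^+ k * ham f (A F)) =
   - ((-1) ^+ k.-1 * br Pi (ins f A) F) - ham f (A F).
  rewrite mulrBr mulrA -expr2 sqrr_sign mul1r; congr (_ - _).
  (* In degree 0 the truncated [k.-1] does no harm: inserting f in a function gives 0. *)
  case: k kA hA => [|k] kA hA /=; last by rewrite exprS mulN1r mulNr.
  by rewrite ins_hom0 // (br_0 _ kPi) !mulr0 oppr0.
by ring.
Qed.

Lemma dPi_kvec k A : kvec k A -> kvec k.+1 (dPi k A).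
Proof.
move=> kA; have [aA hA tA] := kA; have [aPi hPi tPi] := kPi; split.
- move=> s f h t; rewrite /dPi (br_alt kA kPi) (br_alt kPi kA); ring.
- move=> F Fk; rewrite /dPi (br_hom kA hPi) ?addn2 // (br_hom kPi hA) //.
  by rewrite mulr0 addr0 oppr0.
move=> f F.
transitivity (\sum_m E m f * (- dPi k.-1 (ins (x m) A) F + Lie (ham (x m)) A F));
  last by apply: eq_bigr => m _; rewrite dPi_cons.
rewrite dPi_cons // /dPi /Lie.
under eq_bigr do rewrite -(br_lin1 _ _ kA) -ins_Pi opprK.
rewrite -(br_lin1 _ _ kA) -ins_Pi (br_ins_der _ _ kA tPi) opprK.
have -> : ins f A = fun F => \sum_m E m f * ins (x m) A F.
  by apply/funext => F'; rewrite /ins tA.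
rewrite (br_sum_der _ _ _ kPi).
have -> : br (fun F0 => \sum_m E m f * ins (x m) A F0) Pi F =
    \sum_m E m f * br (ins (x m) A) Pi F.
  rewrite -[RHS](eq_bigr _ (fun m _ => shsZ _ _ _)) -shs_sum.
  by apply: shs_eq.
have -> : ham f (A F) = \sum_m E m f * ham (x m) (A F).
  by rewrite /ham tPi.
(* The two non-tensorial sums agree: E_j E_m f is symmetric in j and m, and the wedge products
   differ by the sign of exchanging degrees k - 1 and 1. *)
have second : (-1) ^+ k.-1 * \sum_m wdg (ins (x m) A) (ins (E m f) Pi) F =
    \sum_m wdg (ins (x m) Pi) (ins (E m f) A) F.
  have -> : \sum_m wdg (ins (x m) Pi) (ins (E m f) A) F =
      \sum_m \sum_j E j (E m f) * wdg (ins (x m) Pi) (ins (x j) A) F.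
    apply: eq_bigr => m _; under eq_bigr do rewrite -shsZ.
    rewrite -shs_sum; apply: shs_eq => U V.
    by rewrite {2}/ins tA mulr_sumr; apply: eq_bigr => j _; rewrite mulrCA.
  rewrite exchange_big mulr_sumr; apply: eq_bigr => m _ /=.
  have -> : wdg (ins (x m) A) (ins (E m f) Pi) F =
      \sum_j E j (E m f) * wdg (ins (x m) A) (ins (x j) Pi) F.
    under eq_bigr do rewrite -shsZ.
    rewrite -shs_sum; apply: shs_eq => U V.
    by rewrite {2}/ins tPi mulr_sumr; apply: eq_bigr => j _; rewrite mulrCA.
  rewrite mulr_sumr; apply: eq_bigr => j _; rewrite EC mulrCA; congr (_ * _).
  have [_ h1 _] := kvec_insP (x m) kA; have [_ h2 _] := kvec_insP (x j) kPi.
  by rewrite (wdg_comm _ h1 h2) muln1 mulrA -expr2 sqrr_sign mul1r.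
rewrite mulrDr second; set S := \sum_m wdg _ _ F.
rewrite -[X in X = _]/(_) mulr_sumr.
transitivity (\sum_m E m f * br (ins (x m) A) Pi F +
   \sum_m (-1) ^+ k.-1 * (E m f * br Pi (ins (x m) A) F) +
   \sum_m E m f * ham (x m) (A F) - \sum_m E m f * br A (ins (x m) Pi) F);
  first by ring.
rewrite -!big_split -sumrB; apply: eq_bigr => m _ /=; ring.
Qed.

Definition Xi f := - D Pi [:: f].

Lemma dvg_ham f : dvg (ham f) = - Xi f.
Proof. by rewrite /Xi opprK. Qed.

(* By induction on the degree, inserting one function [f] at a time: up to sign,
   inserting [f] commutes with the curl and anticommutes with dPi up to the Lie
   derivative along the Hamiltonian field of [f], whose commutator with the curl
   is the insertion of its divergence - Xi f. *)
Theorem modular_identity k A F : kvec k A -> size F = k ->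
  D (dPi k A) F - dPi k.-1 (D A) F = (-1) ^+ k * Lie Xi A F.
Proof.
elim: F k A => [|f F IH] k A kA /=.
  (* For a function A the curl of A is 0, dPi A is minus its Hamiltonian field, and minus the
     divergence of that field is Xi A. *)
  case: k kA => // kA _; have [aA hA _] := kA; have [_ hPi _] := kPi.
  have DA0 : D A = fun=> 0.
    apply/funext => F; apply: big1 => i _.
    by rewrite hA ?size_rcons // derivation0 // mulr0 addr0.
  rewrite DA0 [dPi _ _ _]/dPi br_0l (br_0 _ kPi) mulr0 addr0 oppr0 subr0 mul1r.
  rewrite /Lie /= subr0 /dPi.
  rewrite /Xi -sumrN; apply: eq_bigr => i _.
  have -> : br A Pi [:: x i] = 0.
    by rewrite /br /= !hA // mulr0 addr0.
  rewrite add0r mul1r.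
  have -> : br Pi A [:: x i] = Pi [:: A [::]; x i].
    by rewrite /br /= [Pi [:: A [:: x i]]]hPi // add0r mul1r.
  by rewrite derivationN //; ring.
case: k kA => // k kA [Fk].
rewrite -[D _ (f :: F)]/(D (ins f (dPi k.+1 A)) F).
have -> : ins f (dPi k.+1 A) = fun F => - dPi k (ins f A) F + Lie (ham f) A F.
  by apply/funext => F'; rewrite /ins dPi_cons.
rewrite D_add D_opp (D_Lie _ (der_ham f) kA) dPi_cons; last exact: D_kvec.
have kf := kvec_ins f kA; have IHf := IH k _ kf Fk.
rewrite dvg_ham -[Lie Xi A _]/(ins f (Lie Xi A) F) Lie_ins.
have -> : A (rcons F (- Xi f)) = - ((-1) ^+ k * A (Xi f :: F)).
  have [aA _ _] := kA.
  by rewrite alt_rcons // Fk (kvec_opp _ _ kA) mulrN.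
rewrite -[ins f (D A)]/(D (ins f A)) exprS.
move/(congr1 -%R): IHf; rewrite opprB => IHf.
(* The two Lie derivatives of [D A] along the Hamiltonian field of f cancel; the extra term of
   [D_Lie] is the one by which inserting f fails to commute with the Lie derivative along Xi. *)
transitivity ((dPi k.-1 (D (ins f A)) F - D (dPi k (ins f A)) F)
   + (-1) ^+ k * A (Xi f :: F)); first by rewrite /=; ring.
by rewrite IHf; ring.
Qed.

End Bivector.

Lemma D_wdg k A X F : der X -> kvec k A ->
  D (wdg A (lin1 X)) F =
  Lie X A F + dvg X * A F - wdg (D A) (lin1 X) F.
Proof.
move=> dX kA; have DX := der_derivation dX; have [aA hA tA] := kA.
(* The last argument x_i is taken either by X, without sign, or by A, crossing the single entry left
   for X. *)
have wr i : wdg A (lin1 X) (rcons F (x i)) =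
    X (x i) * A F - shs (fun U V => A (rcons U (x i)) * lin1 X V) F.
  rewrite /wdg shs_rcons shs_nil_r => [|U v [|v' V]] /=; rewrite ?mulr0 //.
  rewrite mulrC -shsN; congr (_ + _); apply: shs_eq => U [|v [|v' V]] /=.
  - by rewrite !mulr0 oppr0.
  - by rewrite expr1 mulN1r.
  - by rewrite !mulr0 oppr0.
(* These terms of the Lie derivative will reappear when E_i differentiates the factor X v of the
   wedge product. *)
have Xsub : sub X A F = \sum_i shs (fun U V =>
    A (rcons U (x i)) * (if V is [:: v] then E i (X v) else 0)) F.
  rewrite -(br_lin1 _ _ kA) /br shs_comm -shs_sum; apply: shs_eq => U V.
  case: V => [|v [|v' V]] /=.
  - by rewrite (kvec_0 _ kA) mulr0 big1 // => i _; rewrite mulr0.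
  - rewrite muln1 -alt_rcons // -cats1 (kvec_mid _ _ _ kA).
    by apply: eq_bigr => i _; rewrite cats1 mulrC.
  - by rewrite (kvec_0 _ kA) mulr0 big1 // => i _; rewrite mulr0.
rewrite /Lie Xsub.
have -> : wdg (D A) (lin1 X) F = \sum_i shs (fun U V =>
   (E i (A (rcons U (x i))) + theta i * A (rcons U (x i))) * lin1 X V) F.
  by rewrite -shs_sum; apply: shs_eq => U V; rewrite mulr_suml.
rewrite dX /dvg mulr_suml -sumrB -big_split -sumrB; apply: eq_bigr => i _ /=.
rewrite wr ED derivationN // (derivation_shs _ _ (dE i)) EM.
have -> : shs (fun U V => E i (A (rcons U (x i)) * lin1 X V)) F =
  shs (fun U V => E i (A (rcons U (x i))) * lin1 X V) F +
  shs (fun U V => A (rcons U (x i)) * (if V is [:: v] then E i (X v) else 0)) F.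
  rewrite -shsD; apply: shs_eq => U V; rewrite EM; congr (_ + _ * _).
  by case: V => [|v [|v' V]] //=; exact: derivation0.
have -> : shs (fun U V =>
   (E i (A (rcons U (x i))) + theta i * A (rcons U (x i))) * lin1 X V) F =
  shs (fun U V => E i (A (rcons U (x i))) * lin1 X V) F +
  theta i * shs (fun U V => A (rcons U (x i)) * lin1 X V) F.
  by rewrite -shsZ -shsD; apply: shs_eq => U V; ring.
ring.
Qed.

(** Among the components of X x_j only the one along x_j counts, any other repeating a coordinate:
    this gives a trace. The prefix s1 holds the coordinates already passed. *)
Lemma sub_top k W X s1 s2 : kvec k W -> uniq (s1 ++ s2) ->
  (forall i : 'I_n, i \in s1 ++ s2) ->
  sub X (fun F => W (map x s1 ++ F)) (map x s2) =
  (\sum_(j <- s2) E j (X (x j))) * W (map x (s1 ++ s2)).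
Proof.
move=> kW; elim: s2 s1 => [|j s2 IH] s1 us alls /=; first by rewrite big_nil mul0r.
rewrite big_cons mulrDl; congr (_ + _).
  rewrite (kvec_mid _ _ _ kW) (bigD1 j) //= map_cat big1 ?addr0 // => m mj.
  have [aW _ _] := kW.
  have -> : map x s1 ++ x m :: map x s2 = map x (s1 ++ m :: s2) by rewrite map_cat.
  rewrite (alt_dup tf (alt_mapx x aW)) ?mulr0 //=.
  have := alls m; rewrite mem_cat inE (negPf mj) /= -mem_cat => m12.
  by rewrite -cat_rcons -cats1 -catA uniq_catCA /= m12.
have := IH (rcons s1 j); rewrite cat_rcons => <- //.
by apply: sub_eq => F; rewrite map_rcons cat_rcons.
Qed.

Lemma top_derivative W X : der X -> kvec n W ->
  X (g * W xs) = g * (Lie X W xs + dvg X * W xs).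
Proof.
move=> dX kW; have [_ XM] := der_derivation dX; rewrite XM /Lie.
have := @sub_top _ W X [::] (enum 'I_n) kW; rewrite cat0s => -> //; last first.
- by move=> i; rewrite mem_enum.
- exact: enum_uniq.
have -> : X g = g * \sum_i theta i * X (x i).
  rewrite dX mulr_sumr; apply: eq_bigr => i _.
  by rewrite /theta !mulrA ggi mul1r.
rewrite /dvg big_split big_enum /=; ring.
Qed.

(* Cartan's formula reduces [d (i_A mu)] on [X :: Xs] to [d (i_(A /\ X) mu)]
   on [Xs]. *)
Theorem kosz_flat k A Xs : kvec k A -> alls der Xs -> (k + size Xs)%N = n.+1 ->
  kosz (fun Ys => g * wdgs Ys A xs) Xs = g * wdgs Xs (D A) xs.
Proof.
elim: Xs k A => [|X Xs IH] k A kA dXs kn.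
  rewrite /kosz /= !big_ord0 addr0.
  (* With no field left, [A] has degree n + 1. *)
  have A0 F : A F = 0.
    apply: (kvec_top tf kA) => [|/eqP nk]; rewrite addn0 in kn.
      by rewrite kn.
    by move: kn; rewrite -nk => /n_Sn.
  have -> : A = fun=> 0 by apply/funext.
  by rewrite D_0 mulr0.
have [dX {}dXs] := dXs; have DX := der_derivation dX.
rewrite kosz_cons => [|Y Z Ys]; last by rewrite wdgs_swap mulrN.
have kAX := wdg_kvec kA (lin1_kvec dX).
rewrite /= (IH (k + 1)%N) //; last by rewrite addn1 addSn -addnS.
have kn' : (k + size Xs)%N = n by move: kn; rewrite /= addnS => -[].
have kW := wdgs_kvec kA dXs; rewrite kn' in kW.
rewrite (top_derivative dX kW) Lie_wdgs //.
have -> : \sum_(j < size Xs) (-1) ^+ j *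
    (g * wdgs (omit j Xs) (wdg A (lin1 (comm X (nth (fun=> 0) Xs j)))) xs) =
    g * lieW X A Xs xs.
  by rewrite -lieW_omit mulr_sumr; apply: eq_bigr => j _; rewrite mulrCA.
have -> : D (wdg A (lin1 X)) = fun F =>
    (Lie X A F + dvg X * A F) + - wdg (D A) (lin1 X) F.
  by apply/funext => F; rewrite (D_wdg _ dX kA).
rewrite wdgs_D wdgs_D wdgs_Z wdgs_N; ring.
Qed.

End Calculus.

(** * Shuffle permutations *)
Section ShuffleSums.
Variables (K : nmodType) (L : comPzRingType).
Implicit Types (F : seq K) (T : seq K -> seq K -> L).

Lemma shuffleP p q m (s : 'S_m) : reflect
  ((p + q)%N = m /\ forall i j : 'I_m, (i < j)%N -> (j < p)%N || (p <= i)%N ->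
     (s i < s j)%N) (shuffle p q s).
Proof.
apply: (iffP andP) => -[/eqP pq sh]; split=> //.
  by move=> i j ij c; have /forallP/(_ i)/forallP/(_ j)/implyP := sh; apply; rewrite ij.
by apply/forallP => i; apply/forallP => j; apply/implyP => /andP[]; exact: sh.
Qed.

Lemma lift_perm_onto m (i j : 'I_m.+1) (s : 'S_m.+1) : s i = j ->
  exists s', s = lift_perm i j s'.
Proof.
move=> sij; have /fin_all_exists[f fP] : forall k, exists k', s (lift i k) = lift j k'.
  move=> k; case: (unliftP j (s (lift i k))) => [k' ->|]; first by exists k'.
  by rewrite -sij => /perm_inj/eqP; rewrite eq_sym (negPf (neq_lift i k)).
have f_inj : injective f.
  by move=> k l /(congr1 (lift j)); rewrite -!fP => /perm_inj/lift_inj.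
exists (perm f_inj); apply/permP => k; case: (unliftP i k) => [k'|] ->.
  by rewrite lift_perm_lift permE.
by rewrite lift_perm_id.
Qed.

Lemma lift_perm_inj m (i j : 'I_m.+1) : injective (@lift_perm m i j).
Proof.
move=> s t st; apply/permP => k; apply: (@lift_inj _ j).
by rewrite -!(lift_perm_lift i) st.
Qed.

Lemma sum_lift_perm m (i j : 'I_m.+1) (G : 'S_m.+1 -> L) :
  \sum_(s : 'S_m.+1 | s i == j) G s = \sum_(s : 'S_m) G (lift_perm i j s).
Proof.
transitivity (\sum_(s in [set lift_perm i j s' | s' : 'S_m]) G s).
  apply: eq_bigl => s; apply/eqP/imsetP => [/lift_perm_onto[s' ->]|[s' _ ->]].
    by exists s'.
  exact: lift_perm_id.
by rewrite big_imset //= => s t _ _; exact: lift_perm_inj.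
Qed.

(** [permute] with the size of the permutation decoupled from [size F], for the induction on F. *)
Definition permuted F m (s : 'S_m) : seq K := [seq F`_(s i) | i <- enum 'I_m].

Lemma permuted_lift f F m (i : 'I_m.+1) (s : 'S_m) : size F = m ->
  permuted (f :: F) (lift_perm i ord0 s) =
  take i (permuted F s) ++ f :: drop i (permuted F s).
Proof.
move=> Fm; have sp : size (permuted F s) = m by rewrite size_map size_enum_ord.
have im : (i <= m)%N by rewrite -ltnS.
have st : size (take i (permuted F s)) = i by rewrite size_takel // sp.
apply: (@eq_from_nth _ 0).
  by rewrite size_map size_enum_ord size_cat /= st size_drop sp; lia.
move=> k; rewrite size_map size_enum_ord => km.
rewrite (nth_map (Ordinal km)) ?size_enum_ord // (nth_ord_enum _ (Ordinal km)).
case: (unliftP i (Ordinal km)) => [k' kE|kE]; rewrite kE; last first.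
  have -> : k = i by rewrite -kE.
  by rewrite lift_perm_id nth_cat st ltnn subnn.
have -> : k = bump i k' by have /(congr1 val) := kE.
rewrite lift_perm_lift /= nth_cat st /bump.
have nthp : (permuted F s)`_k' = F`_(s k').
  by rewrite (nth_map k') ?size_enum_ord // nth_ord_enum.
case: (leqP i k') => ik.
  rewrite ltnNge (leqW ik) /= add1n subSn //= nth_drop subnKC //.
by rewrite add0n ik nth_take // nthp.
Qed.

Lemma shuffle_lift0 p q m (s : 'S_m) :
  shuffle p.+1 q (lift_perm ord0 ord0 s) = shuffle p q s.
Proof.
apply/shuffleP/shuffleP => -[pq sh]; split=> [|i j ij c]; [lia | | lia |].
  by have := sh (lift ord0 i) (lift ord0 j); rewrite !lift_perm_lift !lift0 !ltnS; apply.
case: (unliftP ord0 j) ij c => [j' ->|-> //].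
case: (unliftP ord0 i) => [i' ->|-> _ _].
  by rewrite !lift_perm_lift !lift0 !ltnS; exact: sh.
by rewrite lift_perm_id lift_perm_lift.
Qed.

Lemma shuffle_liftp p q m (i0 : 'I_m.+1) (s : 'S_m) : i0 = p :> nat ->
  shuffle p q.+1 (lift_perm i0 ord0 s) = shuffle p q s.
Proof.
move=> ip; apply/shuffleP/shuffleP => -[pq sh]; split=> [|i j ij c]; [lia | | lia |].
  have := sh (lift i0 i) (lift i0 j); rewrite !lift_perm_lift !lift0 !ltnS; apply.
    by rewrite /= /bump ip; lia.
  by rewrite /= /bump ip; lia.
case: (unliftP i0 j) ij c => [j' ->|->]; last by rewrite ip; lia.
case: (unliftP i0 i) => [i' ->|-> _ _].
  rewrite !lift_perm_lift !lift0 !ltnS /= /bump ip => ij c; apply: sh.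
    by lia.
  by lia.
by rewrite lift_perm_id lift_perm_lift.
Qed.

(** A shuffle increases on both blocks, so the least index must open one of them. *)
Lemma shuffle_min p q m (s : 'S_m.+1) (i : 'I_m.+1) : shuffle p q s ->
  s i = ord0 -> (i == 0 :> nat) && (0 < p)%N || (i == p :> nat) && (0 < q)%N.
Proof.
move=> /shuffleP[pq sh] si.
have [i0|i0] := posnP i; first by have := ltn_ord i; lia.
have im := ltn_ord i; suff : (i == p :> nat) by lia.
apply: contraT => ip.
have i1 : (i.-1 < m.+1)%N by lia.
have := sh (Ordinal i1) i; rewrite si /= ltn0; apply; lia.
Qed.

(** The shuffles are sorted by the position of the first entry f, which is 0 or p; removing it
    leaves a shuffle of the remaining entries, and in position p it contributes the sign (-1)^p.
    This is the recursion of [shs]. *)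
Lemma shuffle_shs p q T F :
  \sum_(s : 'S_(size F) | shuffle p q s) (-1) ^+ s *
     T (take p (permuted F s)) (drop p (permuted F s)) =
  shs (fun U V => if (size U == p) && (size V == q) then T U V else 0) F.
Proof.
elim: F p q T => [|f F IH] p q T.
  rewrite /=; have -> : (0 == p)%N && (0 == q)%N = (p + q == 0)%N by lia.
  have pm (s : 'S_0) : permuted [::] s = [::].
    by apply: size0nil; rewrite size_map size_enum_ord.
  case: ifP => [/eqP pq|npq]; last first.
    by rewrite big_pred0 // => s; apply/negP => /shuffleP[] /eqP; rewrite npq.
  rewrite (big_pred1 1%g) => [|s].
    by rewrite odd_perm1 mul1r !pm take_oversize // drop_oversize.
  apply/shuffleP/eqP => [_|_]; first by apply/permP => -[].
  by split=> // -[].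
set G : 'S_(size F).+1 -> L := fun s => if shuffle p q s then (-1) ^+ s *
   T (take p (permuted (f :: F) s)) (drop p (permuted (f :: F) s)) else 0.
rewrite [LHS]/= (_ : \sum_(s | _) _ = \sum_s G s); last by rewrite big_mkcond.
have G0 s i : G s != 0 -> s i = ord0 ->
    (i == 0 :> nat) && (0 < p)%N || (i == p :> nat) && (0 < q)%N.
  rewrite /G; case: ifP => [sh _|_]; last by rewrite eqxx.
  exact: shuffle_min.
have sz (s : 'S_(size F)) : size (permuted F s) = size F.
  by rewrite size_map size_enum_ord.
have [pq|npq] := eqVneq (p + q)%N (size F).+1; last first.
  rewrite big1 => [|s _].
    rewrite (@shs_hom _ _ _ (p + q)) //=; last by rewrite eq_sym.
    by move=> U V; case: ifP => // /andP[/eqP-> /eqP->]; rewrite eqxx.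
  by rewrite /G; case: ifP => // /shuffleP[/eqP]; rewrite (negPf npq).
have left : (0 < p)%N -> \sum_(s : 'S_(size F).+1 | s ord0 == ord0) G s =
    shs (fun U V => if (size (f :: U) == p) && (size V == q) then T (f :: U) V else 0) F.
  case: p @G G0 pq => // p G G0 pq _; rewrite sum_lift_perm.
  rewrite -(IH p q (fun U V => T (f :: U) V)) [RHS]big_mkcond.
  apply: eq_bigr => s _; rewrite /G shuffle_lift0; case: ifP => // _.
  rewrite permuted_lift // take0 drop0 /= odd_lift_perm /=.
  by [].
have right (i : 'I_(size F).+1) : i = p :> nat -> (0 < q)%N ->
    \sum_(s : 'S_(size F).+1 | s i == ord0) G s = shs (fun U V => (-1) ^+ size U *
     (if (size U == p) && (size (f :: V) == q) then T U (f :: V) else 0)) F.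
  clear left; case: q @G G0 pq => // q G G0 pq ip _; rewrite sum_lift_perm.
  transitivity ((-1) ^+ p * shs (fun U V => if (size U == p) && (size V == q)
      then T U (f :: V) else 0) F); last first.
    rewrite -shsZ; apply: shs_eq => U V; rewrite /= eqSS.
    by case: ifP => [/andP[/eqP-> _]|]; rewrite ?mulr0.
  rewrite -(IH p q (fun U V => T U (f :: V))) [in RHS]big_mkcond mulr_sumr.
  apply: eq_bigr => s _; rewrite /G shuffle_liftp //; case: ifP => [|_]; last by rewrite mulr0.
  have pF : (p <= size F)%N by rewrite -ltnS -pq addnS ltnS leq_addr.
  have st : size (take p (permuted F s)) = p by rewrite size_takel // sz.
  move=> _; rewrite permuted_lift // ip take_size_cat // drop_size_cat //.
  by rewrite odd_lift_perm ip /= addbF signr_addb signr_odd mulrA.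
have split0 : \sum_s G s = \sum_(s : 'S_(size F).+1 | s ord0 == ord0) G s +
    \sum_(s : 'S_(size F).+1 | s ord0 != ord0) G s by rewrite (bigID (fun s : 'S_(size F).+1 => s ord0 == ord0)).
(* For p = 0 the positions 0 and p coincide, and f can only open the second block. *)
rewrite /=; have [p0|p0] := posnP p.
  have q0 : (0 < q)%N by move: pq; rewrite p0 add0n => ->.
  rewrite split0 (right ord0) ?p0 // [X in _ + X]big1 ?addr0.
    rewrite [X in _ = X + _](_ : _ = 0) ?add0r //.
    by rewrite -[RHS](shs0 _ F); apply: shs_eq.
  move=> s s0; apply/eqP; apply: contraNT s0 => Gs.
  have := G0 _ (s^-1%g ord0) Gs (permKV _ _); rewrite p0 /= andbF /= => /andP[/eqP e _].
  have e0 : s^-1%g ord0 = ord0 by apply: val_inj.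
  by rewrite -{1}e0 permKV.
rewrite split0 left //; congr (_ + _).
have [q0|q0] := posnP q.
  rewrite big1 => [|s s0].
    by rewrite -[LHS](shs0 _ F); apply: shs_eq => U V; rewrite q0 andbF mulr0.
  apply/eqP; apply: contraNT s0 => Gs.
  have := G0 _ (s^-1%g ord0) Gs (permKV _ _); rewrite q0 ltnn andbF orbF => /andP[/eqP e _].
  have e0 : s^-1%g ord0 = ord0 by apply: val_inj.
  by rewrite -{1}e0 permKV.
have pm : (p < (size F).+1)%N by lia.
rewrite -(right (Ordinal pm)) // [LHS]big_mkcond [RHS]big_mkcond.
apply: eq_bigr => s _; have [Gs|Gs] := eqVneq (G s) 0; first by rewrite Gs !if_same.
have s0 := permKV s ord0.
have := G0 _ (s^-1%g ord0) Gs s0 => /orP[]/andP[/eqP e _].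
  have e0 : s^-1%g ord0 = ord0 by apply: val_inj.
  rewrite -{1}e0 s0 eqxx /=; case: eqP => // sp.
  have : s (Ordinal pm) = s ord0 by rewrite sp -{2}e0 s0.
  by move/perm_inj/(congr1 val) => /= pp; rewrite pp in p0.
have e0 : s^-1%g ord0 = Ordinal pm by apply: val_inj.
rewrite -e0 s0 eqxx; case: eqP => // sp; case/negP: Gs.
have : s ord0 = s (s^-1%g ord0) by rewrite s0.
by move/perm_inj/(congr1 val) => /=; rewrite e => pp; rewrite -pp in p0.
Qed.

End ShuffleSums.

Lemma size_omit (T : Type) (s : seq T) j : (j < size s)%N ->
  size (omit j s) = (size s).-1.
Proof. by move=> js; rewrite size_cat size_takel ?size_drop; lia. Qed.

(** * Laplace expansion: wedge products of vectors as determinants *)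

Section Laplace.
Variables (K : nmodType) (L : comPzRingType).
Implicit Types (v : K -> L) (F : seq K).

Lemma wdg_lin1_omit v (w : seq K -> L) F :
  wdg (lin1 v) w F = \sum_(j < size F) (-1) ^+ j * (v F`_j * w (omit j F)).
Proof.
elim: F w => [|f F IH] w; first by rewrite /wdg /= mul0r big_ord0.
rewrite (wdg_cons _ _ _ (@lin1_hom _ _ v)) big_ord_recl mul1r /= {1}/omit /= drop0.
rewrite expr1 IH mulr_sumr; congr (_ + _).
  by rewrite /wdg shs_nil_l // => u U V; rewrite /ins /= mul0r.
by apply: eq_bigr => j _; rewrite /= mulrA exprS.
Qed.

Lemma nth_omit F j k : (j < size F)%N -> (omit j F)`_k = F`_(bump j k).
Proof.
move=> jF; rewrite nth_cat size_takel ?(ltnW jF) // /bump; case: (ltnP k j) => kj.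
  by rewrite nth_take.
by rewrite nth_drop addSn subnKC.
Qed.

End Laplace.

Lemma det_dw (R : comNzRingType) (K : nmodType) (vs : seq (K -> R)) (F : seq K) :
  size F = size vs ->
  \det (\matrix_(i < size vs, j < size vs) (nth (fun=> 0) vs i) F`_j) = dw vs F.
Proof.
elim: vs F => [|v vs IH] F; first by move/size0nil->; rewrite det_mx00.
move=> Fv; rewrite (expand_det_row _ ord0) /= wdg_lin1_omit Fv.
apply: eq_bigr => j _; rewrite mxE /= /cofactor add0n mulrCA; congr (_ * (_ * _)).
have jF : (j < size F)%N by rewrite Fv.
rewrite -IH ?size_omit ?Fv //; congr (\det _); apply/matrixP => i k.
by rewrite !mxE /= nth_omit.
Qed.

(** * Calculus of several variables *)
Lemma continuous_atP (R : realType) (T : topologicalType) (f : T -> R) x :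
  {for x, continuous f} <->
  forall e, 0 < e -> \forall y \near x, `|f x - f y| < e.
Proof. by rewrite /prop_for /continuous_at; split=> /cvgrPdist_lt. Qed.

Section RowVectors.
Variables (R : realType) (n : nat).
Implicit Types (x y u v : 'rV[R]_n) (f : 'rV[R]_n -> R).

Lemma ball_rV x e y : 0 < e -> (ball x e y <-> forall j, `|x 0 j - y 0 j| < e).
Proof.
move=> e0; split; first by case=> _ xy j; exact: xy.
by move=> xy; split=> // i j; rewrite ord1; exact: xy.
Qed.

Lemma nbhs_rV x (U : set 'rV[R]_n) : nbhs x U ->
  exists2 e, 0 < e & forall y, (forall j, `|x 0 j - y 0 j| < e) -> U y.
Proof.
move=> /nbhs_ballP[e /= e0 eU]; exists e => // y xy; apply: eU.
by apply/ball_rV.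
Qed.

Lemma continuous_rV_at f x : {for x, continuous f} <->
  forall e, 0 < e -> exists2 d, 0 < d &
    forall y, (forall j, `|x 0 j - y 0 j| < d) -> `|f x - f y| < e.
Proof.
split=> [/continuous_atP fx e /fx /nbhs_rV //|fx].
apply/continuous_atP => e /fx[d d0 dP].
by apply: filterS (nbhsx_ballx x d d0) => y /(ball_rV _ _ d0); exact: dP.
Qed.

Lemma continuous_rV (T : topologicalType) (c : T -> 'rV[R]_n) t :
  (forall j, {for t, continuous (fun s => c s 0 j)}) -> {for t, continuous c}.
Proof.
move=> cc; apply/cvg_ballP => e e0.
have : \forall s \near t, forall j, `|c t 0 j - c s 0 j| < e.
  apply: filter_forall => j.
  have /cvgr_dist_lt := cc j; exact.
by apply: filterS => s /(ball_rV _ _ e0).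
Qed.

Lemma near_open f (U : set 'rV[R]_n) x e : 0 < e -> open U -> U x ->
  {for x, continuous f} -> exists2 d, 0 < d &
    forall y, (forall j, `|x 0 j - y 0 j| < d) -> `|f x - f y| < e /\ U y.
Proof.
move=> e0 oU Ux /continuous_rV_at/(_ _ e0)[d1 d10 P1].
have [d2 d20 P2] := nbhs_rV (open_nbhs_nbhs (conj oU Ux)).
exists (Num.min d1 d2) => [|y xy]; first by rewrite lt_min d10.
by split; [apply: P1 | apply: P2] => j;
   have := xy j; rewrite lt_min => /andP[].
Qed.

Lemma is_derive_line f x v t : derivable f (t *: v + x) v ->
  is_derive t 1 (fun s => f (s *: v + x)) ('D_v f (t *: v + x)).
Proof.
have eq_rate : (fun h : R => h^-1 *: (((fun s => f (s *: v + x)) \o shift t)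
      (h *: 1) - f (t *: v + x))) =
    (fun h : R => h^-1 *: ((f \o shift (t *: v + x)) (h *: v) - f (t *: v + x))).
  apply/funext => h /=; congr (_ *: (f _ - _)).
  by rewrite [h *: 1]mulr1 scalerDl addrA.
move=> df; apply: DeriveDef; first by rewrite /derivable eq_rate.
by rewrite /derive eq_rate.
Qed.

Lemma mvt_line f x v (s : R) : (forall t : R, `|t| <= `|s| -> derivable f (t *: v + x) v) ->
  exists2 c, `|c| <= `|s| & f (s *: v + x) - f x = s * 'D_v f (c *: v + x).
Proof.
move=> df; set phi := fun t : R => f (t *: v + x).
have dphi (t : R) : `|t| <= `|s| -> is_derive t 1 phi ('D_v f (t *: v + x)).
  by move=> ts; apply: is_derive_line; exact: df.
have cphi (a b : R) : (forall t, t \in `[a, b]%R -> `|t| <= `|s|) ->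
    {within `[a, b], continuous phi}.
  move=> ab; apply: derivable_within_continuous => t tab.
  by have [] := dphi _ (ab t tab).
have x0 : f x = phi 0 by rewrite /phi scale0r add0r.
rewrite x0 -/(phi s); have [s0|s0] := leP 0 s.
  have bnd t : t \in `[0, s]%R -> `|t| <= `|s|.
    by rewrite in_itv /= => /andP[t0 ts]; rewrite !ger0_norm.
  have dd t : t \in `]0, s[%R -> is_derive t 1 phi ('D_v f (t *: v + x)).
    by move=> tI; apply: dphi; apply: bnd; exact: subset_itv_oo_cc.
  have [c cI ->] := MVT_segment s0 dd (cphi _ _ bnd).
  by exists c; [exact: bnd | rewrite subr0 mulrC].
have bnd t : t \in `[s, 0]%R -> `|t| <= `|s|.
  by rewrite in_itv /= => /andP[t0 ts]; rewrite !ler0_norm ?lerN2 // ltW.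
have dd t : t \in `]s, 0[%R -> is_derive t 1 phi ('D_v f (t *: v + x)).
  by move=> tI; apply: dphi; apply: bnd; exact: subset_itv_oo_cc.
have [c cI e] := MVT_segment (ltW s0) dd (cphi _ _ bnd).
exists c; first exact: bnd.
by apply: oppr_inj; rewrite opprB e sub0r mulrN mulrC.
Qed.

Let hyb x y k : 'rV[R]_n := \row_j (if (j < k)%N then y 0 j else x 0 j).

Let hybS x y (k : 'I_n) :
  hyb x y k.+1 = (y 0 k - x 0 k) *: unit_vec R k + hyb x y k.
Proof.
apply/rowP => j; rewrite !mxE ltnS leq_eqVlt eqxx /= -val_eqE /=.
by case: eqVneq => [/val_inj->|_] /=; rewrite ?ltnn; [ring | ring].
Qed.

(* f y is changed into f x one coordinate at a time. *)
Lemma coordinate_slopes f x (U : set 'rV[R]_n) : open U -> U x -> Ck U 1 f ->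
  exists a : 'I_n -> 'rV[R]_n -> R,
  [/\ forall y, f y - f x = \sum_k (y 0 k - x 0 k) * a k y,
      forall k, {for x, continuous (a k)} &
      forall k, a k x = 'D_(unit_vec R k) f x].
Proof.
move=> oU Ux [_ df].
(* Where y_k = x_k the factor y_k - x_k vanishes and the value is free; the derivative at x makes
   the slope continuous at x. *)
exists (fun k y => if y 0 k == x 0 k then 'D_(unit_vec R k) f x
  else (f (hyb x y k.+1) - f (hyb x y k)) / (y 0 k - x 0 k)); split; last first.
- by move=> k; rewrite eqxx.
- move=> k; have [dk [ck _]] := df k.
  apply/continuous_rV_at => e e0; rewrite eqxx.
  have [d d0 dP] := near_open e0 oU Ux (ck x Ux); exists d => // y xy.
  case: eqVneq => [_|yk]; first by rewrite subrr normr0.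
  (* The edge along which coordinate k moves stays in the box around x, so the mean value theorem
     turns the slope into a derivative near x. *)
  have near_hyb t : `|t| <= `|y 0 k - x 0 k| -> forall j,
      `|x 0 j - (t *: unit_vec R k + hyb x y k) 0 j| < d.
    move=> tk j; rewrite !mxE eqxx /=; case: eqVneq => [->|_].
      rewrite ltnn mulr1 opprD addrCA subrr addr0 normrN (le_lt_trans tk) //.
      by rewrite distrC.
    by rewrite mulr0 add0r; case: ifP => _; rewrite ?subrr ?normr0.
  rewrite hybS.
  have [t tk|c ck' ->] := @mvt_line f (hyb x y k) (unit_vec R k) (y 0 k - x 0 k).
    by apply: dk; have [] := dP _ (near_hyb t tk).
  rewrite mulrC mulKf ?subr_eq0 //.
  by have [] := dP _ (near_hyb c ck').
move=> y.
transitivity (\sum_(k < n) (f (hyb x y k.+1) - f (hyb x y k))).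
  rewrite -(big_mkord xpredT (fun k => f (hyb x y k.+1) - f (hyb x y k))).
  rewrite telescope_sumr //; congr (f _ - f _); apply/rowP => j; rewrite mxE //.
  by rewrite ltn_ord.
apply: eq_bigr => k _; case: eqVneq => [yx|yx].
  by rewrite hybS yx !subrr scale0r add0r subrr mul0r.
by rewrite mulrC divfK // subr_eq0.
Qed.

(** The slopes of [f] along [c], multiplied by the Caratheodory slopes of the coordinates of [c],
    form a Caratheodory slope of the composite; continuity of the partial derivatives suffices for
    this. *)
Lemma is_derive_curve f (U : set 'rV[R]_n) (c : R -> 'rV[R]_n) (t : R)
    (dc : 'I_n -> R) : open U -> U (c t) -> Ck U 1 f ->
  (forall j, is_derive t 1 (fun s => c s 0 j) (dc j)) ->
  is_derive t 1 (f \o c) (\sum_j dc j * 'D_(unit_vec R j) f (c t)).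
Proof.
move=> oU Uc Cf dcj; have [a [fa ca aD]] := coordinate_slopes oU Uc Cf.
have /choice[g gP] : forall j, exists g : R -> R,
    [/\ forall z, c z 0 j - c t 0 j = g z * (z - t),
        {for t, continuous g} & g t = dc j].
  by move=> j; apply/is_derive1_caratheodory.
apply/is_derive1_caratheodory; exists (fun z => \sum_j g j z * a j (c z)); split.
- move=> z /=; rewrite fa mulr_suml; apply: eq_bigr => j _.
  by have [-> _ _] := gP j; ring.
- have cc : {for t, continuous c}.
    apply: continuous_rV => j; apply: differentiable_continuous.
    by apply/derivable1_diffP; have [] := dcj j.
  rewrite (_ : (fun z => _) = \sum_j (fun z => g j z * a j (c z))); last first.
    by apply/funext => z; rewrite fct_sumE.
  apply: (big_ind (fun h : R -> R => {for t, continuous h})).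
  + exact: cst_continuous.
  + by move=> h1 h2; exact: continuousD.
  + move=> j _; have [_ cg _] := gP j; apply: continuousM => //.
    exact: (@continuous_comp _ _ _ c (a j)).
- by apply: eq_bigr => j _; have [_ _ ->] := gP j; rewrite aD.
Qed.

Lemma is_derive_lineE f x v d :
  is_derive x v f d <-> is_derive (0 : R) 1 (fun s : R => f (s *: v + x)) d.
Proof.
have eq_rate : (fun h : R => h^-1 *: (((fun s => f (s *: v + x)) \o
    shift 0) (h *: 1) - f (0 *: v + x))) =
    (fun h : R => h^-1 *: ((f \o shift x) (h *: v) - f x)).
  apply/funext => h /=; congr (_ *: (f _ - f _)).
    by rewrite [h *: 1]mulr1 addr0.
  by rewrite scale0r add0r.
split=> -[df <-]; apply: DeriveDef.
- by rewrite /derivable eq_rate.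
- by rewrite /derive eq_rate.
- by rewrite /derivable -eq_rate.
- by rewrite /derive -eq_rate.
Qed.

Lemma is_derive_C1 f (U : set 'rV[R]_n) x u : open U -> U x -> Ck U 1 f ->
  is_derive x u f (\sum_j u 0 j * 'D_(unit_vec R j) f x).
Proof.
move=> oU Ux Cf; apply/is_derive_lineE.
have U0 : U (0 *: u + x) by rewrite scale0r add0r.
have := @is_derive_curve f U (fun s => s *: u + x) 0 (fun j => u 0 j) oU U0 Cf.
rewrite scale0r add0r; apply => j.
apply/is_derive1_caratheodory; exists (cst (u 0 j)); split=> //.
  by move=> z; rewrite !mxE mul0r add0r addrK subr0 mulrC.
exact: cst_continuous.
Qed.

Lemma derive_C1 f (U : set 'rV[R]_n) x u : open U -> U x -> Ck U 1 f ->
  'D_u f x = \sum_j u 0 j * 'D_(unit_vec R j) f x.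
Proof. by move=> oU Ux Cf; have [_ ->] := is_derive_C1 u oU Ux Cf. Qed.

Lemma is_derive_translate f x w v : derivable f (x + w) v ->
  is_derive x v (fun z => f (z + w)) ('D_v f (x + w)).
Proof.
move=> df; apply/is_derive_lineE.
have /is_derive_lineE := derivableP df.
by congr is_derive; apply/funext => s; rewrite addrA.
Qed.

(** The second difference over a square of side s is s^2 times either mixed derivative at a nearby
    point, by the mean value theorem applied in each direction. If the two values at x differed by D
    > 0, approximating both within D / 2 would be contradictory. *)
Lemma schwarz f (U : set 'rV[R]_n) x i j : open U -> U x -> Ck U 2 f ->
  'D_(unit_vec R i) ('D_(unit_vec R j) f) x =
  'D_(unit_vec R j) ('D_(unit_vec R i) f) x.
Proof.
move=> oU Ux [_ C2].
set ei := unit_vec R i; set ej := unit_vec R j.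
have second k l e : 0 < e -> exists2 d, 0 < d & forall s, 0 < s -> s < d ->
    exists2 r, `|r - 'D_(unit_vec R l) ('D_(unit_vec R k) f) x| < e &
    f (s *: unit_vec R k + x + s *: unit_vec R l) - f (s *: unit_vec R k + x) -
    (f (x + s *: unit_vec R l) - f x) = s * (s * r).
  move=> e0; have [dk [_ dkl]] := C2 k; have [dl [cl _]] := dkl l.
  have [d d0 dP] := near_open e0 oU Ux (cl x Ux).
  (* Half of d, because for k = l the two displacements, each at most s, add up in the same
     coordinate. *)
  have d20 : 0 < d / 2 by rewrite divr_gt0.
  exists (d / 2) => // s s0 sd.
  have box a b : `|a| <= `|s| -> `|b| <= `|s| ->
    forall m, `|x 0 m - (b *: unit_vec R l + (a *: unit_vec R k + x)) 0 m| < d.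
    move=> as_ bs m; rewrite !mxE eqxx /=.
    have -> : x 0 m - (b * (m == l)%:R + (a * (m == k)%:R + x 0 m)) =
       - (b * (m == l)%:R + a * (m == k)%:R) by ring.
    rewrite normrN (le_lt_trans (ler_normD _ _)) // !normrM.
    rewrite (gtr0_norm s0) in as_ bs.
    have c01 (c : bool) : `|c%:R : R| <= 1 by case: c; rewrite ?normr1 ?normr0.
    apply: (@le_lt_trans _ _ (s * 1 + s * 1)); last by lra.
    by apply: lerD; apply: ler_pM.
  have [t ts|a as_ e1] := @mvt_line (fun z => f (z + s *: unit_vec R l) - f z) x (unit_vec R k) s.
    apply: derivableB; last first.
      by apply: dk; have [] := dP _ (box t 0 ts _); rewrite ?normr0 // scale0r add0r.
    have [] // := @is_derive_translate f (t *: unit_vec R k + x) (s *: unit_vec R l) (unit_vec R k).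
    apply: dk; rewrite addrC; by have [] := dP _ (box t s ts (lexx _)).
  have da0 : derivable f (a *: unit_vec R k + x) (unit_vec R k).
    by apply: dk; have [] := dP _ (box a 0 as_ _); rewrite ?normr0 // scale0r add0r.
  have da1 : derivable f (a *: unit_vec R k + x + s *: unit_vec R l) (unit_vec R k).
    by apply: dk; rewrite addrC; have [] := dP _ (box a s as_ (lexx _)).
  have [dt et] := is_derive_translate da1.
  rewrite deriveB // et [X in 'D__ f X - _]addrC in e1.
  have [t ts|b bs e2] := @mvt_line ('D_(unit_vec R k) f) (a *: unit_vec R k + x) (unit_vec R l) s.
    by apply: dl; have [] := dP _ (box a t as_ ts).
  rewrite e2 in e1.
  exists ('D_(unit_vec R l) ('D_(unit_vec R k) f) (b *: unit_vec R l + (a *: unit_vec R k + x))).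
    by rewrite distrC; have [] := dP _ (box a b as_ bs).
  exact: e1.
apply/eqP; rewrite -subr_eq0 -normr_le0 leNgt; apply/negP => D0.
set D := `|_| in D0.
have D20 : 0 < D / 2 by rewrite divr_gt0.
have [d1 d10 P1] := second j i _ D20; have [d2 d20 P2] := second i j _ D20.
have [s /andP[s0]] : exists s, 0 < s < Num.min d1 d2.
  exists (Num.min d1 d2 / 2); have m0 : 0 < Num.min d1 d2 by rewrite lt_min d10.
  by apply/andP; split; lra.
rewrite lt_min => /andP[s1 s2].
have [r1 r1D e1] := P1 s s0 s1; have [r2 r2D e2] := P2 s s0 s2.
(* The second difference is symmetric in the two directions. *)
have r12 : r1 = r2.
  apply: (mulfI (lt0r_neq0 s0)); apply: (mulfI (lt0r_neq0 s0)).
  rewrite -e1 -e2 -!addrA [s *: unit_vec R i + (x + _)]addrCA.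
  rewrite [s *: unit_vec R j + (x + _)]addrCA [s *: unit_vec R j + s *: _]addrC.
  rewrite [x + s *: unit_vec R i]addrC [x + s *: unit_vec R j]addrC; ring.
move: r1D r2D; rewrite r12 => r1D r2D.
have := ler_distD r2 ('D_ei ('D_ej f) x) ('D_ej ('D_ei f) x).
rewrite leNgt => /negP; apply; rewrite -/D [D]splitr; apply: ltrD; [rewrite distrC; exact: r1D | exact: r2D].
Qed.

End RowVectors.

(** * Stability of the classes C^k *)

Section CkTheory.
Variables (R : realType) (n : nat).
Implicit Types (U V : set 'rV[R]_n) (f g : 'rV[R]_n -> R).

Lemma Ck_sub U V k f : V `<=` U -> Ck U k f -> Ck V k f.
Proof.
move=> VU; elim: k f => [|k IH] f [fc fd].
  by split=> // x /VU; exact: fc.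
split=> [x /VU|i]; first exact: fc.
by have [d c] := fd i; split=> [x /VU|]; [exact: d | exact: IH].
Qed.

Lemma Ck_local U k f :
  (forall x, U x -> exists2 V, V x & Ck V k f) -> Ck U k f.
Proof.
elim: k f => [|k IH] f Uf.
  by split=> // x /Uf[V Vx [c _]]; exact: c.
split=> [x /Uf[V Vx [c _]]|i]; first exact: c.
split=> [x /Uf[V Vx [_ /(_ i)[d _]]]|]; first exact: d.
by apply: IH => x /Uf[V Vx [_ /(_ i)[_ c]]]; exists V.
Qed.

Lemma Ck_le U k m f : (m <= k)%N -> Ck U k f -> Ck U m f.
Proof.
move=> mk; rewrite -(subnK mk); elim: (k - m)%N => // j IH.
by rewrite addSn => /CkS/IH.
Qed.

Lemma Ck_sum U k (I : Type) (r : seq I) (F : I -> 'rV[R]_n -> R) : open U ->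
  (forall i, Ck U k (F i)) -> Ck U k (\sum_(i <- r) F i).
Proof.
move=> oU CF; apply: (big_ind (Ck U k)) => //.
  exact: (Ck_cst k 0 oU).
by move=> f g; exact: CkD.
Qed.

Lemma Ck_prod U k (I : Type) (r : seq I) (F : I -> 'rV[R]_n -> R) : open U ->
  (forall i, Ck U k (F i)) -> Ck U k (\prod_(i <- r) F i).
Proof.
move=> oU CF; apply: (big_ind (Ck U k)) => //.
  exact: (Ck_cst k 1 oU).
by move=> f g; exact: CkM.
Qed.

Lemma is_derive_coord (x u : 'rV[R]_n) j : is_derive x u (fun y => y 0 j) (u 0 j).
Proof.
apply/is_derive_lineE; apply/is_derive1_caratheodory.
exists (cst (u 0 j)); split=> //; last exact: cst_continuous.
by move=> z; rewrite !mxE mul0r add0r addrK subr0 mulrC.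
Qed.

Lemma Ck_coord U k j : open U -> Ck U k (fun y => y 0 j).
Proof.
have cc x : {for x, continuous (fun y : 'rV[R]_n => y 0 j)}.
  exact: coord_continuous.
move=> oU; case: k => [|k]; split=> // i.
split=> [x _|]; first by have [] := is_derive_coord x (unit_vec R i) j.
apply: (Ck_eq oU _ (Ck_cst k (unit_vec R i 0 j) oU)) => x _.
by have [_ ->] := is_derive_coord x (unit_vec R i) j.
Qed.

Lemma is_derive_compose V f (c : 'rV[R]_n -> 'rV[R]_n) x u : open V ->
  V (c x) -> Ck V 1 f -> (forall j, derivable (fun y => c y 0 j) x u) ->
  is_derive x u (f \o c)
    (\sum_j 'D_u (fun y => c y 0 j) x * 'D_(unit_vec R j) f (c x)).
Proof.
move=> oV Vc Cf dc; apply/is_derive_lineE.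
have V0 : V (c (0 *: u + x)) by rewrite scale0r add0r.
have := @is_derive_curve R n f V (fun s => c (s *: u + x)) 0
  (fun j => 'D_u (fun y => c y 0 j) x) oV V0 Cf.
rewrite scale0r add0r; apply => j.
by apply/(is_derive_lineE (fun y => c y 0 j)); exact: derivableP.
Qed.

Lemma Ck_comp U V k f (c : 'rV[R]_n -> 'rV[R]_n) : open U -> open V ->
  (forall x, U x -> V (c x)) -> (forall j, Ck U k (fun y => c y 0 j)) ->
  Ck V k f -> Ck U k (f \o c).
Proof.
move=> oU oV UV; elim: k f => [|k IH] f Cc Cf.
all: have cont x : U x -> {for x, continuous (f \o c)}
  by move=> Ux; apply: continuous_comp; [apply: continuous_rV => j;
     have [cc _] := Cc j; exact: cc | have [fc _] := Cf; apply: fc; exact: UV].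
  by split.
split=> // i.
have dfc x : U x -> is_derive x (unit_vec R i) (f \o c)
    (\sum_j 'D_(unit_vec R i) (fun y => c y 0 j) x * 'D_(unit_vec R j) f (c x)).
  move=> Ux; apply: (@is_derive_compose V) => //; first exact: UV.
    exact: (Ck_le _ Cf).
  by move=> j; have [_ /(_ i)[d _]] := Cc j; exact: d.
split=> [x /dfc[]//|].
apply: (@Ck_eq _ _ _ _ (\sum_j ('D_(unit_vec R i) (fun y => c y 0 j)) *
   ('D_(unit_vec R j) f \o c))) => //.
  by move=> x /dfc[_ ->]; rewrite fct_sumE.
apply: Ck_sum => // j; apply: CkM => //.
  by have [_ /(_ i)[_]] := Cc j.
apply: IH => [m|]; first exact: CkS.
by have [_ /(_ j)[_]] := Cf.
Qed.

Lemma CkV U k f : open U -> (forall x, U x -> f x != 0) -> Ck U k f ->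
  Ck U k (fun x => (f x)^-1).
Proof.
move=> oU f0; elim: k => [|k IH] Cf.
all: have cont x : U x -> {for x, continuous (fun x => (f x)^-1)}
  by move=> Ux; apply: continuousV; [exact: f0 | have [fc _] := Cf; exact: fc].
  by split.
split=> // i; have [_ /(_ i)[df cf]] := Cf; split=> [x Ux|].
  by apply: derivableV; [exact: f0 | exact: df].
have CV := IH (CkS Cf).
apply: (Ck_eq oU _ (CkM oU (CkM oU (Ck_cst k (-1) oU) (CkM oU CV CV)) cf)) => x Ux.
rewrite deriveV; [|exact: f0|exact: df].
by rewrite !fctE /= mulN1r -expr2 exprVn.
Qed.

End CkTheory.

(** * Smooth cutoff functions *)

Section Cutoff.
Variable R : realType.

Fixpoint Ck1 (k : nat) (h : R -> R) : Prop :=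
  (forall t, {for t, continuous h}) /\
  (if k is k'.+1 then
     exists2 h', (forall t : R, is_derive t 1 h (h' t)) & Ck1 k' h' else True).

Lemma Ck_comp1 n (U : set 'rV[R]_n) k (h : R -> R) f : open U ->
  Ck1 k h -> Ck U k f -> Ck U k (h \o f).
Proof.
move=> oU; elim: k h => [|k IH] h [ch dh] Cf.
all: have cont x : U x -> {for x, continuous (h \o f)}
  by move=> Ux; apply: continuous_comp; [have [cf _] := Cf; exact: cf | exact: ch].
  by split.
split=> // i; have [h' dh' ch'] := dh; have [_ /(_ i)[df Cdf]] := Cf.
have dhf x : U x -> is_derive x (unit_vec R i) (h \o f)
    (h' (f x) * 'D_(unit_vec R i) f x).
  move=> Ux; apply/is_derive_lineE; apply: is_derive1_comp.
    by rewrite scale0r add0r; exact: dh'.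
  by apply/is_derive_lineE; apply: derivableP; exact: df.
split=> [x /dhf[]//|].
apply: (Ck_eq oU _ (CkM oU (IH h' ch' (CkS Cf)) Cdf)) => x /dhf[_ ->].
by [].
Qed.

(* p (1 / t) exp (- 1 / t): a family that is stable under differentiation *)
Definition flat (p : {poly R}) (t : R) : R :=
  if 0 < t then p.[t^-1] * expR (- t^-1) else 0.

Lemma flat_le0 p t : t <= 0 -> flat p t = 0.
Proof. by move=> t0; rewrite /flat ltNge t0. Qed.

(** With u = 1 / t, the term u^(k+1) / (k+1)! of the exponential series bounds exp u from below;
    this is where the factorial comes from. *)
Lemma flatXn_le k t : 0 < t -> `|flat 'X^k t| <= k.+1`!%:R * t.
Proof.
move=> t0; have u0 : 0 <= t^-1 by rewrite invr_ge0 ltW.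
rewrite /flat t0 hornerXn ger0_norm; last by rewrite mulr_ge0 ?exprn_ge0 ?expR_ge0.
rewrite expRN ler_pdivrMr ?expR_gt0 //.
apply: (@le_trans _ _ (k.+1`!%:R * t * (t^-1 ^+ k.+1 / k.+1`!%:R))).
  have f0 : k.+1`!%:R != 0 :> R by rewrite pnatr_eq0 -lt0n fact_gt0.
  rewrite exprS.
  have -> : k.+1`!%:R * t * (t^-1 * t^-1 ^+ k / k.+1`!%:R) =
     (k.+1`!%:R / k.+1`!%:R) * (t / t) * t^-1 ^+ k :> R by ring.
  by rewrite !divff ?lt0r_neq0 // !mul1r.
rewrite ler_pM2l; last by rewrite mulr_gt0 // ltr0n fact_gt0.
by apply: le_trans (expR_ge1Dxn k u0); rewrite lerDr.
Qed.

Lemma flat_continuous0 p : {for 0, continuous (flat p)}.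
Proof.
rewrite -(coefK p) poly_def.
have -> : flat (\sum_(i < size p) p`_i *: 'X^i) =
    \sum_(i < size p) (fun t => p`_i * flat 'X^i t).
  apply/funext => t; rewrite fct_sumE /flat; case: ifP => t0; last first.
    by rewrite big1 // => i _; rewrite mulr0.
  rewrite horner_sum mulr_suml; apply: eq_bigr => i _.
  by rewrite hornerZ mulrA.
apply: (big_ind (fun h : R -> R => {for 0, continuous h})).
- exact: cst_continuous.
- by move=> h1 h2; exact: continuousD.
move=> i _; apply: continuousM; first exact: cst_continuous.
apply/continuous_atP => e e0; set c : R := i.+1`!%:R.
have c0 : 0 < c by rewrite ltr0n fact_gt0.
have d0 : 0 < e / c by rewrite divr_gt0.
apply: filterS (nbhsx_ballx (0 : R) _ d0) => t; rewrite /ball /= sub0r normrN => td.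
rewrite {1}/flat ltxx sub0r normrN; have [t0|t0] := ltP 0 t; last first.
  by rewrite flat_le0 // normr0.
apply: le_lt_trans (flatXn_le _ t0) _; rewrite -/c mulrC -ltr_pdivlMr //.
by rewrite -(gtr0_norm t0).
Qed.

(** The factor 'X^2 and the sign of the derivative of p come from (1 / t)' = - (1 / t)^2. *)
Lemma is_derive_flat p (t : R) :
  is_derive t 1 (flat p) (flat ('X^2 * (p - p^`())) t).
Proof.
have [t0|t0|t0] := ltgtP t 0.
- rewrite [X in is_derive _ _ _ X]flat_le0 ?ltW //.
  apply: near_eq_is_derive (is_derive_cst (0 : R) t (1 : R)).
  near=> s; rewrite flat_le0 //; near: s.
  by apply: filterS (lt_nbhsl t0) => s /ltW.
- have dinv : is_derive t 1 (fun s : R => s^-1) (- t ^- 2).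
    have := @is_deriveV _ id t 1 1 (lt0r_neq0 t0) (is_derive_id _ _).
    by rewrite /GRing.scale /= mulr1.
  have d1 : is_derive t 1 (horner p \o (fun s : R => s^-1)) (p^`().[t^-1] * (- t ^- 2)).
    by apply: is_derive1_comp.
  have d2 : is_derive t 1 (expR \o (fun s : R => - s^-1)) (expR (- t^-1) * (- - t ^- 2)).
    by apply: is_derive1_comp; exact: is_deriveN.
  have d12 : is_derive t 1 ((horner p \o (fun s : R => s^-1)) *
      (expR \o (fun s : R => - s^-1))) (flat ('X^2 * (p - p^`())) t).
    apply: is_derive_eq (is_deriveM d1 d2) _.
    rewrite /flat t0 hornerM hornerXn hornerD hornerN /= /GRing.scale /=.
    by rewrite exprVn; ring.
  apply: near_eq_is_derive d12; near=> s; rewrite /flat ifT //; near: s.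
  exact: lt_nbhsr.
(* Dividing by t multiplies the polynomial by 'X, so the slope at 0 is again a flat function. *)
rewrite t0; apply/is_derive1_caratheodory; exists (flat ('X * p)); split.
- move=> z; rewrite {2}/flat ltxx !subr0 /flat; case: ifP => z0; last by rewrite mul0r.
  rewrite hornerM hornerX; have zz : z^-1 * z = 1 by rewrite mulVf ?lt0r_neq0.
  by rewrite -[LHS]mul1r -zz; ring.
- exact: flat_continuous0.
- by rewrite /flat ltxx.
Unshelve. all: by end_near. Qed.

Lemma Ck1_flat k p : Ck1 k (flat p).
Proof.
have cp q : forall t, {for t, continuous (flat q)}.
  move=> t; apply: differentiable_continuous; apply/derivable1_diffP.
  by have [] := is_derive_flat q t.
elim: k p => [|k IH] p; split=> //.
by exists (flat ('X^2 * (p - p^`()))) => // t; exact: is_derive_flat.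
Qed.

Variable n : nat.

(* each factor is 1 for |y_i - p_i| <= e and 0 for (y_i - p_i)^2 >= 2 e^2 *)
Definition bump (p : 'rV[R]_n) (e : R) (y : 'rV[R]_n) : R :=
  \prod_i (let s := 2 - ((y 0 i - p 0 i) / e) ^+ 2 in
           flat 1 s / (flat 1 s + flat 1 (1 - s))).

Lemma flat1_gt0 t : 0 < t -> 0 < flat 1 t.
Proof. by move=> t0; rewrite /flat t0 hornerC mul1r expR_gt0. Qed.

Lemma flat1_ge0 t : 0 <= flat 1 t.
Proof.
by have [/flat1_gt0/ltW//|/flat_le0->] := ltP 0 t.
Qed.

Lemma bump_denominator t : 0 < flat 1 t + flat 1 (1 - t).
Proof.
have [t0|t0] := ltP 0 t.
  by rewrite ltr_pwDl ?flat1_gt0 ?flat1_ge0.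
by rewrite ltr_wpDl ?flat1_ge0 // flat1_gt0 //; lra.
Qed.

Lemma Ck_bump U k p e : open U -> Ck U k (bump p e).
Proof.
move=> oU.
pose s i (y : 'rV[R]_n) : R := 2 - ((y 0 i - p 0 i) / e) ^+ 2.
have Cs i : Ck U k (s i).
  have C1 : Ck U k (fun y : 'rV[R]_n => (y 0 i - p 0 i) / e).
    apply: (Ck_eq oU _ (CkM oU (CkB oU (Ck_coord k i oU) (Ck_cst k (p 0 i) oU))
      (Ck_cst k e^-1 oU))) => // y _.
  by apply: (Ck_eq oU _ (CkB oU (Ck_cst k 2 oU) (CkM oU C1 C1))) => // y _.
have C1s i : Ck U k (fun y => 1 - s i y).
  by apply: (Ck_eq oU _ (CkB oU (Ck_cst k 1 oU) (Cs i))) => y _.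
have Cf i := Ck_comp1 oU (Ck1_flat k 1) (Cs i).
have C1f i := Ck_comp1 oU (Ck1_flat k 1) (C1s i).
apply: (@Ck_eq _ _ U k (\prod_i (fun y => flat 1 (s i y) /
   (flat 1 (s i y) + flat 1 (1 - s i y))))) => //.
  by move=> y _; rewrite /bump; elim/big_rec2: _ => // i a b _ <-.
apply: Ck_prod => // i.
apply: (Ck_eq oU _ (CkM oU (Cf i) (CkV oU _ (CkD oU (Cf i) (C1f i))))) => // y _.
by rewrite lt0r_neq0 // bump_denominator.
Qed.

Lemma bump_eq1 (p y : 'rV[R]_n) (e : R) : 0 < e -> (forall i, `|p 0 i - y 0 i| <= e) -> bump p e y = 1.
Proof.
move=> e0 py; rewrite /bump big1 // => i _ /=.
set t := (y 0 i - p 0 i) / e.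
have t1 : t ^+ 2 <= 1.
  rewrite -real_normK ?num_real // expr_le1 // /t normrM normfV (gtr0_norm e0).
  by rewrite ler_pdivrMr // mul1r distrC.
rewrite [flat 1 (1 - _)]flat_le0 ?addr0 ?divff //; last by lra.
by rewrite lt0r_neq0 // flat1_gt0 //; lra.
Qed.

(** A factor vanishes already from distance sqrt 2 e on; 2 e is a bound free of square roots. *)
Lemma bump_neq0 (p y : 'rV[R]_n) (e : R) : 0 < e -> bump p e y != 0 ->
  forall i, `|p 0 i - y 0 i| <= 2 * e.
Proof.
move=> e0 b0 i; rewrite leNgt; apply/negP => ie; move/eqP: b0; apply.
rewrite /bump (bigD1 i) //= flat_le0 ?mul0r //.
rewrite subr_le0 -real_normK ?num_real // normrM normfV (gtr0_norm e0).
have : 2 <= `|y 0 i - p 0 i| / e by rewrite ler_pdivlMr // distrC ltW.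
move=> a2; apply: (@le_trans _ _ (2 * 2)); first by lra.
by rewrite expr2; apply: ler_pM.
Qed.

End Cutoff.

(** * Local frames *)
Lemma open_preimage_on (T T' : topologicalType) (D : set T) (f : T -> T')
    (B : set T') : open D -> (forall x, D x -> {for x, continuous f}) ->
  open B -> open (D `&` f @^-1` B).
Proof.
move=> oD cf oB; rewrite openE => x [Dx Bfx]; apply: filterI.
  exact: open_nbhs_nbhs.
by apply: (cf x Dx); exact: open_nbhs_nbhs.
Qed.

Section Charts.
Variables (R : realType) (n : nat) (M : manifold R n).
Implicit Types (c : chart R n M) (f : M -> R) (F G : Cinf M).

Lemma chart_image c x : cdom c x -> (cmap c @` cdom c) (cmap c x).
Proof. by exists x. Qed.

Lemma chart_invP c z : (cmap c @` cdom c) z ->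
  cdom c (cinv c z) /\ cmap c (cinv c z) = z.
Proof. by move=> [x cx <-]; rewrite cmapK. Qed.

Lemma open_chart_preimage c (A : set M) : open A ->
  open ((cmap c @` cdom c) `&` cinv c @^-1` A).
Proof.
by apply: open_preimage_on (@cimg_open _ _ _ c) _ => x; exact: cinv_continuous.
Qed.

Lemma transition_Ck c c' k j : atlas c -> atlas c' ->
  Ck ((cmap c @` cdom c) `&` cinv c @^-1` cdom c') k
     (fun y => cmap c' (cinv c y) 0 j).
Proof.
move=> ac ac'; apply: Ck_sub (atlas_compatible ac ac' j k) => z [Oz cz].
have [cz' zE] := chart_invP Oz; exists (cinv c z) => //.
Qed.

(** One chart around each point is enough, because the transition maps carry smoothness to every
    other chart. The neighbourhood may depend on the order k. *)
Lemma smooth_chart f :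
  (forall x, exists2 c, atlas c & cdom c x /\ forall k, exists V,
     [/\ open V, V (cmap c x), V `<=` cmap c @` cdom c & Ck V k (f \o cinv c)]) ->
  smooth f.
Proof.
move=> fP c' ac' k; apply: Ck_local => _ [x cx' <-].
have [c ac [cx /(_ k)[V [oV Vx VO CV]]]] := fP x.
pose A := cdom c `&` cmap c @^-1` V.
have oA : open A.
  by apply: open_preimage_on => //; [exact: cdom_open | exact: cmap_continuous].
have oV' := @open_chart_preimage c' A oA.
exists ((cmap c' @` cdom c') `&` cinv c' @^-1` A).
  by split; [exact: chart_image | split; rewrite /preimage /= cmapK].
apply: (@Ck_eq _ _ _ _ ((f \o cinv c) \o (cmap c \o cinv c'))) => //.
  by move=> z [_ [cz _]] /=; rewrite cmapK.
apply: Ck_comp oV' oV _ _ CV; first by move=> z [_ []].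
by move=> j; apply: Ck_sub (transition_Ck _ _ ac' ac) => z [Oz [cz _]].
Qed.

Lemma Cinf_smooth F : smooth F.
Proof. by case: F => f sf; exact: asboolW sf. Qed.

Lemma smooth_near f : (forall x : M, exists F, \forall y \near x, f y = F y) -> smooth f.
Proof.
move=> fP; apply: smooth_chart => x; have [c ac cx] := atlas_cover x.
exists c => //; split=> // k; have [F fF] := fP x.
have [A [oA Ax] AF] : exists2 A, open A /\ A x & forall y, A y -> f y = F y.
  have : nbhs x [set y | f y = F y] := fF.
  by rewrite nbhsE => -[A [oA Ax] AF]; exists A.
exists ((cmap c @` cdom c) `&` cinv c @^-1` A); split.
- exact: open_chart_preimage.
- by split; [exact: chart_image | rewrite /preimage /= cmapK].
- by move=> z [].
apply: (@Ck_eq _ _ _ _ (F \o cinv c)); first exact: open_chart_preimage.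
  by move=> z [_ Az] /=; rewrite AF.
apply: (@Ck_sub _ _ (cmap c @` cdom c)); first by move=> z [].
exact: (Cinf_smooth F ac).
Qed.

Lemma to_CinfE f x : smooth f -> to_Cinf f x = f x.
Proof. by move=> sf; rewrite /to_Cinf [fun_of_Cinf _]insubdK //; apply/asboolP. Qed.

Lemma Cinf_inj F G : (forall x, F x = G x) -> F = G.
Proof. by move=> FG; apply: val_inj; apply/funext. Qed.

Lemma CinfD F G x : fun_of_Cinf (F + G) x = F x + G x.
Proof. by rewrite -[LHS]/((\val (F + G) : M -> R) x) raddfD. Qed.
Lemma CinfN F x : fun_of_Cinf (- F) x = - F x.
Proof. by rewrite -[LHS]/((\val (- F) : M -> R) x) raddfN. Qed.
Lemma CinfM F G x : fun_of_Cinf (F * G) x = F x * G x.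
Proof. by rewrite -[LHS]/((\val (F * G) : M -> R) x) rmorphM. Qed.
Lemma Cinf0 x : fun_of_Cinf (0 : Cinf M) x = 0.
Proof. by rewrite -[LHS]/((\val (0 : Cinf M) : M -> R) x) raddf0. Qed.
Lemma Cinf1 x : fun_of_Cinf (1 : Cinf M) x = 1.
Proof. by rewrite -[LHS]/((\val (1 : Cinf M) : M -> R) x) rmorph1. Qed.

Lemma CkF F c k : atlas c -> Ck (cmap c @` cdom c) k (F \o cinv c).
Proof. by move=> ac; exact: Cinf_smooth. Qed.

Lemma near_chart c x (P : M -> Prop) : cdom c x -> (\forall y \near x, P y) ->
  \forall z \near cmap c x, P (cinv c z).
Proof.
move=> cx Px; have cc := cinv_continuous (chart_image cx).
by apply: cc; rewrite cmapK.
Qed.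

(** Locality of tangent vectors, on which the whole passage to restrictions rests. *)
Lemma tangent_near x v F G : tangent x v -> (\forall y \near x, F y = G y) ->
  v F = v G.
Proof.
move=> [c [ac cx [u vE]]] FG; rewrite !vE; apply: near_eq_derive.
exact: (near_chart (P := fun y => F y = G y)).
Qed.

Lemma derivable_chart F c x u : atlas c -> cdom c x ->
  derivable (F \o cinv c) (cmap c x) u.
Proof.
move=> ac cx; have [] // := is_derive_C1 u (@cimg_open _ _ _ c) (chart_image cx) (CkF F 1 ac).
Qed.

Lemma tangentD x v F G : tangent x v -> v (F + G) = v F + v G.
Proof.
move=> [c [ac cx [u vE]]]; rewrite !vE -deriveD; try exact: derivable_chart.
by congr ('D_u _ _); apply/funext => z /=; rewrite CinfD.
Qed.

Lemma tangentM x v F G : tangent x v -> v (F * G) = v F * G x + F x * v G.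
Proof.
move=> [c [ac cx [u vE]]]; rewrite !vE.
have -> : fun_of_Cinf (F * G) \o cinv c = (F \o cinv c) * (G \o cinv c).
  by apply/funext => z; exact: CinfM.
rewrite deriveM; try exact: derivable_chart.
by rewrite /= cmapK // /GRing.scale /= addrC [G x * _]mulrC.
Qed.

End Charts.

(** * Global functions and fields that extend coordinates and partial derivatives *)

Section LocalExtension.
Variables (R : realType) (n : nat) (M : manifold R n).
Variables (c : chart R n M) (x0 : M) (e : R).
Hypotheses (ac : atlas c) (cx0 : cdom c x0) (e0 : 0 < e).
Hypothesis box : forall y : 'rV[R]_n, (forall i, `|cmap c x0 0 i - y 0 i| <= 2 * e) ->
  (cmap c @` cdom c) y.

Notation b := (bump (cmap c x0) e).
Notation O := (cmap c @` cdom c).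

Definition extend (h : 'rV[R]_n -> R) (y : M) : R :=
  if `[< cdom c y >] then b (cmap c y) * h (cmap c y) else 0.

(** A compact set of a Hausdorff space. Its complement is the open set on which a cut off function
    is 0, which makes the extension by 0 smooth outside the chart. *)
Lemma bump_support_closed : closed
  (cinv c @` [set y : 'rV[R]_n | forall i, y 0 i \in `[cmap c x0 0 i - 2 * e, cmap c x0 0 i + 2 * e]%R]).
Proof.
apply: compact_closed; first exact: points_hausdorff.
apply: continuous_compact.
  apply: continuous_in_subspaceT => y /set_mem yb; apply: cinv_continuous.
  by apply: box => i; have := yb i; rewrite in_itv /= ler_distlC.
apply: (@rV_compact R n (fun i =>
  [set t | t \in `[cmap c x0 0 i - 2 * e, cmap c x0 0 i + 2 * e]%R])) => i.
exact: segment_compact.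
Qed.

Lemma extend_neq0 h y : extend h y != 0 ->
  cdom c y /\ forall i, `|cmap c x0 0 i - cmap c y 0 i| <= 2 * e.
Proof.
rewrite /extend; case: asboolP => [cy|]; last by rewrite eqxx.
move=> h0; split=> //; apply: (bump_neq0 e0).
by apply: contraNneq h0 => ->; rewrite mul0r.
Qed.

Lemma extend_smooth h : smooth_on O h -> smooth (extend h).
Proof.
move=> sh; apply: smooth_chart => x.
have [cx|ncx] := pselect (cdom c x).
  exists c => //; split=> // k; exists O; split=> //.
  - exact: cimg_open.
  apply: (@Ck_eq _ _ _ _ (b * h)); first exact: cimg_open.
    move=> z /chart_invP[cz zE] /=; rewrite /extend; case: asboolP => // _.
    by rewrite zE.
  by apply: CkM; [exact: cimg_open | apply: Ck_bump; exact: cimg_open | exact: sh].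
have [c' ac' cx'] := atlas_cover x; exists c' => //; split=> // k.
have := bump_support_closed; set S := cinv c @` _ => cS.
have oS : open (~` S) by exact: closed_openC.
exists ((cmap c' @` cdom c') `&` cinv c' @^-1` (~` S)); split.
- exact: open_chart_preimage.
- split; first exact: chart_image.
  rewrite /preimage /= cmapK // => -[y yb xE]; apply: ncx; rewrite -xE.
  have /chart_invP[] // : O y.
  by apply: box => i; have := yb i; rewrite in_itv /= ler_distlC.
- by move=> z [].
apply: (@Ck_eq _ _ _ _ (cst 0)); first exact: open_chart_preimage.
  move=> z [_ nS] /=; apply/esym/eqP; apply: contrapT => /negP.
  move=> /extend_neq0[cz zb]; apply: nS; exists (cmap c (cinv c' z)).
    by move=> i; have := zb i; rewrite in_itv /= ler_distlC.
  by rewrite cmapK.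
by apply: Ck_cst; exact: open_chart_preimage.
Qed.

(** An open set on which the cutoff is 1. *)
Definition core : set M :=
  cdom c `&` cmap c @^-1` [set y : 'rV[R]_n | forall i, `|cmap c x0 0 i - y 0 i| < e].

Lemma core_open : open core.
Proof.
apply: open_preimage_on => //; [exact: cdom_open | exact: cmap_continuous |].
have -> : [set y : 'rV[R]_n | forall i, `|cmap c x0 0 i - y 0 i| < e] =
    ball (cmap c x0) e.
  by apply/seteqP; split=> y /(ball_rV _ _ e0).
exact: ball_open.
Qed.

Lemma core_x0 : core x0.
Proof. by split=> // i; rewrite subrr normr0. Qed.

Lemma extend_core h y : core y -> extend h y = h (cmap c y).
Proof.
move=> [cy yb]; rewrite /extend; case: asboolP => // _.
by rewrite bump_eq1 ?mul1r // => i; apply: ltW; exact: yb.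
Qed.

Lemma extend_core_near h y : core y ->
  \forall z \near cmap c y, extend h (cinv c z) = h z.
Proof.
move=> Cy; have [cy _] := Cy.
have oV := @open_chart_preimage _ _ _ c _ core_open.
have Vy : ((cmap c @` cdom c) `&` cinv c @^-1` core) (cmap c y).
  by split; [exact: chart_image | rewrite /preimage /= cmapK].
apply: filterS (open_nbhs_nbhs (conj oV Vy)) => z [/chart_invP[cz zE] Cz].
by rewrite extend_core // zE.
Qed.

Definition loc_coord (j : 'I_n) : Cinf M := to_Cinf (extend (fun y => y 0 j)).

Definition loc_frame (i : 'I_n) (F : Cinf M) : Cinf M :=
  to_Cinf (extend ('D_(unit_vec R i) (F \o cinv c))).

Lemma loc_coordE j y : loc_coord j y = extend (fun y => y 0 j) y.
Proof.
by rewrite to_CinfE //; apply: extend_smooth => k; apply: Ck_coord; exact: cimg_open.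
Qed.

Lemma loc_frameE i F y :
  loc_frame i F y = extend ('D_(unit_vec R i) (F \o cinv c)) y.
Proof.
rewrite to_CinfE //; apply: extend_smooth => k.
by have [_ /(_ i)[]] := CkF F k.+1 ac.
Qed.

Lemma loc_frame_core i F y : core y ->
  loc_frame i F y = 'D_(unit_vec R i) (F \o cinv c) (cmap c y).
Proof. by move=> Cy; rewrite loc_frameE extend_core. Qed.

Lemma loc_frame_coord y i j : core y -> loc_frame i (loc_coord j) y = (i == j)%:R.
Proof.
move=> Cy; rewrite loc_frame_core //.
rewrite (near_eq_derive _ (g := fun z : 'rV[R]_n => z 0 j)).
  have [_ ->] := is_derive_coord (cmap c y) (unit_vec R i) j.
  by rewrite mxE eqxx /= eq_sym.
have := extend_core_near (fun z => z 0 j) Cy; apply: filterS => z <-.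
by rewrite /= loc_coordE.
Qed.

Lemma loc_frame_comm y i j F : core y ->
  loc_frame i (loc_frame j F) y = loc_frame j (loc_frame i F) y.
Proof.
have step k l : core y -> loc_frame k (loc_frame l F) y =
   'D_(unit_vec R k) ('D_(unit_vec R l) (F \o cinv c)) (cmap c y).
  move=> Cy; rewrite loc_frame_core //; apply: near_eq_derive.
  have := extend_core_near ('D_(unit_vec R l) (F \o cinv c)) Cy.
  by apply: filterS => z <-; rewrite /= loc_frameE.
move=> Cy; have [cy _] := Cy.
have sch := @schwarz R n (F \o cinv c) _ (cmap c y) i j (@cimg_open _ _ _ c)
  (chart_image cy) (CkF F 2 ac).
exact: etrans (step i j Cy) (etrans sch (esym (step j i Cy))).
Qed.

Lemma loc_frame_vector_field i : vector_field (loc_frame i).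
Proof.
move=> y; have [cy|ncy] := pselect (cdom c y).
  exists c; split=> //; exists (b (cmap c y) *: unit_vec R i) => F.
  rewrite (derive_C1 _ (@cimg_open _ _ _ c) (chart_image cy) (CkF F 1 ac)).
  rewrite (bigD1 i) //= big1 => [|j ji].
    rewrite addr0 !mxE !eqxx mulr1 /vf_at loc_frameE /extend.
    by case: asboolP.
  by rewrite !mxE eqxx (negPf ji) mulr0 mul0r.
have [c' ac' cy'] := atlas_cover y; exists c'; split=> //; exists 0 => F.
by rewrite derive0 /vf_at loc_frameE /extend; case: asboolP.
Qed.

Lemma loc_frame_tangent y (a : 'I_n -> R) : core y ->
  tangent y (fun F => \sum_i a i * loc_frame i F y).
Proof.
move=> Cy; have [cy _] := Cy; exists c; split=> //; exists (\row_i a i) => F.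
rewrite (derive_C1 _ (@cimg_open _ _ _ c) (chart_image cy) (CkF F 1 ac)).
by apply: eq_bigr => i _; rewrite mxE loc_frame_core.
Qed.

(** The vector is given in some chart c', and the chain rule for the transition map expresses it in
    [c]. The coefficients are then found by applying it to the coordinates. *)
Lemma tangent_loc_frame y v F : core y -> tangent y v ->
  v F = \sum_i v (loc_coord i) * loc_frame i F y.
Proof.
move=> Cy [c' [ac' cy' [u vE]]]; have [cy _] := Cy.
pose a j := 'D_u (fun z => cmap c (cinv c' z) 0 j) (cmap c' y).
have oW := @open_chart_preimage _ _ _ c' _ (@cdom_open _ _ _ c).
have Wy : ((cmap c' @` cdom c') `&` cinv c' @^-1` cdom c) (cmap c' y).
  by split; [exact: chart_image | rewrite /preimage /= cmapK].
have vF G : v G = \sum_j a j * loc_frame j G y.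
  rewrite vE (near_eq_derive _ (g := (G \o cinv c) \o (cmap c \o cinv c'))); last first.
    apply: filterS (open_nbhs_nbhs (conj oW Wy)) => z [_ cz] /=.
    by rewrite cmapK.
  have Oy : (cmap c @` cdom c) ((cmap c \o cinv c') (cmap c' y)).
    by rewrite /= cmapK //; exact: chart_image.
  have [|_ ->] := @is_derive_compose _ _ _ (G \o cinv c) (cmap c \o cinv c') (cmap c' y) u
    (@cimg_open _ _ _ c) Oy (CkF G 1 ac).
    move=> j; have [] // := is_derive_C1 u oW Wy (transition_Ck 1 j ac' ac).
  by apply: eq_bigr => j _; rewrite loc_frame_core //= [cinv c' _]cmapK.
rewrite vF; apply: eq_bigr => i _; congr (_ * _).
rewrite vF (bigD1 i) //= big1 => [|j ji].
  by rewrite addr0 loc_frame_coord // eqxx mulr1.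
by rewrite loc_frame_coord // (negPf ji) mulr0.
Qed.

End LocalExtension.

Section Frames.
Variables (R : realType) (n : nat) (M : manifold R n).

(** The fields and the coordinates are defined on all of M, as the global definitions require, but
    behave like partial derivatives and coordinates on [U] only. *)
Record frame (U : set M) (E : 'I_n -> Cinf M -> Cinf M) (x : 'I_n -> Cinf M)
    : Prop := Frame {
  frame_open : open U;
  frame_vf : forall i, vector_field (E i);
  frame_coord : forall y i j, U y -> E i (x j) y = (i == j)%:R;
  frame_comm : forall y i j F, U y -> E i (E j F) y = E j (E i F) y;
  frame_tangent : forall y (a : 'I_n -> R), U y ->
    tangent y (fun F => \sum_i a i * E i F y);
  tangent_frame : forall y v F, U y -> tangent y v ->
    v F = \sum_i v (x i) * E i F y }.

Lemma frame_sub (U V : set M) E x : open V -> V `<=` U -> frame U E x -> frame V E x.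
Proof. by move=> oV VU [oU E1 E2 E3 E4 E5]; split=> // *; auto. Qed.

Lemma small_box (x0 : M) (N : set M) : open N -> N x0 ->
  exists c e, [/\ atlas c, cdom c x0, 0 < e &
   forall y : 'rV[R]_n, (forall i, `|cmap c x0 0 i - y 0 i| <= 2 * e) ->
     (cmap c @` cdom c) y /\ N (cinv c y)].
Proof.
move=> oN Nx; have [c ac cx] := atlas_cover x0.
have oV := @open_chart_preimage _ _ _ c N oN.
have Vx : ((cmap c @` cdom c) `&` cinv c @^-1` N) (cmap c x0).
  by split; [exact: chart_image | rewrite /preimage /= cmapK].
have [e e0 eV] := nbhs_rV (open_nbhs_nbhs (conj oV Vx)).
(* Doubling e / 4 stays strictly below e. *)
exists c, (e / 4); split=> //; first by rewrite divr_gt0.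
move=> y yb; have [] // : ((cmap c @` cdom c) `&` cinv c @^-1` N) y.
by apply: eV => i; apply: le_lt_trans (yb i) _; lra.
Qed.

Lemma exists_frame (x0 : M) : exists U E x, U x0 /\ frame U E x.
Proof.
have [c [e [ac cx e0 box]]] := small_box (@openT M) (I : setT x0).
have box' (y : 'rV[R]_n) : (forall i, `|cmap c x0 0 i - y 0 i| <= 2 * e) ->
  (cmap c @` cdom c) y by move=> /box[].
exists (core c x0 e), (loc_frame c x0 e), (loc_coord c x0 e); split.
  exact: core_x0.
split.
- exact: core_open.
- exact: loc_frame_vector_field.
- by move=> y i j; exact: loc_frame_coord.
- by move=> y i j F; exact: loc_frame_comm.
- by move=> y a; exact: loc_frame_tangent.
- by move=> y v F; exact: tangent_loc_frame.
Qed.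

Lemma exists_bump (x0 : M) (N : set M) : open N -> N x0 -> exists phi : Cinf M,
  (\forall y \near x0, phi y = 1) /\ forall y, phi y != 0 -> N y.
Proof.
move=> oN Nx; have [c [e [ac cx e0 box]]] := small_box oN Nx.
have box' (y : 'rV[R]_n) : (forall i, `|cmap c x0 0 i - y 0 i| <= 2 * e) ->
  (cmap c @` cdom c) y by move=> /box[].
have s1 : smooth (extend c x0 e (cst 1)).
  by apply: extend_smooth => // k; apply: Ck_cst; exact: cimg_open.
exists (to_Cinf (extend c x0 e (cst 1))); split.
  have := open_nbhs_nbhs (conj (core_open c x0 e0) (core_x0 cx e0)).
  by apply: filterS => y Cy; rewrite to_CinfE // extend_core.
move=> y; rewrite to_CinfE // => /(extend_neq0 e0)[cy yb].
by have [_] := box _ yb; rewrite cmapK.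
Qed.

Lemma exists_inverse (x0 : M) (g : Cinf M) : g x0 != 0 ->
  exists h : Cinf M, \forall y \near x0, g y * h y = 1.
Proof.
move=> gx.
have [N [oN Nx] Ng] : exists2 N, open N /\ N x0 & forall y, N y -> g y != 0.
  have [c ac cx] := atlas_cover x0.
  exists (cdom c `&` (fun y => g (cinv c (cmap c y))) @^-1` [set t | t != 0]).
    split; last by split=> //; rewrite /preimage /= cmapK.
    apply: open_preimage_on (@cdom_open _ _ _ c) _ _ => [y cy|].
      apply: (@continuous_comp _ _ _ (cmap c) (g \o cinv c)).
        exact: cmap_continuous.
      have [gc _] := CkF g 0 ac; apply: gc; exact: chart_image.
    exact: open_neq.
  by move=> y [cy]; rewrite /preimage /= cmapK.
have [phi [phi1 phiN]] := exists_bump oN Nx.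
(* The inverse will be g / k: where phi is 1 this is 1 / g, and where g vanishes phi is 0, so that k
   has no zero. *)
pose k : Cinf M := g * g + (1 - phi) * (1 - phi).
have kE y : k y = g y ^+ 2 + (1 - phi y) ^+ 2.
  by rewrite /k !(CinfD, CinfM, CinfN, Cinf1) !expr2.
have k0 y : k y != 0.
  rewrite kE; have [gy|gy] := eqVneq (g y) 0; last first.
    by rewrite gt_eqF // ltr_pwDl ?sqr_ge0 // exprn_even_gt0.
  have -> : phi y = 0.
    by apply/eqP/negPn/negP => /phiN/Ng; rewrite gy eqxx.
  by rewrite gy subr0 expr0n add0r expr1n oner_eq0.
have sk : smooth (fun y => (k y)^-1).
  move=> c ac j; apply: (CkV (@cimg_open _ _ _ c) _ (CkF k j ac)) => z _.
  exact: k0.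
exists (g * to_Cinf (fun y => (k y)^-1)).
have nN := open_nbhs_nbhs (conj oN Nx); apply: filterS2 nN phi1 => y /Ng gy phiy.
rewrite CinfM to_CinfE // kE phiy subrr expr0n addr0 mulrA -expr2 divff //.
by rewrite expf_neq0.
Qed.

End Frames.

(** * Restriction to an open set *)
(* The ring of the restrictions to [U] of the smooth functions on the whole of
   [M]. *)
Section Restriction.
Variables (R : realType) (n : nat) (M : manifold R n) (U : set M).

Definition restr_pred : {pred ({y : M | U y} -> R)} :=
  fun phi => `[< exists F : Cinf M, forall y, phi y = F (sval y) >].

Lemma restr_subring : subring_closed restr_pred.
Proof.
split=> [|f g /asboolP[F fF] /asboolP[G gG]|f g /asboolP[F fF] /asboolP[G gG]];
  apply/asboolP.
- by exists 1 => y; rewrite Cinf1.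
- by exists (F - G) => y; rewrite CinfD CinfN -fF -gG.
- by exists (F * G) => y; rewrite CinfM -fF -gG.
Qed.

Record restr := MkRestr { fun_of_restr :> {y : M | U y} -> R;
  _ : fun_of_restr \in restr_pred }.

HB.instance Definition _ := [isSub of restr for fun_of_restr].
HB.instance Definition _ := [Choice of restr by <:].
HB.instance Definition _ :=
  GRing.SubChoice_isSubComPzRing.Build ({y : M | U y} -> R) restr_pred restr
    restr_subring.

Lemma restr_inj (a b : restr) : (forall y, a y = b y) -> a = b.
Proof. by move=> ab; apply: val_inj; apply/funext. Qed.

Lemma restrD (a b : restr) y : fun_of_restr (a + b) y = a y + b y.
Proof. by rewrite -[LHS]/((\val (a + b) : _ -> R) y) raddfD. Qed.
Lemma restrN (a : restr) y : fun_of_restr (- a) y = - a y.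
Proof. by rewrite -[LHS]/((\val (- a) : _ -> R) y) raddfN. Qed.
Lemma restrM (a b : restr) y : fun_of_restr (a * b) y = a y * b y.
Proof. by rewrite -[LHS]/((\val (a * b) : _ -> R) y) rmorphM. Qed.
Lemma restr0 y : fun_of_restr 0 y = 0.
Proof. by rewrite -[LHS]/((\val (0 : restr) : _ -> R) y) raddf0. Qed.
Lemma restr1 y : fun_of_restr 1 y = 1.
Proof. by rewrite -[LHS]/((\val (1 : restr) : _ -> R) y) rmorph1. Qed.
Lemma restr_sum (I : Type) (r : seq I) (F : I -> restr) y :
  fun_of_restr (\sum_(i <- r) F i) y = \sum_(i <- r) F i y.
Proof.
elim: r => [|i r IH]; first by rewrite !big_nil restr0.
by rewrite !big_cons restrD IH.
Qed.

Lemma restr_mem (F : Cinf M) : (fun y : {y : M | U y} => F (sval y)) \in restr_pred.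
Proof. by apply/asboolP; exists F. Qed.

Definition res (F : Cinf M) : restr := MkRestr (restr_mem F).

Lemma resE F y : res F y = F (sval y). Proof. by []. Qed.

Lemma lift_ex (a : restr) : exists F : Cinf M, res F = a.
Proof.
case: a => a aP; have /asboolP[F aF] := aP.
by exists F; apply: restr_inj => y; rewrite resE -aF.
Qed.

Definition lift (a : restr) : Cinf M := projT1 (cid (lift_ex a)).

Lemma res_lift a : res (lift a) = a.
Proof. exact: (projT2 (cid (lift_ex a))). Qed.

Lemma liftE a y : lift a (sval y) = a y.
Proof. by rewrite -{2}(res_lift a). Qed.

Lemma map_res_lift s : map res (map lift s) = s.
Proof. by rewrite -map_comp map_id_in // => a _; exact: res_lift. Qed.

Lemma resD F G : res (F + G) = res F + res G.
Proof. by apply: restr_inj => y; rewrite restrD !resE CinfD. Qed.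
Lemma resN F : res (- F) = - res F.
Proof. by apply: restr_inj => y; rewrite restrN !resE CinfN. Qed.
Lemma resM F G : res (F * G) = res F * res G.
Proof. by apply: restr_inj => y; rewrite restrM !resE CinfM. Qed.
Lemma res0 : res 0 = 0.
Proof. by apply: restr_inj => y; rewrite restr0 resE Cinf0. Qed.

Lemma res_sign k F : res ((-1) ^+ k * F) = (-1) ^+ k * res F.
Proof.
elim: k => [|k IH]; first by rewrite !mul1r.
by rewrite !exprS -!mulrA !mulN1r resN IH.
Qed.

Lemma restr_sign k (a : restr) y :
  fun_of_restr ((-1) ^+ k * a) y = (-1) ^+ k * a y.
Proof.
elim: k => [|k IH]; first by rewrite !mul1r.
by rewrite !exprS -!mulrA !mulN1r restrN IH.
Qed.

Lemma restr_torsion_free (a : restr) : a = - a -> a = 0.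
Proof.
move=> aN; apply: restr_inj => y; rewrite restr0.
have ay : a y = - a y by rewrite {1}aN restrN.
by lra.
Qed.

(** A vector field acts on restrictions through an arbitrary lift; for open [U] the result does not
    depend on it, by [vres_res]. *)
Definition vres (X : Cinf M -> Cinf M) : restr -> restr := fun a => res (X (lift a)).

Lemma vres_res X F : open U -> vector_field X -> vres X (res F) = res (X F).
Proof.
move=> oU vX; apply: restr_inj => -[y Uy]; rewrite !resE /=.
apply: (tangent_near (vX y)); apply: filterS (open_nbhs_nbhs (conj oU Uy)) => z Uz.
by have := liftE (res F) (exist _ z Uz).
Qed.

Lemma vres_derivation X : open U -> vector_field X -> derivation (vres X).
Proof.
move=> oU vX; split=> a b.
  rewrite -(res_lift a) -(res_lift b) -resD !vres_res // -resD.
  by congr res; apply: Cinf_inj => y; rewrite CinfD; exact: (tangentD _ _ (vX y)).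
rewrite -(res_lift a) -(res_lift b) -resM !vres_res // -!resM -resD.
congr res; apply: Cinf_inj => y; rewrite CinfD !CinfM.
exact: (tangentM _ _ (vX y)).
Qed.

Definition mvres k (A : mvfield M) : seq restr -> restr := fun s =>
  if size s == k then res (A (map lift s)) else 0.

Definition trunc (k : nat) (w : seq (Cinf M) -> R) : seq (Cinf M) -> R := fun F =>
  if size F == k then w F else 0.

(* the value at [y] of a field [B] on [U] *)
Definition pull (y : {y : M | U y}) (B : seq restr -> restr) : seq (Cinf M) -> R :=
  fun F => B (map res F) y.

Lemma pull_wdg y B C : pull y (wdg B C) = wdg (pull y B) (pull y C).
Proof.
apply/funext => F; rewrite /pull /wdg shs_map.
rewrite (shs_morph (phi := fun a : restr => a y)).
- by apply: shs_eq => V W; rewrite restrM.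
- by move=> a b; rewrite restrD.
- by move=> a; rewrite restrN.
Qed.

Lemma pull_lin1 y X : open U -> vector_field X ->
  pull y (lin1 (vres X)) = lin1 (vf_at (sval y) X).
Proof.
move=> oU vX; apply/funext => -[|F [|G H]]; try exact: restr0.
by rewrite -[LHS]/(fun_of_restr (vres X (res F)) y) vres_res.
Qed.

Lemma pull_wdgs y B Xs : open U -> alls (@vector_field R n M) Xs ->
  pull y (wdgs (map vres Xs) B) = wdgs (map (vf_at (sval y)) Xs) (pull y B).
Proof.
move=> oU; elim: Xs B => //= X Xs IH B [vX vXs].
by rewrite IH // pull_wdg pull_lin1.
Qed.

End Restriction.

Lemma real_torsion_free (R : realType) (a : R) : a = - a -> a = 0.
Proof. by move=> aN; lra. Qed.

(** * Tangent vectors and multivectors at a point of a coordinate domain *)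

Section Fibre.
Variables (R : realType) (n : nat) (M : manifold R n).
Variables (U : set M) (E : 'I_n -> Cinf M -> Cinf M) (x : 'I_n -> Cinf M).
Hypothesis fr : frame U E x.
Variable y : {y : M | U y}.

Notation p := (sval y).

Definition fd (m : 'I_n) (F : Cinf M) : R := E m F p.

Lemma fd_x i j : fd i (x j) = (i == j)%:R.
Proof. by apply: (frame_coord fr); exact: svalP. Qed.

Lemma tangent_der v : tangent p v <-> der fd x v.
Proof.
split=> [tv F|dv].
  rewrite (tangent_frame fr F (svalP y) tv).
  by apply: eq_bigr => m _; rewrite mulrC.
rewrite (_ : v = fun F => \sum_m v (x m) * E m F p).
  exact: (frame_tangent fr _ (svalP y)).
by apply/funext => F; rewrite dv; apply: eq_bigr => m _; rewrite mulrC.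
Qed.

Lemma alls_tangent vs : alls (tangent p) vs <-> alls (der fd x) vs.
Proof.
by elim: vs => //= v vs IH; split=> -[/tangent_der dv /IH].
Qed.

Lemma tangentsP (z : M) k vs :
  tangents z k vs <-> size vs = k /\ alls (tangent z) vs.
Proof.
split=> -[<- tv]; split=> //.
  exact: (nth_alls (t0 := 0)).
by move=> i; exact: (alls_nth 0 tv).
Qed.

Lemma wedge_vectors_dw (vs : seq (Cinf M -> R)) F : size F = size vs ->
  wedge_vectors vs F = dw vs F.
Proof. exact: det_dw. Qed.

Lemma decomposition_dw k w l F : decomposition p k w l -> size F = k ->
  w F = \sum_(t <- l) t.1 * dw t.2 F.
Proof.
move=> [tl wE] Fk; rewrite wE // big_seq [RHS]big_seq; apply: eq_bigr => t /tl[tk _].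
by rewrite wedge_vectors_dw // tk.
Qed.

Lemma decomposition_kvec k (l : seq (R * seq (Cinf M -> R))) :
  (forall t, t \in l -> tangents p k t.2) ->
  kvec fd x k (fun F => \sum_(t <- l) t.1 * dw t.2 F).
Proof.
elim: l => [|t l IH] tl.
  by under eq_fun do rewrite big_nil; exact: kvec0.
under eq_fun do rewrite big_cons; apply: kvecD.
  apply: kvecZ; have /tangentsP[<- tv] := tl t (mem_head _ _).
  by apply: dw_kvec; apply/alls_tangent.
by apply: IH => t' tl'; apply: tl; rewrite inE tl' orbT.
Qed.

Lemma kvector_kvec k w : kvector p k w -> kvec fd x k (trunc k w).
Proof.
move=> [l dl]; have [tl _] := dl; have kl := decomposition_kvec tl.
rewrite (_ : trunc k w = fun F => \sum_(t <- l) t.1 * dw t.2 F) //.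
apply/funext => F; rewrite /trunc; case: eqP => [Fk|/eqP Fk].
  exact: (decomposition_dw dl).
by have [_ hl _] := kl; rewrite hl.
Qed.

(** By induction on k through Euler's identity: w is 1 / k times the sum over m of E_m /\ (insertion
    of x_m in w), and the insertions have smaller degree. *)
Lemma kvec_decomposition k w : kvec fd x k w ->
  exists l : seq (R * seq (Cinf M -> R)),
    (forall t, t \in l -> tangents p k t.2) /\
    forall F, w F = \sum_(t <- l) t.1 * dw t.2 F.
Proof.
elim: k w => [|k IH] w kw.
  exists [:: (w [::], [::])]; split=> [t|F].
    by rewrite inE => /eqP->.
  rewrite big_seq1 /=; case: F => [|f F] /=; first by rewrite mulr1.
  by have [_ -> //] := kw; rewrite mulr0.
have /choice[lm lmP] : forall m, exists l : seq (R * seq (Cinf M -> R)),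
    (forall t, t \in l -> tangents p k t.2) /\
    forall F, ins (x m) w F = \sum_(t <- l) t.1 * dw t.2 F.
  by move=> m; apply: IH; exact: kvec_ins.
exists [seq (t.1 / k.+1%:R, fd m :: t.2) | m <- enum 'I_n, t <- lm m]; split.
  move=> _ /allpairsPdep[m [t [_ tl ->]]] /=.
  have [/(_ t tl)/tangentsP[tk tv] _] := lmP m.
  apply/tangentsP; split; first by rewrite /= tk.
  by split=> //; apply/tangent_der; exact: (der_d fd_x).
move=> F; rewrite big_allpairs_dep /=.
transitivity (k.+1%:R^-1 * \sum_m wdg (lin1 (fd m)) (ins (x m) w) F).
  by rewrite (wdg_ins_count _ kw) mulrA mulVf ?mul1r // pnatr_eq0.
rewrite mulr_sumr big_enum /=; apply: eq_bigr => m _.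
have -> : ins (x m) w = fun F => \sum_(t <- lm m) t.1 * dw t.2 F.
  by apply/funext => G; have [_ ->] := lmP m.
have -> : wdg (lin1 (fd m)) (fun F => \sum_(t <- lm m) t.1 * dw t.2 F) F =
    \sum_(t <- lm m) t.1 * wdg (lin1 (fd m)) (dw t.2) F.
  rewrite [RHS](eq_bigr _ (fun t _ => esym (shsZ _ _ _))) -shs_sum.
  by apply: shs_eq => V W; rewrite mulr_sumr; apply: eq_bigr => t _; rewrite mulrCA.
by rewrite mulr_sumr; apply: eq_bigr => t _; ring.
Qed.

Lemma kvec_decomposition_of k w w' : kvec fd x k w' ->
  (forall F, size F = k -> w F = w' F) -> exists l, decomposition p k w l.
Proof.
move=> /kvec_decomposition[l [tl w'E]] ww'; exists l; split=> // F Fk.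
rewrite ww' // w'E big_seq [RHS]big_seq; apply: eq_bigr => t /tl[tk _].
by rewrite wedge_vectors_dw // tk.
Qed.

Lemma kvec_kvector k w w' : kvec fd x k w' ->
  (forall F, size F = k -> w F = w' F) -> kvector p k w.
Proof. exact: kvec_decomposition_of. Qed.

End Fibre.

(** * Multivector fields and their brackets on a coordinate domain *)

Section RestrictedFrame.
Variables (R : realType) (n : nat) (M : manifold R n).
Variables (U : set M) (E : 'I_n -> Cinf M -> Cinf M) (x : 'I_n -> Cinf M).
Hypothesis fr : frame U E x.

Let oU := frame_open fr.
Notation mvU := (@mvres R n M U).

Definition rE (i : 'I_n) : restr U -> restr U := vres (E i).
Definition rx (i : 'I_n) : restr U := res U (x i).

Lemma rE_derivation i : derivation (rE i).
Proof. exact: vres_derivation oU (frame_vf fr i). Qed.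

Lemma rE_res i F : rE i (res U F) = res U (E i F).
Proof. exact: vres_res oU (frame_vf fr i). Qed.

Lemma rE_comm i j a : rE i (rE j a) = rE j (rE i a).
Proof.
rewrite -(res_lift a) !rE_res; apply: restr_inj => -[y Uy]; rewrite !resE.
exact: (frame_comm fr).
Qed.

Lemma vres_der X : vector_field X -> der rE rx (vres X).
Proof.
move=> vX a; rewrite -(res_lift a) vres_res //.
apply: restr_inj => y; rewrite resE restr_sum.
rewrite -[X _ _]/(vf_at (sval y) X (lift a)).
have /(tangent_der fr)-> := vX (sval y); apply: eq_bigr => m _.
by rewrite restrM rE_res vres_res.
Qed.

Lemma pull_kvec k B y : kvec rE rx k B -> kvec (fd E y) x k (pull y B).
Proof.
move=> [aB hB tB]; split.
- by move=> s f g t; rewrite /pull !map_cat /= aB restrN.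
- by move=> F Fk; rewrite /pull hB ?size_map // restr0.
move=> f F; rewrite /pull /= tB restr_sum; apply: eq_bigr => m _.
by rewrite restrM rE_res.
Qed.

(** [mvres] evaluates [A] on chosen lifts; at a point of [U] these have the same differentials as
    the entries of F. *)
Lemma mvres_res k A F : multivector k A ->
  mvU k A (map (res U) F) = if size F == k then res U (A F) else 0.
Proof.
move=> mA; rewrite /mvres size_map; case: eqP => // Fk.
apply: restr_inj => y; rewrite !resE -map_comp.
have kA := kvector_kvec fr (mA (sval y)).
have := @kvec_map _ _ _ (fd E y) x _ _ (@lift _ _ _ U \o res U) F kA.
rewrite /trunc size_map Fk eqxx; apply=> f m.
have : rE m (res U (lift (res U f))) = rE m (res U f) by rewrite res_lift.
by rewrite !rE_res => /(congr1 (fun a : restr U => a y)); rewrite !resE.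
Qed.

Lemma pull_mvres k A y : multivector k A ->
  pull y (mvU k A) = trunc k (mv_at A (sval y)).
Proof.
move=> mA; apply/funext => F; rewrite /pull mvres_res // /trunc.
by case: eqP => // _; rewrite restr0.
Qed.

Lemma mvres_kvec k A : multivector k A -> kvec rE rx k (mvU k A).
Proof.
move=> mA.
have at_y y F : mvU k A (map (res U) F) y = trunc k (mv_at A (sval y)) F.
  by rewrite -(pull_mvres y mA).
split=> [s f g t|F Fk|f F].
- rewrite -(map_res_lift s) -(map_res_lift t) -(res_lift f) -(res_lift g).
  rewrite -!map_cons -!map_cat; apply: restr_inj => y; rewrite restrN !at_y.
  by rewrite !map_cat /=; have [-> _ _] := kvector_kvec fr (mA (sval y)).
- by rewrite /mvres ifN.
- rewrite -(map_res_lift F) -(res_lift f) -map_cons; apply: restr_inj => y.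
  rewrite restr_sum at_y; have [_ _ ->] := kvector_kvec fr (mA (sval y)).
  apply: eq_bigr => m _; rewrite restrM rE_res.
  by rewrite -[rx m :: _]/(map (res U) (x m :: map (@lift _ _ _ U) F)) at_y.
Qed.

Definition bra (e : nat) (A B : seq (restr U) -> restr U) s : restr U :=
  br A B s - (-1) ^+ e * br B A s.

Lemma res_shuffle_sum a b A B F : multivector a.+1 A -> multivector b B ->
  res U (\sum_(s : 'S_(size F) | shuffle b a s)
    (-1) ^+ s * A (B (take b (permute s)) :: drop b (permute s))) =
  br (mvU a.+1 A) (mvU b B) (map (res U) F).
Proof.
move=> mA mB.
rewrite (shuffle_shs b a (fun V W => A (B V :: W)) F).
rewrite (shs_morph (phi := res U)) => [|f g|f]; rewrite ?resD ?resN //.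
rewrite /br shs_map; apply: shs_eq => V W.
rewrite mvres_res //; case: eqP => [Vb|_] /=; last first.
  by rewrite res0 (kvec_0 rE_derivation _ (mvres_kvec mA)).
rewrite -[res U (B V) :: _]/(map (res U) (B V :: W)) mvres_res //= eqSS.
by case: eqP => // _; rewrite res0.
Qed.

Lemma res_schouten a b A B F : multivector a A -> multivector b B ->
  res U (schouten a b A B F) =
  bra (a.+1 * b.+1) (mvU a A) (mvU b B) (map (res U) F).
Proof.
move=> mA mB; rewrite /schouten resD resN res_sign /bra.
have half c d C D : multivector c C -> multivector d D ->
    res U (if c is c'.+1 then \sum_(s : 'S_(size F) | shuffle d c' s)
      (-1) ^+ s * C (D (take d (permute s)) :: drop d (permute s)) else 0) =
    br (mvU c C) (mvU d D) (map (res U) F).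
  case: c => [|c] mC mD; last exact: res_shuffle_sum.
  by rewrite res0 -[LHS](shs0 _ (map (res U) F)).
congr (_ - _ * _); [exact: half | exact: half].
Qed.

End RestrictedFrame.

Lemma set_nth_cat (T : Type) (x0 : T) s v t u :
  set_nth x0 (s ++ v :: t) (size s) u = s ++ u :: t.
Proof. by elim: s => //= a s ->. Qed.

Lemma alls_cat (T : Type) (P : T -> Prop) s t :
  alls P (s ++ t) <-> alls P s /\ alls P t.
Proof. by elim: s => [|a s IH] /=; [|rewrite IH]; tauto. Qed.

Lemma dw_swap (K : Type) (L : comPzRingType) (s t : seq (K -> L)) f g F :
  dw (s ++ f :: g :: t) F = - dw (s ++ g :: f :: t) F.
Proof.
elim: s F => [|h s IH] F /=.
  rewrite !wdg_assoc lin1_swap -wdgNl.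
  by [].
by rewrite -wdgNr; congr (wdg _ _ _); apply/funext => G; exact: IH.
Qed.

(** * Alternating forms of top degree on a tangent space *)

Section TopForms.
Variables (R : realType) (n : nat) (M : manifold R n).
Variables (U : set M) (E : 'I_n -> Cinf M -> Cinf M) (x : 'I_n -> Cinf M).
Hypothesis fr : frame U E x.
Variables (y : {y : M | U y}) (alpha : seq (Cinf M -> R) -> R).

Notation p := (sval y).
Hypothesis alternating_alpha : alternating p n alpha.

(** Tangent vectors as a type, so that the coordinate lemmas apply to forms, with the roles of
    functions and vectors exchanged. *)
Notation tang := {v : Cinf M -> R | tangent p v}.
Notation vals := (map (fun v : tang => sval v)).

Lemma alternating_lin s t v w r : tangents p n (s ++ v :: t) -> tangent p w ->
  alpha (s ++ (fun F => r * v F + w F) :: t) = r * alpha (s ++ v :: t) + alpha (s ++ w :: t).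
Proof.
move=> tv tw; have [lin _] := alternating_alpha.
have sn : (size s < n)%N.
  by have [sn _] := tv; have := sn; rewrite size_cat /=; lia.
have v_t : tangent p v.
  have /tangentsP[_ /alls_cat[_ []]] // := tv.
by have := lin _ (size s) v w r tv sn v_t tw; rewrite !set_nth_cat.
Qed.

Lemma alternating_eq0 s t v : tangents p n (s ++ v :: v :: t) ->
  alpha (s ++ v :: v :: t) = 0.
Proof.
move=> tv; have [_ eq0] := alternating_alpha.
apply: (eq0 _ (size s) (size s).+1 tv); last first.
  by rewrite !nth_cat ltnn subnn ltnNge leqnSn /= subSn // subnn.
by have [sn _] := tv; have := sn; rewrite size_cat /=; lia.
Qed.

Lemma tangent_combination (r : seq 'I_n) (a : 'I_n -> R) :
  tangent p (fun F => \sum_(m <- r) a m * E m F p).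
Proof.
apply/(tangent_der fr) => F; elim: r => [|m r IH].
  by rewrite big_nil big1 // => m _; rewrite big_nil mulr0.
rewrite big_cons IH; under [RHS]eq_bigr do rewrite big_cons mulrDr.
rewrite big_split /=; congr (_ + _).
under eq_bigr do rewrite mulrCA; rewrite -mulr_sumr; congr (_ * _).
exact: (der_d (fd_x fr y)).
Qed.

Definition E_tang (m : 'I_n) : tang := exist _ _ (frame_vf fr m p).

Lemma tangent_add v w r : tangent p v -> tangent p w ->
  tangent p (fun F => r * v F + w F).
Proof.
move=> /(tangent_der fr) dv /(tangent_der fr) dw; apply/(tangent_der fr) => F.
rewrite dv dw mulr_sumr -big_split; apply: eq_bigr => m _ /=; ring.
Qed.

Definition top_form (vs : seq tang) : R := if size vs == n then alpha (vals vs) else 0.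
Definition top_det (vs : seq tang) : R :=
  if size vs == n then dw (vals vs) (map x (enum 'I_n)) else 0.
Definition tang_coord (m : 'I_n) (v : tang) : R := sval v (x m).

Lemma top_form_kvec : kvec tang_coord E_tang n top_form.
Proof.
split=> [s f g t|F /negPf Fn|v vs].
- rewrite /top_form !size_cat /=; case: eqP => [sn|_]; last by rewrite oppr0.
  rewrite !map_cat /=.
  have tP (u w : Cinf M -> R) : tangent p u -> tangent p w ->
      tangents p n (vals s ++ u :: w :: vals t).
    move=> tu tw; apply/tangentsP; split; first by rewrite size_cat /= !size_map.
    apply/alls_cat; split; last split=> //; last split=> //.
      by elim: (s) => //= a b IH; split=> //; exact: svalP.
    by elim: (t) => //= a b IH; split=> //; exact: svalP.
  have tf := svalP f; have tg := svalP g.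
  (* Polarization: alpha vanishes on (H, H) for H = F + G. The factor 1 gives H the shape in which
     linearity is stated. *)
  set F := sval f; set G := sval g; set H := fun h => 1 * F h + G h.
  have tH : tangent p H by exact: tangent_add.
  have e : alpha (vals s ++ H :: H :: vals t) = 1 * alpha (vals s ++ F :: H :: vals t) +
      alpha (vals s ++ G :: H :: vals t) := alternating_lin 1 (tP F H tf tH) tg.
  have l u : tangent p u -> alpha (vals s ++ u :: H :: vals t) =
      1 * alpha (vals s ++ u :: F :: vals t) + alpha (vals s ++ u :: G :: vals t).
    move=> tu; have tuF : tangents p n (rcons (vals s) u ++ F :: vals t).
      by rewrite cat_rcons; exact: tP.
    by have := alternating_lin 1 tuF tg; rewrite !cat_rcons.
  have := alternating_eq0 (tP H H tH tH); rewrite e.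
  rewrite !l // (alternating_eq0 (tP F F tf tf)) (alternating_eq0 (tP G G tg tg)).
  rewrite !mul1r add0r addr0 => /eqP; rewrite addr_eq0 => /eqP.
  exact.
- by rewrite /top_form Fn.
rewrite /top_form /=; case: eqP => [vn|_]; last by rewrite big1 // => m _; rewrite mulr0.
have tvs : alls (tangent p) (vals vs).
  by elim: (vs) => //= a b IH; split=> //; exact: svalP.
have tP u : tangent p u -> tangents p n (u :: vals vs).
  by move=> tu; apply/tangentsP; split=> //=; rewrite size_map.
have alpha0 : alpha ((fun=> 0) :: vals vs) = 0.
  have tv := svalP v; have := @alternating_lin [::] (vals vs) (sval v) (sval v) (-1) (tP _ tv) tv.
  rewrite /= mulN1r addNr (_ : (fun F => -1 * sval v F + sval v F) = fun=> 0) //.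
  by apply/funext => F; rewrite mulN1r addNr.
have -> : sval v = fun F => \sum_(m <- index_enum 'I_n) sval v (x m) * E m F p.
  by apply/funext => F; rewrite (tangent_frame fr F (svalP y) (svalP v)).
elim: (index_enum 'I_n) => [|m r IH].
  by rewrite big_nil -alpha0; congr (alpha (_ :: _)); apply/funext => F; rewrite big_nil.
rewrite big_cons -IH.
have := @alternating_lin [::] (vals vs) (fd E y m) _ (sval v (x m)) (tP _ _)
  (tangent_combination r (fun m => sval v (x m))).
move=> /= <-; last exact: frame_vf fr m p.
congr (alpha (_ :: _)); apply/funext => F; by rewrite big_cons.
Qed.

Lemma top_det_kvec : kvec tang_coord E_tang n top_det.
Proof.
split=> [s f g t|F /negPf Fn|v vs].
- rewrite /top_det !size_cat /=; case: eqP => [_|_]; last by rewrite oppr0.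
  by rewrite !map_cat /= dw_swap.
- by rewrite /top_det Fn.
rewrite /top_det /=; case: eqP => [vn|_]; last by rewrite big1 // => m _; rewrite mulr0.
rewrite /wdg.
transitivity (shs (fun V W => \sum_m tang_coord m v *
   (lin1 (fd E y m) V * dw (vals vs) W)) (map x (enum 'I_n))).
  apply: shs_eq => V W; under eq_bigr do rewrite mulrA.
  rewrite -mulr_suml; congr (_ * _); case: V => [|F [|G V]] /=; last 2 first.
  - by rewrite (tangent_frame fr F (svalP y) (svalP v)).
  - by rewrite big1 // => m _; rewrite mulr0.
  by rewrite big1 // => m _; rewrite mulr0.
by rewrite shs_sum; apply: eq_bigr => m _; rewrite shsZ.
Qed.

Lemma dw_frame : dw (map (fd E y) (enum 'I_n)) (map x (enum 'I_n)) = 1.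
Proof.
rewrite -det_dw ?size_map //.
rewrite (_ : \matrix_(_, _) _ = 1%:M) ?det1 //; apply/matrixP => i j; rewrite !mxE.
have ln m (k : 'I_m) : m = n -> (k < n)%N by move=> <-.
have sz : size (Finite.enum 'I_n) = n by rewrite -enumT size_enum_ord.
have il : (i < n)%N := ln _ i sz; have jl : (j < n)%N := ln _ j sz.
rewrite (nth_map (Ordinal il) _ (fd E y)) ?size_enum_ord //.
rewrite (nth_map (Ordinal jl) 0 x) ?size_enum_ord // (fd_x fr) -!val_eqE /=.
by rewrite !nth_enum_ord.
Qed.

(** Both sides are alternating of top degree in the vectors, so they are compared on the frame only,
    where the determinant is 1. *)
Lemma alternating_top vs : tangents p n vs ->
  alpha vs = alpha (map (fd E y) (enum 'I_n)) * dw vs (map x (enum 'I_n)).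
Proof.
move=> tvs; have [vn tv] := tvs.
have [us usE] : exists us : seq tang, vals us = vs.
  have /tangentsP[_ {}tv] := tvs; elim: vs tv {tvs vn} => [|v vs IH] /= tv.
    by exists [::].
  by have [tv1 /IH[us <-]] := tv; exists (exist _ v tv1 :: us).
have un : size us = n by have := vn; rewrite -usE size_map.
set c := alpha (map (fd E y) (enum 'I_n)).
have kd := kvecD top_form_kvec (kvecZ (- c) top_det_kvec).
have E_xs : vals (map E_tang (enum 'I_n)) = map (fd E y) (enum 'I_n).
  by rewrite -map_comp.
have top : n == n ->
    top_form (map E_tang (enum 'I_n)) + - c * top_det (map E_tang (enum 'I_n)) = 0.
  move=> _; rewrite /top_form /top_det size_map size_enum_ord eqxx E_xs.
  by rewrite dw_frame mulr1 subrr.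
have := kvec_top (@real_torsion_free R) kd (leqnn n) top us.
rewrite /top_form /top_det un eqxx usE mulNr => /eqP; rewrite subr_eq0 => /eqP.
exact.
Qed.

End TopForms.

(** * Volume forms *)
Section VolumeForm.
Variables (R : realType) (n : nat) (M : manifold R n) (mu : dform M).
Hypothesis Hmu : volume_form mu.

(* [g] is the density of [mu] in the frame and [h] a global function equal to
   1 / g on [U]. *)
Record volume_frame (U : set M) (E : 'I_n -> Cinf M -> Cinf M)
    (x : 'I_n -> Cinf M) (g h : Cinf M) : Prop := VolumeFrame {
  volume_frame_frame : frame U E x;
  volume_frame_density : forall y, U y ->
    g y = mu y (map (fun i F => E i F y) (enum 'I_n));
  volume_frame_inverse : forall y, U y -> g y * h y = 1 }.

Lemma exists_volume_frame (x0 : M) :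
  exists U E x g h, U x0 /\ volume_frame U E x g h.
Proof.
have [U [E [x [Ux fr]]]] := exists_frame x0.
have [[amu smu] nmu] := Hmu.
have vE : vector_fields n (map E (enum 'I_n)).
  split=> [|i i_n]; first by rewrite size_map size_enum_ord.
  rewrite (nth_map (Ordinal i_n)) ?size_enum_ord //; exact: (frame_vf fr).
pose g := to_Cinf (fun y => mu y [seq vf_at y X | X <- map E (enum 'I_n)]).
have gE y : g y = mu y (map (fun i F => E i F y) (enum 'I_n)).
  by rewrite to_CinfE; [rewrite -map_comp | exact: smu vE].
have gx : g x0 != 0.
  have [vs tvs] := nmu x0; apply: contra_neq => g0.
  rewrite (alternating_top fr (y := exist _ x0 Ux) (amu x0) tvs).
  by rewrite -[map (fd _ _) _]/(map (fun i F => E i F x0) (enum 'I_n)) -gE g0 mul0r.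
have [h gh] := exists_inverse gx.
have : nbhs x0 [set y | g y * h y = 1] := gh.
rewrite nbhsE => -[V [oV Vx] Vgh].
have oU := frame_open fr.
(* The domain shrinks to where [h] inverts the density. *)
exists (U `&` V), E, x, g, h; split; first by [].
split; last by move=> y [_ /Vgh].
  by apply: frame_sub fr => [|y []//]; exact: openI.
by move=> y _; exact: gE.
Qed.

Lemma tangent_comb (z : M) (v w : Cinf M -> R) r : tangent z v -> tangent z w ->
  tangent z (fun F => r * v F + w F).
Proof.
have [U [E [x [Uz fr]]]] := exists_frame z.
exact: (tangent_add fr (y := exist _ z Uz)).
Qed.

Lemma tangent0 (z : M) : tangent z (fun=> 0).
Proof.
have [U [E [x [Uz fr]]]] := exists_frame z.
apply/(tangent_der fr (exist _ z Uz)) => F.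
by rewrite big1 // => m _; rewrite mulr0.
Qed.

Section Flat.
Variables (U : set M) (E : 'I_n -> Cinf M -> Cinf M) (x : 'I_n -> Cinf M).
Variables (g h : Cinf M).
Hypothesis vfr : volume_frame U E x g h.

Let fr := volume_frame_frame vfr.
Let oU := frame_open fr.
Notation xs := (map x (enum 'I_n)).
Notation rxs := (map (rx U x) (enum 'I_n)).
Notation mvU := (@mvres R n M U).

(** Since mu is g times the determinant in the frame, every decomposition that the choice may return
    yields the same number. *)
Lemma pairing_top (y : {y | U y}) w w' : kvec (fd E y) x n w' ->
  (forall F, size F = n -> w F = w' F) ->
  pairing n (sval y) (mu (sval y)) w = g (sval y) * w' xs.
Proof.
move=> kw' ww'; have [l0 dl0] := kvec_decomposition_of fr kw' ww'.
rewrite /pairing; set A := [set r | _].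
have : A (get A).
  by apply: getPex; exists (\sum_(t <- l0) t.1 * mu (sval y) t.2); exists l0.
move=> [l dl ->]; have xn : size xs = n by rewrite size_map size_enum_ord.
rewrite -ww' // (decomposition_dw dl) // mulr_sumr.
have [tl _] := dl; rewrite big_seq [RHS]big_seq; apply: eq_bigr => t /tl tt.
have [[amu _] _] := Hmu.
rewrite (alternating_top fr (amu (sval y)) tt) (volume_frame_density vfr (svalP y)).
by rewrite mulrCA.
Qed.

(** The value of i(w) mu for a single k-vector at z rather than a field: curls are found point by
    point before being glued. *)
Definition flat_pt k (w : seq (Cinf M) -> R) (z : M) (vs : seq (Cinf M -> R)) : R :=
  pairing n z (mu z) (wedge k (n - k) w (wedge_vectors vs)).

Lemma wedge_wdg a b (w w' : seq (Cinf M) -> R) F :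
  wedge a b w w' F = wdg (trunc a w) (trunc b w') F.
Proof.
rewrite -[LHS]/(\sum_(s : 'S_(size F) | shuffle a b s)
  (-1) ^+ s * w (take a (permuted F s)) * w' (drop a (permuted F s))).
under eq_bigr do rewrite -mulrA.
rewrite (shuffle_shs a b (fun V W => w V * w' W)).
apply: shs_eq => V W; rewrite /trunc.
by case: eqP => _; case: eqP => _ //=; rewrite ?mul0r ?mulr0.
Qed.

Lemma flat_ptE k w (y : {y | U y}) vs : (k <= n)%N -> kvector (sval y) k w ->
  tangents (sval y) (n - k) vs ->
  flat_pt k w (sval y) vs = g (sval y) * wdgs vs (trunc k w) xs.
Proof.
move=> kn kw tvs; have [vk _] := tvs.
have kw' := kvector_kvec fr kw.
have /tangentsP[_ /(alls_tangent fr) dvs] := tvs.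
have kd := wdgs_kvec kw' dvs; rewrite vk subnKC // in kd.
rewrite /flat_pt (pairing_top kd) // => F Fn; rewrite wedge_wdg -wdg_dw.
congr (wdg _ _ _); apply/funext => G; rewrite /trunc; case: eqP => [Gk|/eqP Gk].
  by rewrite wedge_vectors_dw // vk.
by rewrite dw_hom // vk.
Qed.

Lemma mu_flatE k A (y : {y | U y}) vs : (k <= n)%N -> multivector k A ->
  tangents (sval y) (n - k) vs ->
  mu_flat mu k A (sval y) vs = g (sval y) * wdgs vs (pull y (mvU k A)) xs.
Proof.
move=> kn mA tvs; rewrite (pull_mvres fr y mA) -(flat_ptE kn (mA (sval y)) tvs).
by rewrite /mu_flat /contract kn.
Qed.

Lemma tangents_vf (z : M) k Xs : size Xs = k -> alls (@vector_field R n M) Xs ->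
  tangents z k (map (vf_at z) Xs).
Proof.
move=> Xk vX; apply/tangentsP; split; first by rewrite size_map.
by elim: Xs vX {Xk} => //= X Xs IH [vX /IH].
Qed.

Lemma rxsE : map (res U) xs = rxs.
Proof. by rewrite -map_comp. Qed.

Definition flat_res k A Xs : restr U := res U g * wdgs (map (@vres _ _ _ U) Xs) (mvU k A) rxs.

Lemma flat_resE k A (y : {y | U y}) Xs : (k <= n)%N -> multivector k A ->
  size Xs = (n - k)%N -> alls (@vector_field R n M) Xs ->
  mu_flat mu k A (sval y) (map (vf_at (sval y)) Xs) = flat_res k A Xs y.
Proof.
move=> kn mA Xk vX; rewrite mu_flatE //; last exact: tangents_vf.
by rewrite restrM resE -pull_wdgs // -rxsE.
Qed.

End Flat.

(** Ensures that [to_Cinf] in [koszul] does not fall back on its default value 0. *)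
Lemma flat_smooth k A Xs : (k <= n)%N -> multivector k A ->
  size Xs = (n - k)%N -> alls (@vector_field R n M) Xs ->
  smooth (fun z => mu_flat mu k A z (map (vf_at z) Xs)).
Proof.
move=> kn mA Xk vX; apply: smooth_near => z.
have [U [E [x [g [h [Uz vfr]]]]]] := exists_volume_frame z.
exists (lift (flat_res U x g k A Xs)).
have oU := frame_open (volume_frame_frame vfr).
apply: filterS (open_nbhs_nbhs (conj oU Uz)) => y Uy.
rewrite -[y]/(sval (exist U y Uy)) liftE.
exact: (flat_resE vfr (exist U y Uy)).
Qed.

Section VolumeFrame.
Variables (U : set M) (E : 'I_n -> Cinf M -> Cinf M) (x : 'I_n -> Cinf M).
Variables (g h : Cinf M).
Hypothesis vfr : volume_frame U E x g h.

Let fr := volume_frame_frame vfr.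
Let oU := frame_open fr.
Notation xs := (map x (enum 'I_n)).
Notation rxs := (map (rx U x) (enum 'I_n)).
Notation mvU := (@mvres R n M U).
Notation rD := (D (rE E) (rx U x) (res U g) (res U h)).

Lemma res_gh : res U g * res U h = 1.
Proof.
apply: restr_inj => y; rewrite restrM restr1 !resE.
exact: (volume_frame_inverse vfr (svalP y)).
Qed.

Lemma vres_lie_bracket X Y F : vector_field X -> vector_field Y ->
  comm (vres X) (vres Y) (res U F) = res U (lie_bracket X Y F).
Proof.
by move=> vX vY; rewrite /comm /lie_bracket !vres_res // resD resN.
Qed.

Lemma lie_bracket_tangent X Y (y : {y | U y}) : vector_field X -> vector_field Y ->
  tangent (sval y) (vf_at (sval y) (lie_bracket X Y)).
Proof.
move=> vX vY; apply/(tangent_der fr) => F.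
have dX := vres_der fr vX; have dY := vres_der fr vY.
have := der_comm (rE_derivation fr) (rE_comm fr) dX dY (res U F).
rewrite vres_lie_bracket // => /(congr1 (fun a : restr U => a y)).
rewrite resE restr_sum -[lie_bracket _ _ _ _]/(vf_at _ _ _) => ->.
by apply: eq_bigr => m _; rewrite restrM (rE_res fr) vres_lie_bracket.
Qed.

Lemma alls_omit (T : Type) (P : T -> Prop) i s : alls P s -> alls P (omit i s).
Proof.
move=> Ps; apply/alls_cat; elim: s i Ps => [|a s IH] [|i] //= [Pa Ps].
  by rewrite drop0.
by have [] := IH i Ps.
Qed.

Lemma map_omit (T T' : Type) (f : T -> T') i s : map f (omit i s) = omit i (map f s).
Proof. by rewrite /omit map_cat map_take map_drop. Qed.

(** [eta] is only required to agree with i(A) mu, so that mu itself is covered, as i(1) mu. *)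
Lemma koszul_res (k : nat) (eta : dform M) (y : {y | U y}) A Xs : multivector k A ->
  eq_form (n - k) eta (mu_flat mu k A) -> alls (@vector_field R n M) Xs ->
  (k + size Xs)%N = n.+1 ->
  koszul eta Xs (sval y) =
  kosz (fun Ys => res U g * wdgs Ys (mvU k A) rxs) (map (@vres _ _ _ U) Xs) y.
Proof.
move=> mA etaE vX kX; rewrite /koszul /kosz restrD !restr_sum size_map.
have vXi i : (i < size Xs)%N -> vector_field Xs`_i by move=> iX; exact: alls_nth.
have so i : (i < size Xs)%N -> size (omit i Xs) = (n - k)%N.
  by move=> iX; rewrite size_omit //; lia.
congr (_ + _).
  apply: eq_bigr => i _; have iX := ltn_ord i.
  have kn : (k <= n)%N by lia.
  rewrite (nth_map (0 : Cinf M -> Cinf M)) // -map_omit.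
  have vo := alls_omit i vX.
  have -> : (fun y0 => eta y0 [seq vf_at y0 X | X <- omit i Xs]) =
      (fun y0 => mu_flat mu k A y0 [seq vf_at y0 X | X <- omit i Xs]).
    by apply/funext => z; apply: etaE; apply: tangents_vf => //; exact: so.
  set F := to_Cinf _.
  have -> : res U g * wdgs (map (@vres _ _ _ U) (omit i Xs)) (mvU k A) rxs = res U F.
    apply: restr_inj => z; rewrite resE to_CinfE; last exact: flat_smooth (so _ iX) vo.
    exact: esym (flat_resE vfr z kn mA (so _ iX) vo).
  rewrite (vres_res _ oU) //; last exact: vXi.
  by rewrite restr_sign.
apply: eq_bigr => j _; rewrite restr_sum; apply: eq_bigr => i _.
have jX := ltn_ord j; have iX : (i < size Xs)%N := ltn_trans (ltn_ord i) jX.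
have kn : (k <= n)%N by lia.
have ij := ltn_ord i.
have sij : size (omit i (omit j Xs)) = (n - k).-1.
  by rewrite size_omit so //; lia.
rewrite !(nth_map (0 : Cinf M -> Cinf M)) // -!map_omit.
have voo : alls (@vector_field R n M) (omit i (omit j Xs)).
  by do 2!apply: alls_omit.
have tl : tangents (sval y) (n - k)
  [seq vf_at (sval y) X | X <- lie_bracket Xs`_i Xs`_j :: omit i (omit j Xs)].
  apply/tangentsP; split; first by rewrite /= size_map sij; lia.
  split; first exact: lie_bracket_tangent (vXi _ iX) (vXi _ jX).
  by have /tangentsP[] := tangents_vf (sval y) erefl voo.
rewrite etaE // (mu_flatE vfr kn mA tl).
have -> : wdgs [seq vf_at (sval y) X | X <- lie_bracket Xs`_i Xs`_j :: omit i (omit j Xs)]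
   (pull y (mvU k A)) xs =
   wdgs (comm (vres Xs`_i) (vres Xs`_j) :: map (@vres _ _ _ U) (omit i (omit j Xs)))
     (mvU k A) rxs y.
  rewrite -rxsE -[RHS]/(pull y _ xs) /= pull_wdgs // pull_wdg.
  congr (wdgs _ (wdg _ _) _); apply/funext => -[|F [|G s]]; try exact: esym (restr0 _).
  rewrite -[RHS]/(fun_of_restr (comm (vres Xs`_i) (vres Xs`_j) (res U F)) y).
  by rewrite vres_lie_bracket; [| exact: vXi | exact: vXi].
by rewrite -[g (sval y)]/(res U g y) -restrM restr_sign.
Qed.

(** Constant coefficients v(x_i) are enough, the fields E_i being already defined on all of M. *)
Lemma vector_field_extension (z : {y | U y}) v : tangent (sval z) v ->
  exists2 X, vector_field X & vf_at (sval z) X = v.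
Proof.
move=> tv.
have sc (a : R) : smooth (cst a : M -> R).
  by move=> c ac k; apply: (Ck_cst k a); exact: cimg_open.
pose X F := \sum_i to_Cinf (cst (v (x i))) * E i F.
have XE F w : X F w = \sum_i v (x i) * E i F w.
  rewrite /X; elim: (index_enum _) => [|i r IH]; first by rewrite !big_nil Cinf0.
  by rewrite !big_cons CinfD CinfM IH to_CinfE.
exists X => [w|].
  have -> : vf_at w X = fun F => \sum_i v (x i) * E i F w.
    by apply/funext => F; exact: XE.
  elim: (index_enum _) => [|i r IH].
    by under eq_fun do rewrite big_nil; exact: tangent0.
  by under eq_fun do rewrite big_cons; apply: tangent_comb => //; exact: (frame_vf fr).
apply/funext => F; rewrite /vf_at XE (tangent_frame fr F (svalP z) tv).
by [].
Qed.

Lemma vector_fields_extension (y : {y | U y}) vs : alls (tangent (sval y)) vs ->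
  exists2 Xs, alls (@vector_field R n M) Xs & map (vf_at (sval y)) Xs = vs.
Proof.
elim: vs => [|v vs IH] /=; first by exists [::].
by move=> [/vector_field_extension[X vX <-] /IH[Xs vXs <-]]; exists (X :: Xs).
Qed.

(** Every extension of the vectors gives the same value, by [kosz_flat], so it does not matter which
    one the choice in [extd] returns. *)
Lemma extd_flat k eta A (y : {y | U y}) vs : multivector k A ->
  eq_form (n - k) eta (mu_flat mu k A) -> alls (tangent (sval y)) vs ->
  (k + size vs)%N = n.+1 ->
  extd eta (sval y) vs = g (sval y) * wdgs vs (pull y (rD (mvU k A))) xs.
Proof.
move=> mA etaE tv kv; rewrite /extd; set S := [set r | _].
have val Xs : vector_fields (size vs) Xs -> map (vf_at (sval y)) Xs = vs ->
    koszul eta Xs (sval y) = g (sval y) * wdgs vs (pull y (rD (mvU k A))) xs.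
  move=> [Xk vX] Xvs; have {}vX : alls (@vector_field R n M) Xs.
    by apply: (nth_alls (t0 := 0)) => i; rewrite Xk; exact: vX.
  rewrite (koszul_res y mA etaE vX) ?Xk //.
  have kA := mvres_kvec fr mA.
  have dXs : alls (der (rE E) (rx U x)) (map (@vres _ _ _ U) Xs).
    elim: Xs vX {Xk Xvs} => //= X Xs IH [vX /IH]; split=> //; exact: (vres_der fr vX).
  rewrite (kosz_flat (@restr_torsion_free _ _ _ U) (rE_derivation fr) res_gh kA dXs) ?size_map ?Xk //.
  have := congr1 (fun B => B xs) (pull_wdgs y (rD (mvU k A)) oU vX).
  by rewrite Xvs restrM resE => <-; rewrite /pull rxsE.
have : S (get S).
  apply: getPex; have [Xs vXs Xvs] := vector_fields_extension tv.
  exists (koszul eta Xs (sval y)); exists Xs; split=> //.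
  split; first by rewrite -Xvs size_map.
  by move=> i iv; apply: (alls_nth 0 vXs); rewrite -(size_map (vf_at (sval y))) Xvs.
by move=> [Xs [vXs Xvs ->]]; exact: val.
Qed.

(** Stated for single k-vectors, to compare pointwise choices as well as fields. Above degree n all
    k-vectors vanish, so contractions are compared only for k at most n. *)
Lemma mu_sharp_unique k w w' (y : {y | U y}) :
  kvector (sval y) k w -> kvector (sval y) k w' ->
  ((k <= n)%N -> forall vs, tangents (sval y) (n - k) vs ->
     flat_pt k w (sval y) vs = flat_pt k w' (sval y) vs) ->
  forall F, size F = k -> w F = w' F.
Proof.
move=> kw kw' ww'.
have kt := kvector_kvec fr kw; have kt' := kvector_kvec fr kw'.
have kd := kvecD kt (kvecN kt').
suff d0 F : trunc k w F - trunc k w' F = 0.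
  move=> F Fk; have := d0 F; rewrite /trunc Fk eqxx => /eqP.
  by rewrite subr_eq0 => /eqP.
have [kn|nk] := leqP k n; last first.
  by apply: (kvec_top (@real_torsion_free R) kd (ltnW nk)) => /eqP nk'; rewrite nk' ltnn in nk.
apply: (wdgs_inj (@real_torsion_free R) (fd_x fr y) (subnKC kn) kd) => vs vk dvs.
have tvs : tangents (sval y) (n - k) vs.
  by apply/tangentsP; split=> //; apply/(alls_tangent fr).
have g0 : g (sval y) != 0.
  apply/eqP => g0; have := volume_frame_inverse vfr (svalP y).
  by rewrite g0 mul0r => /eqP; rewrite eq_sym oner_eq0.
apply: (mulfI g0); rewrite mulr0 wdgs_D wdgs_N mulrDr mulrN.
by rewrite -(flat_ptE vfr) // -(flat_ptE vfr) // ww' // subrr.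
Qed.

End VolumeFrame.
End VolumeForm.

(** * Existence and local form of the curl and of the modular field *)

Section Curl.
Variables (R : realType) (n : nat) (M : manifold R n) (mu : dform M).
Hypothesis Hmu : volume_form mu.

Section AtFrame.
Variables (U : set M) (E : 'I_n -> Cinf M -> Cinf M) (x : 'I_n -> Cinf M).
Variables (g h : Cinf M).
Hypothesis vfr : volume_frame mu U E x g h.

Let fr := volume_frame_frame vfr.
Notation mvU := (@mvres R n M U).
Notation rD := (D (rE E) (rx U x) (res U g) (res U h)).

Lemma curl_at_kvec a A (y : {y | U y}) : multivector a.+1 A ->
  kvec (fd E y) x a (pull y (rD (mvU a.+1 A))).
Proof.
move=> mA; apply: (pull_kvec fr).
exact: (D_kvec _ _ (@restr_torsion_free _ _ _ U) (rE_derivation fr) (rE_comm fr)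
  (mvres_kvec fr mA)).
Qed.

Lemma curl_at a A (y : {y | U y}) : (a <= n)%N -> multivector a.+1 A ->
  kvector (sval y) a (pull y (rD (mvU a.+1 A))) /\
  forall vs, tangents (sval y) (n - a) vs ->
    flat_pt mu a (pull y (rD (mvU a.+1 A))) (sval y) vs =
    extd (mu_flat mu a.+1 A) (sval y) vs.
Proof.
move=> an mA; have kD := curl_at_kvec y mA.
have kv := kvec_kvector fr kD (fun F _ => erefl); split=> // vs tvs.
have [vk _] := tvs; have /tangentsP[_ tv] := tvs.
rewrite (extd_flat Hmu vfr mA (fun _ _ _ => erefl) tv); last by rewrite vk; lia.
rewrite (flat_ptE Hmu vfr an kv tvs); congr (_ * wdgs _ _ _).
apply/funext => F; rewrite /trunc; case: eqP => // /eqP Fa.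
by have [_ -> //] := kD.
Qed.

End AtFrame.

Lemma multivector0 k : multivector k (fun=> 0 : Cinf M).
Proof.
move=> z; exists [::]; split=> // F _.
by rewrite big_nil /mv_at Cinf0.
Qed.

(** Serves the curl in degrees a > n, where the truncated n - a is 0 and the form is evaluated on no
    vectors. *)
Lemma extd_nil (eta : dform M) z : extd eta z [::] = 0.
Proof.
rewrite /extd; set S := [set r | _].
have : S (get S).
  by apply: getPex; exists (koszul eta [::] z); exists [::]; split=> //; split.
move=> [Xs [[X0 _] _ ->]]; rewrite (size0nil X0) /koszul /=.
by rewrite !big_ord0 addr0.
Qed.

(* Glues the local curls: at a point they do not depend on the frame, because a
   multivector is determined by its contraction with [mu]. *)
Lemma curl_exists a A : multivector a.+1 A -> exists B,
  multivector a B /\ eq_form (n - a) (mu_flat mu a B) (extd (mu_flat mu a.+1 A)).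
Proof.
move=> mA; have [an|na] := leqP a n; last first.
  exists (fun=> 0); split; first exact: multivector0.
  move=> z vs [vs0 _]; have -> : vs = [::] by apply: size0nil; rewrite vs0; lia.
  by rewrite extd_nil /mu_flat /contract leqNgt na.
have /choice[w wP] : forall z, exists w, kvector z a w /\
    forall vs, tangents z (n - a) vs ->
      flat_pt mu a w z vs = extd (mu_flat mu a.+1 A) z vs.
  move=> z; have [U [E [x [g [h [Uz vfr]]]]]] := exists_volume_frame Hmu z.
  exists (pull (exist _ z Uz) (D (rE E) (rx U x) (res U g) (res U h) (mvres a.+1 A))).
  exact: (curl_at vfr (exist _ z Uz)).
(* The choices at nearby points are unrelated, but by uniqueness they all agree with the curl
   computed in one frame, which is smooth. *)
have sw F : smooth (fun z => trunc a (w z) F).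
  apply: smooth_near => z.
  have [U [E [x [g [h [Uz vfr]]]]]] := exists_volume_frame Hmu z.
  exists (lift (D (rE E) (rx U x) (res U g) (res U h) (mvres a.+1 A) (map (res U) F))).
  have oU := frame_open (volume_frame_frame vfr).
  apply: filterS (open_nbhs_nbhs (conj oU Uz)) => p Up.
  rewrite -[p]/(sval (exist U p Up)) liftE /trunc; case: eqP => [Fa|/eqP Fa].
    have [kw fw] := wP p; have [kD fD] := curl_at vfr (exist _ p Up) an mA.
    apply: (mu_sharp_unique Hmu vfr (y := exist U p Up) kw kD _ Fa) => _ vs tvs.
    by rewrite fw // fD.
  have [_ h0 _] := curl_at_kvec vfr (exist _ p Up) mA.
  by have := h0 F Fa; rewrite /pull => ->.
exists (fun F => to_Cinf (fun z => trunc a (w z) F)).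
have BE z F : size F = a -> to_Cinf (fun z => trunc a (w z) F) z = w z F.
  by move=> Fa; rewrite to_CinfE // /trunc Fa eqxx.
split=> z.
  have [[l [tl lE]] _] := wP z; exists l; split=> // F Fa.
  by rewrite /mv_at BE // lE.
move=> vs tvs; rewrite /mu_flat /contract an.
have [_ <- //] := wP z; rewrite /flat_pt; congr (pairing _ _ _ _).
apply/funext => F; rewrite !wedge_wdg; congr (wdg _ _ _).
apply/funext => G; rewrite /trunc; case: eqP => // Ga.
by rewrite /mv_at BE.
Qed.

Lemma curlP a A : multivector a.+1 A -> multivector a (curl mu a.+1 A) /\
  eq_form (n - a) (mu_flat mu a (curl mu a.+1 A)) (extd (mu_flat mu a.+1 A)).
Proof.
move=> /curl_exists[B BP]; rewrite /curl /mu_sharp.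
exact: (@xgetPex _ (fun=> 0) [set B : mvfield M | multivector a B /\
  eq_form (n - a) (mu_flat mu a B) (extd (mu_flat mu a.+1 A))] (ex_intro _ B BP)).
Qed.

Lemma curl_res (U : set M) E x g h a A : volume_frame mu U E x g h ->
  multivector a.+1 A ->
  mvres a (curl mu a.+1 A) = D (rE E) (rx U x) (res U g) (res U h) (mvres a.+1 A).
Proof.
move=> vfr mA; have fr := volume_frame_frame vfr; have [mC flatC] := curlP mA.
apply/funext => s; apply: restr_inj => y; rewrite -(map_res_lift s).
set F := map _ s.
rewrite -[LHS]/(pull y (mvres a (curl mu a.+1 A)) F) (pull_mvres fr) //.
rewrite -[RHS]/(pull y (D (rE E) (rx U x) (res U g) (res U h) (mvres a.+1 A)) F).
have kD := curl_at_kvec vfr y mA; rewrite /trunc; case: eqP => [Fa|/eqP Fa]; last first.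
  by have [_ -> //] := kD.
have kv := kvec_kvector fr kD (fun F _ => erefl).
apply: (mu_sharp_unique Hmu vfr (mC (sval y)) kv _ Fa) => an vs tvs.
have [_ ->//] := curl_at vfr y an mA.
by have := flatC _ _ tvs; rewrite /mu_flat /contract an.
Qed.

Lemma multivector1 : multivector 0 (fun=> 1 : Cinf M).
Proof.
move=> z; exists [:: (1, [::])]; split=> [t|F /size0nil->].
  by rewrite inE => /eqP->.
by rewrite big_seq1 /mv_at Cinf1 wedge_vectors_dw // mulr1.
Qed.

(** Writing mu as i(1) mu puts d mu within reach of [extd_flat]. *)
Lemma mu_flat_one : eq_form (n - 0) mu (mu_flat mu 0 (fun=> 1)).
Proof.
move=> z vs tvs; have [U [E [x [g [h [Uz vfr]]]]]] := exists_volume_frame Hmu z.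
have fr := volume_frame_frame vfr; have [[amu _] _] := Hmu.
pose y : {y | U y} := exist _ z Uz.
rewrite (mu_flatE Hmu vfr (y := y) (leq0n n) multivector1 tvs).
rewrite (pull_mvres fr _ multivector1) -wdg_dw.
have -> : trunc 0 (mv_at (fun=> 1) (sval y)) = @eps _ _.
  by apply/funext => -[|F s]; rewrite /trunc //= /mv_at Cinf1.
rewrite eps_wdg; rewrite subn0 in tvs.
by rewrite (alternating_top fr (y := y) (amu z) tvs) (volume_frame_density vfr Uz).
Qed.

(** d mu = i(C 1) mu, and the curl of a function is 0. *)
Lemma extd_mu z vs : tangents z n.+1 vs -> extd mu z vs = 0.
Proof.
move=> /tangentsP[vn tv]; have [U [E [x [g [h [Uz vfr]]]]]] := exists_volume_frame Hmu z.
have fr := volume_frame_frame vfr.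
rewrite (extd_flat Hmu vfr (y := exist _ z Uz) multivector1 mu_flat_one tv) ?vn //.
have -> : D (rE E) (rx U x) (res U g) (res U h) (mvres 0 (fun=> 1)) = fun=> 0.
  apply/funext => s; apply: big1 => i _; rewrite /mvres size_rcons /=.
  by rewrite (derivation0 (rE_derivation fr i)) mulr0 addr0.
have -> : pull (exist _ z Uz) (fun=> 0 : restr U) = fun F => 0 * @eps _ _ F.
  by apply/funext => F; rewrite /pull restr0 mul0r.
by rewrite wdgs_Z mul0r mulr0.
Qed.

Variable Pi : mvfield M.
Hypothesis mPi : multivector 2 Pi.

Lemma lie_PiE : eq_form (n - 1) (lie_Pi Pi n mu)
  (fun z vs => - extd (mu_flat mu 2 Pi) z vs).
Proof.
move=> z vs tvs; rewrite /lie_Pi -[RHS]add0r; congr (_ - _).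
rewrite /contract; case: ifP => // n1.
have [U [E [x [g [h [Uz vfr]]]]]] := exists_volume_frame Hmu z.
have fr := volume_frame_frame vfr; pose y : {y | U y} := exist _ z Uz.
have [vn _] := tvs; have /tangentsP[_ /(alls_tangent fr y) dvs] := tvs.
have n12 : (n.+1 - 2 = n - 1)%N by lia.
have kw := wdg_kvec (kvector_kvec fr (mPi (sval y))) (dw_kvec dvs).
have {kw} kw : kvec (fd E y) x n.+1 (wdg (trunc 2 (mv_at Pi z)) (dw vs)).
  by rewrite vn (_ : 2 + (n - 1) = n.+1)%N in kw; last by lia.
have [F Fn|l0 dl0] := kvec_decomposition_of fr (w := wedge 2 (n.+1 - 2) (mv_at Pi z)
    (wedge_vectors vs)) kw.
  rewrite wedge_wdg; congr (wdg _ _ _); apply/funext => G; rewrite /trunc.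
  case: eqP => [Gn|/eqP Gn]; first by rewrite wedge_vectors_dw // vn -n12.
  by rewrite dw_hom // vn -n12.
(* Any decomposition writes i(Pi) d mu as a combination of values of d mu on n + 1 vectors, all 0;
   one has to be exhibited for the choice to be meaningful. *)
rewrite /pairing; set S := [set r | _].
have : S (get S).
  by apply: getPex; exists (\sum_(t <- l0) t.1 * extd mu z t.2); exists l0.
move=> [l [tl _] ->]; rewrite big_seq big1 // => t /tl tt.
by rewrite extd_mu // mulr0.
Qed.

Lemma modular_fieldP : multivector 1 (modular_field Pi mu) /\
  eq_form (n - 1) (lie_Pi Pi n mu) (mu_flat mu 1 (modular_field Pi mu)).
Proof.
suff ex : exists Xi : mvfield M, multivector 1 Xi /\
    eq_form (n - 1) (lie_Pi Pi n mu) (contract n 1 Xi mu).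
  exact: (@xgetPex _ (fun=> 0) [set Xi : mvfield M | multivector 1 Xi /\
    eq_form (n - 1) (lie_Pi Pi n mu) (contract n 1 Xi mu)] ex).
have [mC flatC] := curlP mPi; set B := curl mu 2 Pi in mC flatC.
have mN : multivector 1 (fun F => - B F).
  move=> z; have [U [E [x [g [h [Uz vfr]]]]]] := exists_volume_frame Hmu z.
  have fr := volume_frame_frame vfr; pose y : {y | U y} := exist _ z Uz.
  apply: (kvec_kvector fr (y := y) (kvecN (kvector_kvec fr (mC (sval y))))) => F F1.
  by rewrite /trunc F1 eqxx; exact: CinfN.
exists (fun F => - B F); split=> // z vs tvs; rewrite (lie_PiE tvs) -(flatC _ _ tvs).
rewrite -[RHS]/(mu_flat mu 1 (fun F => - B F) z vs).
(* In dimension 0 the contraction of mu with a vector field is 0 by definition. *)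
have [n1|n0] := leqP 1 n; last first.
  by rewrite /mu_flat /contract leqNgt n0 /= oppr0.
have [U [E [x [g [h [Uz vfr]]]]]] := exists_volume_frame Hmu z.
have fr := volume_frame_frame vfr; pose y : {y | U y} := exist _ z Uz.
rewrite (mu_flatE Hmu vfr (y := y) n1 mC tvs) (mu_flatE Hmu vfr (y := y) n1 mN tvs).
rewrite !(pull_mvres fr) // -mulrN; congr (_ * _).
rewrite -[LHS]/((fun F => - wdgs vs (trunc 1 (mv_at B (sval y))) F) _) -wdgs_N.
congr (wdgs _ _ _); apply/funext => F; rewrite /trunc; case: eqP => // _.
by rewrite oppr0.
Qed.

Lemma modular_field_res (U : set M) E x g h s : volume_frame mu U E x g h ->
  mvres 1 (modular_field Pi mu) s =
  lin1 (Xi (rE E) (rx U x) (res U g) (res U h) (mvres 2 Pi)) s.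
Proof.
move=> vfr; have fr := volume_frame_frame vfr; have [mX lieX] := modular_fieldP.
have [mC flatC] := curlP mPi.
case: s => [|b [|c s]] //; apply: restr_inj => y.
have -> : lin1 (Xi (rE E) (rx U x) (res U g) (res U h) (mvres 2 Pi)) [:: b] =
    - mvres 1 (curl mu 2 Pi) [:: b] by rewrite (curl_res vfr mPi).
rewrite restrN; have kC := kvecN (kvector_kvec fr (mC (sval y))).
have kvC : kvector (sval y) 1 (fun F => - mv_at (curl mu 2 Pi) (sval y) F).
  apply: (kvec_kvector fr kC) => F F1; by rewrite /trunc F1 eqxx.
suff flat_eq : (1 <= n)%N -> forall vs, tangents (sval y) (n - 1) vs ->
    flat_pt mu 1 (mv_at (modular_field Pi mu) (sval y)) (sval y) vs =
    flat_pt mu 1 (fun F => - mv_at (curl mu 2 Pi) (sval y) F) (sval y) vs.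
  exact: (mu_sharp_unique Hmu vfr (mX (sval y)) kvC flat_eq (erefl : size [:: lift b] = 1)).
move=> n1 vs tvs.
have := lieX _ _ tvs; rewrite (lie_PiE tvs) -(flatC _ _ tvs) /mu_flat /contract n1.
rewrite -[pairing _ _ _ _]/(flat_pt mu 1 (mv_at (curl mu 2 Pi) (sval y)) (sval y) vs).
rewrite -[in RHS]/(flat_pt mu 1 _ (sval y) vs) => <-.
rewrite (flat_ptE Hmu vfr n1 (mC (sval y)) tvs) (flat_ptE Hmu vfr n1 kvC tvs).
rewrite -mulrN; congr (_ * _).
rewrite -[LHS]/((fun F => - wdgs vs (trunc 1 (mv_at (curl mu 2 Pi) (sval y))) F) _) -wdgs_N.
by congr (wdgs _ _ _); apply/funext => F; rewrite /trunc; case: eqP => // _; rewrite oppr0.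
Qed.

Lemma partial_res (U : set M) E x a A F : frame U E x -> multivector a A ->
  res U (partial Pi a A F) = dPi (mvres 2 Pi) a (mvres a A) (map (res U) F).
Proof.
move=> fr mA; rewrite /partial resN (res_schouten fr) // /bra /dPi.
congr (- (_ + _)); rewrite -mulNr; congr (_ * _).
by rewrite -signr_odd oddM /= andbT -[in RHS]signr_odd; case: (odd a); rewrite ?opprK.
Qed.

Lemma partial_multivector a A : multivector a A -> multivector a.+1 (partial Pi a A).
Proof.
move=> mA z; have [U [E [x [Uz fr]]]] := exists_frame z.
pose y : {y | U y} := exist _ z Uz.
have kP := dPi_kvec (rE_derivation fr) (rE_comm fr)
  (mvres_kvec fr mPi) (mvres_kvec fr mA).
apply: (kvec_kvector fr (pull_kvec fr y kP)) => F Fa.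
by rewrite /pull -(partial_res _ fr mA).
Qed.

Lemma mvres_partial (U : set M) E x a A : frame U E x -> multivector a A ->
  mvres a.+1 (partial Pi a A) = dPi (mvres 2 Pi) a (@mvres _ _ _ U a A).
Proof.
move=> fr mA; apply/funext => s; rewrite /mvres; case: eqP => [sa|/eqP sa].
  by rewrite (partial_res _ fr mA) map_res_lift.
have [_ -> //] := dPi_kvec (rE_derivation fr) (rE_comm fr)
  (mvres_kvec fr mPi) (mvres_kvec fr mA).
Qed.

Theorem modular_op_schouten a A F : multivector a A -> size F = a ->
  modular_op Pi mu a A F = (-1) ^+ a * schouten 1 a (modular_field Pi mu) A F.
Proof.
(* The two global functions are compared at z through their restrictions to a volume frame around
   z. *)
move=> mA Fa; apply: Cinf_inj => z.
have [U [E [x [g [h [Uz vfr]]]]]] := exists_volume_frame Hmu z.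
have fr := volume_frame_frame vfr; pose y : {y | U y} := exist _ z Uz.
rewrite -[LHS]/(res U (modular_op Pi mu a A F) y).
rewrite -[RHS]/(res U ((-1) ^+ a * schouten 1 a (modular_field Pi mu) A F) y).
congr (fun_of_restr _ y).
have [mX _] := modular_fieldP; have kA := mvres_kvec fr mA.
have kPi := mvres_kvec fr mPi.
have rs : size (map (res U) F) = a by rewrite size_map.
rewrite res_sign (res_schouten fr) // /bra.
have -> : mvres 1 (modular_field Pi mu) =
    lin1 (Xi (rE E) (rx U x) (res U g) (res U h) (mvres 2 Pi)).
  by apply/funext => s; exact: modular_field_res.
(* The exponent (1 + 1)(a + 1) is even, so the bracket with Xi is the Lie derivative along it. *)
have sgn : (-1) ^+ (2 * a.+1) = 1 :> restr U by rewrite exprM sqrrN !expr1n.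
rewrite br_lin1_l (br_lin1 (rE_derivation fr) _ _ kA) sgn mul1r.
have := modular_identity (@restr_torsion_free _ _ _ U) (rE_derivation fr) (rE_comm fr)
  (res_gh vfr) kPi kA rs.
rewrite /Lie => <-.
have mP := partial_multivector mA.
rewrite /modular_op resD resN; congr (_ - _).
  have := curl_res vfr mP => /(congr1 (fun B => B (map (res U) F))).
  rewrite (mvres_res fr _ (curlP mP).1) Fa eqxx => ->.
  by rewrite (mvres_partial fr mA).
(* For a = 0 the operator [partial] is taken in degree [0.-1], which is 0 and not -1. On the zero
   field and the empty sequence it still gives 0, there being no (0, 1)-shuffle of an empty set. *)
clear sgn; case: a => [|a] in mA Fa kA rs mP *.
  rewrite (size0nil Fa) /partial /schouten /=.
  rewrite big_pred0 => [|s]; last by apply/negP => /shuffleP[].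
  rewrite mulr0 subr0 oppr0 res0.
  have -> : D (rE E) (rx U x) (res U g) (res U h) (mvres 0 A) = fun=> 0.
    apply/funext => s; apply: big1 => i _; rewrite /mvres size_rcons /=.
    by rewrite (derivation0 (rE_derivation fr i)) mulr0 addr0.
  by rewrite /dPi br_0l (br_0 (rE_derivation fr) _ kPi) mulr0 addr0 oppr0.
by rewrite (partial_res _ fr (curlP mA).1) (curl_res vfr mA).
Qed.

End Curl.

Theorem mainTheorem5 (R : realType) (n : nat) (P : manifold R n)
    (HP : oriented P) (Pi : mvfield P) (HPi : poisson Pi)
    (mu : dform P) (Hmu : volume_form mu)
    (a : nat) (A : mvfield P) (HA : multivector a A)
    (F : seq (Cinf P)) (HF : size F = a) :
  modular_op Pi mu a A F =
    curl mu a.+1 (partial Pi a A) F - partial Pi a.-1 (curl mu a A) F /\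
  modular_op Pi mu a A F = (-1) ^+ a * schouten 1 a (modular_field Pi mu) A F.
Proof.
split=> //; have [mPi _] := HPi.
exact: modular_op_schouten.
Qed.
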